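(* Any finite-dimensional irreducible (real) contact Lie algebra is isomorphic, as a filtered Lie algebra, to one and only one of the following. (I) One of the following graded Lie subalgebras $\mathfrak h$ of the Lie algebra $\mathfrak g(\mathfrak n)$ of polynomials in $x,y,z$ (see context), viewed as a filtered Lie algebra, where $\langle\dots\rangle$ denotes real linear span: 1. $\langle 1,x,y,z,x^2,xz,z^2,x(2y-xz),z(2y-xz),(2y-xz)^2\rangle$; 2. $\langle 1,x,y,z,x^2,xz,z^2\rangle$; 3. $\langle 1,x,z,x^2,xz,z^2\rangle$; 4. $\langle 1,x,z,x^2+z^2,2y-xz,\ x(x^2+z^2)-2z(2y-xz),\ z(x^2+z^2)+2x(2y-xz),\ (x^2+z^2)^2+4(2y-xz)^2\rangle$; 5. $\langle 1,x,z,x^2+z^2,2y-xz\rangle$; 6. $\langle 1,x,z,x^2+z^2+\alpha(2y-xz)\rangle$, with a parameter $\alpha\in\mathbb R$, $\alpha\ge 0$ (distinct values of $\alpha$ being distinct members of the list). (II.1) $\mathfrak g=\mathfrak{gl}(2,\mathbb R)$, with $\mathfrak g_p=\mathfrak g$ for $p\le -2$, $\mathfrak g_p=\{0\}$ for $p\ge 1$, and $$\mathfrak g_0=\left\{\begin{pmatrix} x & x\\ -x & x\end{pmatrix} : x\in\mathbb R\right\},\qquad \mathfrak g_{-1}=\left\{\begin{pmatrix} x+y & x+z\\ z-x & x-y\end{pmatrix} : x,y,z\in\mathbb R\right\}.$$ (II.2) $\mathfrak g=\mathfrak u(2)$ (skew-Hermitian complex $2\times 2$ matrices, as a real Lie algebra),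 with $\mathfrak g_p=\mathfrak g$ for $p\le -2$, $\mathfrak g_p=\{0\}$ for $p\ge 1$, and $$\mathfrak g_0=\left\{\begin{pmatrix} ix & x\\ -x & ix\end{pmatrix} : x\in\mathbb R\right\},\qquad \mathfrak g_{-1}=\left\{\begin{pmatrix} ix+iy & x+iz\\ iz-x & ix-iy\end{pmatrix} : x,y,z\in\mathbb R\right\}.$$
   Context: All Lie algebras are over $\mathbb R$. A filtered Lie algebra is a Lie algebra $\mathfrak g$ with a decreasing family of subspaces $\{\mathfrak g_p\}_{p\in\mathbb Z}$ such that $[\mathfrak g_p,\mathfrak g_q]\subset\mathfrak g_{p+q}$ for all $p,q$. An isomorphism of filtered Lie algebras is a Lie algebra isomorphism carrying the $p$-th filtration subspace onto the $p$-th filtration subspace for every $p$. A filtered Lie algebra $\mathfrak g$ is called a contact Lie algebra if (a) $\mathfrak g_p=\mathfrak g$ for all $p\le -2$; (b) $\operatorname{codim}_{\mathfrak g}\mathfrak g_{-1}=1$, $\operatorname{codim}_{\mathfrak g}\mathfrak g_0=3$, and $[\mathfrak g_{-1},\mathfrak g_{-1}]+\mathfrak g_{-1}=\mathfrak g$; (c) $\mathfrak g_{p+1}=\{x\in\mathfrak g_p : [x,\mathfrak g_{-1}]\subset\mathfrak g_p\}$ for all $p\ge 0$; (d) $\bigcap_{p\in\mathbb Z}\mathfrak g_p=\{0\}$. It is called irreducible if the $\mathfrak g_0$-module $\mathfrak g_{-1}/\mathfrak g_0$ is irreducible. The graded Lie algebra $\mathfrak g(\mathfrak n)$: for a smooth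 function $f(x,y,z)$ put $$X_f=-\frac{\partial f}{\partial z}\frac{\partial}{\partial x}+\left(f-z\frac{\partial f}{\partial z}\right)\frac{\partial}{\partial y}+\left(\frac{\partial f}{\partial x}+z\frac{\partial f}{\partial y}\right)\frac{\partial}{\partial z}.$$ The underlying space of $\mathfrak g(\mathfrak n)$ is the space of real polynomials in $x,y,z$, with bracket $\{f,g\}=\omega([X_f,X_g])$, $\omega=dy-z\,dx$ (equivalently $X_{\{f,g\}}=[X_f,X_g]$). Give $x,y,z$ the degrees $1,2,1$ respectively; then $\mathfrak g_p(\mathfrak n)$ is the space of homogeneous polynomials of weighted degree $p+2$, and $\mathfrak g(\mathfrak n)=\bigoplus_{p\ge -2}\mathfrak g_p(\mathfrak n)$. A graded Lie algebra $\mathfrak h=\bigoplus_p\mathfrak h_p$ is viewed as a filtered Lie algebra through the filtration whose $p$-th subspace is $\bigoplus_{q\ge p}\mathfrak h_q$. *)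

(* Defs.v *)
From HB Require Import structures.
From mathcomp Require Import all_boot all_order all_algebra.
From mathcomp Require Import classical_sets reals.
From mathcomp Require Import complex ring_quotient generic_quotient.
From mathcomp Require Import mpoly.
From mathcomp Require Import ring.

Set Implicit Arguments.
Unset Strict Implicit.
Unset Printing Implicit Defensive.

Import Order.TTheory GRing.Theory Num.Theory.
Local Open Scope classical_set_scope.
Local Open Scope ring_scope.

HB.mixin Record isLieAlgebra (R : pzRingType) L of GRing.Lmodule R L := {
  lie : L -> L -> L;
  lie_linearl : forall y, linear (lie^~ y);
  lie_linearr : forall x, linear (lie x);
  lie_alt : forall x, lie x x = 0;
  lie_jacobi : forall x y z,
    lie x (lie y z) + lie y (lie z x) + lie z (lie x y) = 0
}.

#[short(type="lieAlgType")]
HB.structure Definition LieAlgebra (R : pzRingType) :=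
  {L of isLieAlgebra R L & GRing.Lmodule R L}.

#[short(type="finLieAlgType")]
HB.structure Definition FinLieAlgebra (R : nzRingType) :=
  {L of LieAlgebra R L & Vector R L}.

Section QuotientSpace.
Variables (K : fieldType) (V : vectType K) (U : {vspace V}).
Local Open Scope quotient_scope.

Definition quotv := Quotient.quot U.
HB.instance Definition _ := GRing.Zmodule.on quotv.

Definition pi_quotv (v : V) : quotv := \pi_quotv v.

Lemma pi_quotv_eq u v : (pi_quotv u == pi_quotv v) = (u - v \in U).
Proof. by rewrite /pi_quotv -Quotient.idealrBE. Qed.

Lemma repr_quotv v : repr (pi_quotv v) - v \in U.
Proof. by rewrite -pi_quotv_eq /pi_quotv reprK. Qed.

Lemma pi_quotvD u v : pi_quotv (u + v) = pi_quotv u + pi_quotv v.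
Proof. by rewrite /pi_quotv !piE. Qed.

Definition quotv_scale a (q : quotv) := pi_quotv (a *: repr q).

Lemma pi_quotvZ a v : pi_quotv (a *: v) = quotv_scale a (pi_quotv v).
Proof.
apply/eqP; rewrite pi_quotv_eq -scalerBr -opprB scalerN rpredN.
exact/memvZ/repr_quotv.
Qed.

Lemma quotvP (q : quotv) : exists v, q = pi_quotv v.
Proof. by exists (repr q); rewrite /pi_quotv reprK. Qed.

Lemma quotv_scaleA a b q :
  quotv_scale a (quotv_scale b q) = quotv_scale (a * b) q.
Proof. by have [v ->] := quotvP q; rewrite -!pi_quotvZ scalerA. Qed.
Lemma quotv_scale1 : left_id 1 quotv_scale.
Proof. by move=> q; have [v ->] := quotvP q; rewrite -pi_quotvZ scale1r. Qed.
Lemma quotv_scaleDr : right_distributive quotv_scale +%R.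
Proof.
move=> a q r; have [u ->] := quotvP q; have [v ->] := quotvP r.
by rewrite -pi_quotvD -!pi_quotvZ scalerDr pi_quotvD.
Qed.
Lemma quotv_scaleDl q : {morph quotv_scale^~ q : a b / a + b}.
Proof.
move=> a b; have [v ->] := quotvP q.
by rewrite -!pi_quotvZ scalerDl pi_quotvD.
Qed.
HB.instance Definition _ := GRing.Zmodule_isLmodule.Build K quotv
  quotv_scaleA quotv_scale1 quotv_scaleDr quotv_scaleDl.

End QuotientSpace.
Arguments pi_quotv {K V} U v.

Section Filtered.
Variables (K : fieldType) (g : finLieAlgType K).
Implicit Types (U V W : {vspace g}) (F : int -> {vspace g}).

Definition liev U V : {vspace g} :=
  <<[seq lie u v | u <- vbasis U, v <- vbasis V]>>%VS.

Lemma lievP U V W :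
  reflect (forall u v, u \in U -> v \in V -> lie u v \in W) (liev U V <= W)%VS.
Proof.
apply: (iffP span_subvP) => [UVW u v uU vV | UVW _ /allpairsP[[u v] /= [uU vV ->]]];
  last by apply: UVW; apply: vbasis_mem.
pose lu y : {linear g -> g} :=
  HB.pack (lie^~ y) (GRing.isLinear.Build _ _ _ _ _ (lie_linearl y)).
pose lv x : {linear g -> g} :=
  HB.pack (lie x) (GRing.isLinear.Build _ _ _ _ _ (lie_linearr x)).
rewrite (coord_vbasis uU) -[lie _ v]/(lu v _) linear_sum.
apply: memv_suml => i _; rewrite linearZ /=; apply: memvZ.
rewrite (coord_vbasis vV) -[lie _ _]/(lv _ _) linear_sum.
apply: memv_suml => j _; rewrite linearZ /=; apply: memvZ.
by apply: UVW; apply: allpairs_f; apply: mem_nth; rewrite size_tuple.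
Qed.

Record filtered F : Prop := Filtered {
  filtered_decr : forall p q : int, p <= q -> (F q <= F p)%VS;
  filtered_lie : forall (p q : int) x y,
    x \in F p -> y \in F q -> lie x y \in F (p + q)
}.

Record contact F : Prop := Contact {
  contact_filtered : filtered F;
  contact_full : forall p : int, p <= -2 -> F p = fullv;
  contact_codim1 : \dim {: g} = (\dim (F (-1)%R) + 1)%N;
  contact_codim3 : \dim {: g} = (\dim (F 0%R) + 3)%N;
  contact_generate : (liev (F (-1)%R) (F (-1)%R) + F (-1)%R)%VS = fullv;
  contact_prolong : forall p : int, 0 <= p -> forall x,
    x \in F (p + 1) <->
    x \in F p /\ (forall y, y \in F (-1) -> lie x y \in F p);
  contact_sep : forall x, (forall p : int, x \in F p) -> x = 0
}.

(* The action of x on g / F 0; when x is in F 0, lie x preserves F 0 and the  *)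
(* choice of a representative is immaterial.                                  *)
Definition isotropy_act F (x : g) (q : quotv (F 0)) : quotv (F 0) :=
  pi_quotv (F 0) (lie x (repr q)).

(* The subspace F (-1) / F 0 of g / F 0.                                      *)
Definition isotropy_module F : set (quotv (F 0)) :=
  [set pi_quotv (F 0) v | v in [set` F (-1)]].
Arguments isotropy_module F : clear implicits.

Definition isotropy_submodule F (S : set (quotv (F 0))) : Prop :=
  [/\ S 0, (forall a u v, S u -> S v -> S (a *: u + v)),
      S `<=` isotropy_module F &
      forall x q, x \in F 0 -> S q -> S (isotropy_act x q)].

Definition irreducible F : Prop :=
  isotropy_module F <> [set 0] /\
  forall S : set (quotv (F 0)),
    isotropy_submodule S -> S = [set 0] \/ S = isotropy_module F.

End Filtered.

Section ContactPolynomials.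
Variable R : realType.

Definition contact_poly := {mpoly R[3]}.
HB.instance Definition _ := GRing.Lmodule.on contact_poly.
Implicit Types f g h : {mpoly R[3]}.

Definition ix : 'I_3 := @Ordinal 3 0 isT.
Definition iy : 'I_3 := @Ordinal 3 1 isT.
Definition iz : 'I_3 := @Ordinal 3 2 isT.
Definition px : {mpoly R[3]} := 'X_ix.
Definition py : {mpoly R[3]} := 'X_iy.
Definition pz : {mpoly R[3]} := 'X_iz.

(* A stands for the vector field A ix d/dx + A iy d/dy + A iz d/dz.           *)
Definition vfield := 'I_3 -> {mpoly R[3]}.

Definition vfield_lie (A B : vfield) : vfield := fun i =>
  \sum_j (A j * mderiv j (B i) - B j * mderiv j (A i)).

Definition contact_vfield f : vfield := fun i =>
  match val i with
  | 0%N => - mderiv iz f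
  | 1%N => f - pz * mderiv iz f
  | _ => mderiv ix f + pz * mderiv iy f
  end.

Definition omega (A : vfield) : {mpoly R[3]} := A iy - pz * A ix.

Definition poly_lie f g : {mpoly R[3]} :=
  omega (vfield_lie (contact_vfield f) (contact_vfield g)).

Lemma mderiv_var (i j : 'I_3) : mderiv i 'X_j = (i == j)%:R :> {mpoly R[3]}.
Proof.
rewrite mderivX mnmE eq_sym; case: eqP => [->|_]; last by rewrite scale0r.
by rewrite (_ : (_ - _)%MM = 0%MM) ?mpolyX0 ?scale1r //; apply/mnmP => k; rewrite !mnmE subnn.
Qed.

Lemma sum3 (V : zmodType) (F : 'I_3 -> V) :
  \sum_j F j = F ix + F iy + F iz.
Proof.
rewrite !big_ord_recr big_ord0 /= add0r.
by congr (F _ + F _ + F _); apply/val_inj.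
Qed.

Lemma poly_lieE f g : poly_lie f g =
  (mderiv ix f + pz * mderiv iy f) * mderiv iz g
  - (mderiv ix g + pz * mderiv iy g) * mderiv iz f
  + f * mderiv iy g - g * mderiv iy f.
Proof.
rewrite /poly_lie /omega /vfield_lie !sum3 /contact_vfield /=.
rewrite !(mderivN, mderivD, mderivB, mderivM) !mderiv_var /=.
rewrite ?(mderiv_comm ix iz) ?(mderiv_comm iy iz) ?(mderiv_comm ix iy).
ring.
Qed.

Lemma contact_vfield_lie f g :
  contact_vfield (poly_lie f g)
  =1 vfield_lie (contact_vfield f) (contact_vfield g).
Proof.
move=> i; rewrite /vfield_lie sum3 /contact_vfield poly_lieE.
case: i => -[|[|[|//]]] ? /=;
rewrite !(mderivN, mderivD, mderivB, mderivM) !mderiv_var /=;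
rewrite ?(mderiv_comm ix iz) ?(mderiv_comm iy iz) ?(mderiv_comm ix iy);
ring.
Qed.

Lemma poly_lie_linearl g : linear (poly_lie^~ g).
Proof.
move=> a f h; rewrite !poly_lieE !(mderivD, mderivZ) -!mul_mpolyC; ring.
Qed.

Lemma poly_lie_linearr f : linear (poly_lie f).
Proof.
move=> a g h; rewrite !poly_lieE !(mderivD, mderivZ) -!mul_mpolyC; ring.
Qed.

Lemma poly_lie_alt f : poly_lie f f = 0.
Proof. rewrite poly_lieE; ring. Qed.

Lemma poly_lie_jacobi f g h :
  poly_lie f (poly_lie g h) + poly_lie g (poly_lie h f)
  + poly_lie h (poly_lie f g) = 0.
Proof.
rewrite !poly_lieE !(mderivN, mderivD, mderivB, mderivM) !mderiv_var /=.
rewrite ?(mderiv_comm ix iz) ?(mderiv_comm iy iz) ?(mderiv_comm ix iy).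
move: (mderiv ix (mderiv ix f)) (mderiv iy (mderiv iy f))
  (mderiv iz (mderiv iz f)) (mderiv ix (mderiv iy f))
  (mderiv ix (mderiv iz f)) (mderiv iy (mderiv iz f)).
move: (mderiv ix (mderiv ix g)) (mderiv iy (mderiv iy g))
  (mderiv iz (mderiv iz g)) (mderiv ix (mderiv iy g))
  (mderiv ix (mderiv iz g)) (mderiv iy (mderiv iz g)).
move: (mderiv ix (mderiv ix h)) (mderiv iy (mderiv iy h))
  (mderiv iz (mderiv iz h)) (mderiv ix (mderiv iy h))
  (mderiv ix (mderiv iz h)) (mderiv iy (mderiv iz h)).
move: (mderiv ix f) (mderiv iy f) (mderiv iz f).
move: (mderiv ix g) (mderiv iy g) (mderiv iz g).
move: (mderiv ix h) (mderiv iy h) (mderiv iz h) pz => *.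
ring.
Qed.

HB.instance Definition _ := isLieAlgebra.Build R contact_poly
  poly_lie_linearl poly_lie_linearr poly_lie_alt poly_lie_jacobi.

(* Membership in g_p(n), for x, y, z of degrees 1, 2, 1.                      *)
Definition contact_homog (p : int) f : Prop :=
  forall m, m \in msupp f -> (m ix + 2 * m iy + m iz)%N%:Z = p + 2.

Definition poly_span (s : seq {mpoly R[3]}) : set contact_poly :=
  [set f | exists c : 'I_(size s) -> R, f = \sum_i c i *: s`_i].

(* The direct sum of the homogeneous components of H of degree at least p.    *)
Definition graded_filtration (H : set contact_poly) (p : int) :
    set contact_poly :=
  [set f | exists (n : nat) (u : nat -> contact_poly),
     (forall i, (i < n)%N -> H (u i) /\ contact_homog (p + i%:Z) (u i)) /\
     f = \sum_(i < n) u i].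

End ContactPolynomials.

Section Matrices.
Variable R : realType.
Local Open Scope complex_scope.

Definition mx2 (T : Type) (a b c d : T) : 'M[T]_2 :=
  \matrix_(i, j) if i == 0 then (if j == 0 then a else b)
                 else (if j == 0 then c else d).

Definition gl2 := 'M[R]_2.
HB.instance Definition _ := GRing.Lmodule.on gl2.

Definition mx_lie {T : pzRingType} (A B : 'M[T]_2) : 'M[T]_2 :=
  A *m B - B *m A.

Lemma mx_lie_alt (T : pzRingType) (A : 'M[T]_2) : mx_lie A A = 0.
Proof. exact: subrr. Qed.

Lemma mx_lie_jacobi (T : comPzRingType) (A B C : 'M[T]_2) :
  mx_lie A (mx_lie B C) + mx_lie B (mx_lie C A) + mx_lie C (mx_lie A B) = 0.
Proof.
rewrite /mx_lie !mulmxBl !mulmxBr !mulmxA.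
move: (A *m B *m C) (A *m C *m B) (B *m C *m A) (B *m A *m C) => a b c d.
move: (C *m A *m B) (C *m B *m A) => e f.
apply/matrixP => i j; rewrite !mxE; ring.
Qed.

Lemma mx_lie_linearl (T : comPzRingType) (B : 'M[T]_2) : linear (mx_lie^~ B).
Proof.
move=> a A C; rewrite /mx_lie mulmxDl mulmxDr -scalemxAl -scalemxAr.
by rewrite scalerBr opprD addrACA.
Qed.

Lemma mx_lie_linearr (T : comPzRingType) (B : 'M[T]_2) : linear (mx_lie B).
Proof.
move=> a A C; rewrite /mx_lie mulmxDl mulmxDr -scalemxAl -scalemxAr.
by rewrite scalerBr opprD addrACA.
Qed.

HB.instance Definition _ := isLieAlgebra.Build R gl2
  (@mx_lie_linearl R) (@mx_lie_linearr R) (@mx_lie_alt R) (@mx_lie_jacobi R).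

(* gl(2, C), regarded as a Lie algebra over the reals.                        *)
Definition gl2C := 'M[R[i]]_2.
HB.instance Definition _ := GRing.Zmodule.on gl2C.

Definition gl2C_scale (a : R) (A : gl2C) : gl2C := a%:C *: (A : 'M[R[i]]_2).

Lemma gl2C_scaleA a b A : gl2C_scale a (gl2C_scale b A) = gl2C_scale (a * b) A.
Proof. by rewrite /gl2C_scale scalerA -rmorphM. Qed.
Lemma gl2C_scale1 : left_id 1 gl2C_scale.
Proof. by move=> A; rewrite /gl2C_scale rmorph1 scale1r. Qed.
Lemma gl2C_scaleDr : right_distributive gl2C_scale +%R.
Proof. by move=> a A B; rewrite /gl2C_scale scalerDr. Qed.
Lemma gl2C_scaleDl A : {morph gl2C_scale^~ A : a b / a + b}.
Proof. by move=> a b; rewrite /gl2C_scale rmorphD scalerDl. Qed.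
HB.instance Definition _ := GRing.Zmodule_isLmodule.Build R gl2C
  gl2C_scaleA gl2C_scale1 gl2C_scaleDr gl2C_scaleDl.

Lemma gl2C_lie_linearl (B : gl2C) :
  linear ((fun A : gl2C => mx_lie A B : gl2C)).
Proof. by move=> a A C; apply: (@mx_lie_linearl R[i] B a%:C A C). Qed.

Lemma gl2C_lie_linearr (B : gl2C) :
  linear ((fun A : gl2C => mx_lie B A : gl2C)).
Proof. by move=> a A C; apply: (@mx_lie_linearr R[i] B a%:C A C). Qed.

HB.instance Definition _ := isLieAlgebra.Build R gl2C
  gl2C_lie_linearl gl2C_lie_linearr
  (@mx_lie_alt R[i]) (@mx_lie_jacobi R[i]).

Definition u2 : set gl2C := [set A | map_mx conjc A^T = - A].

End Matrices.

Section Models.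
Variable R : realType.
Local Open Scope complex_scope.

(* A filtered Lie algebra given inside an ambient Lie algebra. Closure of the *)
(* carrier under lie is not recorded: filtered_iso, whose phi is a            *)
(* bracket-preserving bijection onto the carrier, entails it.                 *)
Record filtered_sub := FilteredSub {
  ambient : lieAlgType R;
  carrier : set ambient;
  filtration : int -> set ambient
}.

Definition graded_sub (s : seq {mpoly R[3]}) : filtered_sub :=
  @FilteredSub (contact_poly R) (poly_span s)
    (graded_filtration (poly_span s)).

Definition four_step (A : lieAlgType R) (G G' G0 : set A) : filtered_sub :=
  @FilteredSub A G (fun p : int =>
    if p <= -2 then G else if p == -1 then G' else if p == 0 then G0
    else [set 0]).

Definition gl2_model : filtered_sub :=
  @four_step (gl2 R) [set: gl2 R]
    [set A : gl2 R | exists x y z : R,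
       A = mx2 (x + y) (x + z)
               (z - x) (x - y)]
    [set A : gl2 R | exists x : R,
       A = mx2 x     x
               (- x) x].

Definition u2_model : filtered_sub :=
  @four_step (gl2C R) (@u2 R)
    [set A : gl2C R | exists x y z : R,
       A = mx2 ('i%C * x%:C + 'i%C * y%:C) (x%:C + 'i%C * z%:C)
               ('i%C * z%:C - x%:C)        ('i%C * x%:C - 'i%C * y%:C)]
    [set A : gl2C R | exists x : R,
       A = mx2 ('i%C * x%:C) x%:C
               (- x%:C)      ('i%C * x%:C)].

Inductive model : Type :=
| ModelI1 | ModelI2 | ModelI3 | ModelI4 | ModelI5
| ModelI6 (alpha : R) of 0 <= alpha
| ModelII1 | ModelII2.

Definition model_algebra (m : model) : filtered_sub :=
  let x := px R in let y := py R in let z := pz R in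
  let w := 2 *: y - x * z in
  match m with
  | ModelI1 => graded_sub
      [:: 1; x; y; z; x ^+ 2; x * z; z ^+ 2; x * w; z * w; w ^+ 2]
  | ModelI2 => graded_sub [:: 1; x; y; z; x ^+ 2; x * z; z ^+ 2]
  | ModelI3 => graded_sub [:: 1; x; z; x ^+ 2; x * z; z ^+ 2]
  | ModelI4 => graded_sub
      [:: 1; x; z; x ^+ 2 + z ^+ 2; w;
          x * (x ^+ 2 + z ^+ 2) - 2 *: (z * w);
          z * (x ^+ 2 + z ^+ 2) + 2 *: (x * w);
          (x ^+ 2 + z ^+ 2) ^+ 2 + 4 *: w ^+ 2]
  | ModelI5 => graded_sub [:: 1; x; z; x ^+ 2 + z ^+ 2; w]
  | ModelI6 alpha _ => graded_sub [:: 1; x; z; x ^+ 2 + z ^+ 2 + alpha *: w]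
  | ModelII1 => gl2_model
  | ModelII2 => u2_model
  end.

Definition filtered_iso (g : finLieAlgType R) (F : int -> {vspace g})
    (M : filtered_sub) : Prop :=
  exists phi : {linear g -> ambient M},
    [/\ injective phi,
        {morph phi : u v / lie u v},
        phi @` [set: g] = @carrier M &
        forall p, phi @` [set` F p] = @filtration M p].

End Models.

(* Main.v *)
From HB Require Import structures.
Require Import Defs.
From mathcomp Require Import all_boot all_order all_algebra.
From mathcomp Require Import boolp classical_sets reals.
From mathcomp Require Import complex mpoly ring lra zify.

(** The isotropy subalgebra F 0 acts on the plane F (-1) / F 0, and its image S in gl(2) is
    an irreducible Lie algebra. Such an S is, up to a change of basis, either a conformal
    algebra, that is a line generated by a rotation plus a dilation or all of co(2), or it
    contains sl(2) ([isotropy_cases]). Everything else is computed from S, because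
    of the maximality condition in the definition of contact Lie algebras: for p >= 0 an
    element of F p is determined modulo F (p + 1) by its brackets with two elements X and Z
    spanning F (-1) modulo F 0 ([F_prolongXZ]). In particular F vanishes from the
    first p >= 0 at which F p = F (p + 1) ([F_stable]).

    The first prolongation F 1 / F 2 is bounded through the pairs of isotropy matrices of
    [f,X] and [f,Z], for f in F 1, which are linked by the Jacobi identity
    ([first_prolongation]). In contact polynomials, when S contains sl(2) the candidates
    for f are the cubics in x and z and the products of x and z with w = 2 y - x z. A
    cubic leads, by brackets with sl(2), to an element acting like x^2 z, and n successive
    brackets with it turn X into an element acting like a nonzero multiple of x^(n+1),
    against finite dimension ([cubic_unbounded]). So only multiples of xw and zw remain
    ([sl2_symbol]). When S is conformal, two parameters remain ([co2_symbol]).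

    Suppose that S contains minus the identity. A lift E of it acts on F p / F (p + 1) as
    multiplication by p ([E_act]), its eigenvectors split the filtration ([eig_lift]), and g
    is graded. Brackets are then computed exactly: elements of nonnegative degree
    are equal as soon as they have the same brackets with X and Z ([eig_eq]). If F 1 is
    zero this gives the affine algebras [framed_gl2_affine] and [framed_similitude];
    otherwise F 1 is the standard plane, and the Jacobi identity determines F 2 as a line
    and kills F 3, which gives sp(4) ([framed_projective]) or su(2,1) ([framed_hermitian]).

    Suppose that S does not contain minus the identity. Then S is sl(2) or a line, and F 1 is
    zero. For sl(2) the weights of H force all brackets ([framed_sl2]). For a line, X and Z
    can be chosen so that its generator J acts on them exactly, and the remaining brackets
    [[X,Z],X] = b Z and [[X,Z],Z] = - b X involve one curvature constant b, which is zero
    unless J acts as a rotation ([circular_exists]). Rescaling X and Z reduces b to 0, 4 or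
    - 4 ([circular_normal]): the values are those of a graded algebra, of u(2) and of
    gl(2,R).

    To say that g is isomorphic to a member of the list is to say that g has a basis adapted
    to the filtration with a given table of brackets ([iso_framed]). The dimensions
    10, 7, 6, 8, 5 and 4 separate all members but the four-dimensional ones, and two
    adapted bases of one four-dimensional algebra differ by a similitude, which preserves
    the ratio of rotation to dilation up to sign and multiplies b by a positive number
    ([circular_unique]). *)

Set Implicit Arguments.
Unset Strict Implicit.
Unset Printing Implicit Defensive.
Import Order.TTheory GRing.Theory Num.Theory.
Local Open Scope ring_scope.

(** * Linear combinations in a module *)

Section LinearCombinations.
Variables (R : pzRingType) (V : lmodType R).

(** Ring normalisation does not apply to elements of a module; an equality between linear
    combinations is reduced to equalities of scalars, one for each atom. *)
Inductive lexp :=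
  LAtom of nat | LZero | LAdd of lexp & lexp | LOpp of lexp | LScale of R & lexp.

Fixpoint leval (env : seq V) e : V :=
  match e with
  | LAtom n => nth 0 env n
  | LZero => 0
  | LAdd e1 e2 => leval env e1 + leval env e2
  | LOpp e1 => - leval env e1
  | LScale a e1 => a *: leval env e1
  end.

Fixpoint lcoef e (n : nat) : R :=
  match e with
  | LAtom m => if Nat.eqb m n then 1 else 0
  | LZero => 0
  | LAdd e1 e2 => lcoef e1 n + lcoef e2 n
  | LOpp e1 => - lcoef e1 n
  | LScale a e1 => a * lcoef e1 n
  end.

Fixpoint lcoef_eq e1 e2 n : Prop :=
  if n is n'.+1 then lcoef e1 n' = lcoef e2 n' /\ lcoef_eq e1 e2 n' else True.

Lemma leval_coef env e :
  leval env e = \sum_(i < size env) lcoef e i *: nth 0 env i.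
Proof.
elim: e => [m||e1 IH1 e2 IH2|e1 IH1|a e1 IH1] /=.
- have eqbE i : Nat.eqb m i = (m == i) by apply/idP/eqP => /PeanoNat.Nat.eqb_eq.
  have [lt_m|le_m] := ltnP m (size env); last first.
    rewrite nth_default // big1 // => i _; rewrite eqbE.
    by case: eqP => [e|_]; rewrite ?scale0r // leqNgt e ltn_ord in le_m *.
  rewrite (bigD1 (Ordinal lt_m)) //= eqbE eqxx scale1r big1 ?addr0 // => i ne_i.
  rewrite eqbE; case: eqP => [e|_]; last by rewrite scale0r.
  by case/eqP: ne_i; apply: val_inj.
- by rewrite big1 // => i _; rewrite scale0r.
- by rewrite IH1 IH2 -big_split; apply: eq_bigr => i _; rewrite scalerDl.
- by rewrite IH1 -sumrN; apply: eq_bigr => i _; rewrite scaleNr.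
- by rewrite IH1 scaler_sumr; apply: eq_bigr => i _; rewrite scalerA.
Qed.

Lemma lmod_correct env e1 e2 :
  lcoef_eq e1 e2 (size env) -> leval env e1 = leval env e2.
Proof.
move=> eq12; rewrite !leval_coef; apply: eq_bigr => i _; congr (_ *: _).
elim: (size env) eq12 i => [_ []//|n IHn /= [eqn /IHn {}IHn] [i lt_i]] /=.
by move: lt_i; rewrite ltnS leq_eqVlt => /predU1P[->//|lt_i]; apply: (IHn (Ordinal lt_i)).
Qed.
End LinearCombinations.

(* Syntactic equality up to the algebraic structures through which the
   operations are elaborated. *)
Ltac same u w :=
  lazymatch u with
  | @lie _ _ ?a ?b =>
      lazymatch w with @lie _ _ ?c ?d => let _ := same a c in same b d end
  | @GRing.add _ ?a ?b =>
      lazymatch w with @GRing.add _ ?c ?d => let _ := same a c in same b d end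
  | @GRing.opp _ ?a => lazymatch w with @GRing.opp _ ?c => same a c end
  | @GRing.scale _ _ ?k ?a =>
      lazymatch w with @GRing.scale _ _ ?l ?c =>
        let _ := match goal with _ => unify k l end in same a c end
  | _ => let _ := match goal with _ => constr_eq u w end in constr:(tt)
  end.
Ltac lmod_mem x l :=
  lazymatch l with
  | nil => constr:(false)
  | cons ?y ?l' => let b := match goal with
     | _ => let _ := same x y in constr:(true)
     | _ => lmod_mem x l' end in b
  end.
Ltac lmod_atoms u l :=
  lazymatch u with
  | @GRing.add _ ?a ?b => let l := lmod_atoms a l in lmod_atoms b l
  | @GRing.opp _ ?a => lmod_atoms a l
  | @GRing.zero _ => l
  | @GRing.scale _ _ _ ?a => lmod_atoms a l
  | _ => let b := lmod_mem u l in
         lazymatch b with true => l | false => constr:(cons u l) end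
  end.
Ltac lmod_pos x l :=
  lazymatch l with
  | cons ?y ?l' =>
     match goal with
     | _ => let _ := same x y in constr:(O)
     | _ => let n := lmod_pos x l' in constr:(S n) end
  end.
Ltac lmod_reify R u l :=
  lazymatch u with
  | @GRing.add _ ?a ?b => let a := lmod_reify R a l in let b := lmod_reify R b l in
      constr:(@LAdd R a b)
  | @GRing.opp _ ?a => let a := lmod_reify R a l in constr:(@LOpp R a)
  | @GRing.zero _ => constr:(@LZero R)
  | @GRing.scale _ _ ?k ?a => let a := lmod_reify R a l in constr:(@LScale R k a)
  | _ => let n := lmod_pos u l in constr:(@LAtom R n)
  end.
Ltac lmod_with R V :=
  lazymatch goal with
  | |- @eq ?T ?u ?v =>
    let l := lmod_atoms u (@nil T) in let l := lmod_atoms v l in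
    let e1 := lmod_reify R u l in let e2 := lmod_reify R v l in
    refine (@lmod_correct R V l e1 e2 _);
    cbn [lcoef lcoef_eq size Nat.eqb]; repeat split; try (by ring); try (by lra); try (by field)
  end.

(** * Brackets *)

Section LieBasics.
Variables (R : pzRingType) (L : lieAlgType R).
Implicit Types x y z : L.

Lemma lieDl x y z : lie (x + y) z = lie x z + lie y z.
Proof. by have := lie_linearl z 1 x y; rewrite !scale1r. Qed.
Lemma lieDr x y z : lie z (x + y) = lie z x + lie z y.
Proof. by have := lie_linearr z 1 x y; rewrite !scale1r. Qed.
Lemma lie0l z : lie 0 z = 0 :> L.
Proof. by apply: (addrI (lie 0 z)); rewrite -lieDl !addr0. Qed.
Lemma lie0r z : lie z 0 = 0 :> L.
Proof. by apply: (addrI (lie z 0)); rewrite -lieDr !addr0. Qed.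
Lemma lieZl a x z : lie (a *: x) z = a *: lie x z.
Proof. by have := lie_linearl z a x 0; rewrite !addr0 lie0l addr0. Qed.
Lemma lieZr a x z : lie z (a *: x) = a *: lie z x.
Proof. by have := lie_linearr z a x 0; rewrite !addr0 lie0r addr0. Qed.
Lemma lieNl x z : lie (- x) z = - lie x z.
Proof. by rewrite -scaleN1r lieZl scaleN1r. Qed.
Lemma lieNr x z : lie z (- x) = - lie z x.
Proof. by rewrite -scaleN1r lieZr scaleN1r. Qed.
Lemma lieC x y : lie x y = - lie y x.
Proof.
apply/eqP; rewrite -addr_eq0; apply/eqP.
by have := lie_alt (x + y); rewrite lieDl !lieDr !lie_alt add0r addr0.
Qed.
Lemma lie_jacr x y z : lie x (lie y z) = lie (lie x y) z + lie y (lie x z).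
Proof.
have := lie_jacobi x y z; rewrite (lieC z (lie x y)) (lieC z x) lieNr.
by move/eqP; rewrite -addrA -opprD subr_eq0 addrC => /eqP.
Qed.
Lemma lie_jacl x y z : lie (lie x y) z = lie x (lie y z) - lie y (lie x z).
Proof. by rewrite lie_jacr addrK. Qed.
Lemma lie_suml n (u : 'I_n -> L) z : lie (\sum_i u i) z = \sum_i lie (u i) z.
Proof.
by elim/big_rec2: _ => [|i x y _ <-]; rewrite ?lie0l // lieDl.
Qed.
Lemma lie_sumr n (u : 'I_n -> L) z : lie z (\sum_i u i) = \sum_i lie z (u i).
Proof.
by elim/big_rec2: _ => [|i x y _ <-]; rewrite ?lie0r // lieDr.
Qed.

Definition lieE :=
  (lieDl, lieDr, lieZl, lieZr, lieNl, lieNr, lie0l, lie0r, @lie_alt R L).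
End LieBasics.

(** * Adapted bases and filtered isomorphisms *)

Section Frames.
Variable R : realType.
Local Open Scope classical_set_scope.

Definition comb (A : lmodType R) (s : seq A) (t : seq (R * nat)) : A :=
  foldr (fun p v => p.1 *: nth 0 s p.2 + v) 0 t.

Definition span_deg (A : lmodType R) (s : seq A) (d : seq int) (p : int) : set A :=
  [set v | exists c : nat -> R,
     v = \sum_(i < size s | p <= nth 0 d i) c i *: nth 0 s i].

(** A basis s of the algebra adapted to the filtration, with degrees d, and its structure
    constants: the bracket of the i-th and j-th vectors, for i < j, is the sum of the
    multiples listed in t i j as pairs of a coefficient and an index. As degrees are at
    least -2, step -2 of the filtration contains the whole basis. *)
Record framed (A : lieAlgType R) (Fil : int -> set A) (s : seq A) (d : seq int)
    (t : nat -> nat -> seq (R * nat)) : Prop := Framed {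
  framed_ge : forall i, -2 <= nth 0 d i;
  framed_free : forall c : nat -> R, \sum_(i < size s) c i *: nth 0 s i = 0 ->
    forall i, (i < size s)%N -> c i = 0;
  framed_fil : forall p, Fil p = span_deg s d p;
  framed_lie : forall i j, (i < j < size s)%N ->
    lie (nth 0 s i) (nth 0 s j) = comb s (t i j)
}.

Lemma span_deg_nth (A : lmodType R) (s : seq A) d p i :
  (i < size s)%N -> p <= nth 0 d i -> span_deg s d p (nth 0 s i).
Proof.
move=> lt_i le_p; exists (fun j => (j == i)%:R).
rewrite (bigD1 (Ordinal lt_i)) //= eqxx scale1r big1 ?addr0 // => j /andP[_ ne_j].
by rewrite (_ : (_ == i) = false) ?scale0r //; apply: contraNF ne_j => /eqP e; apply/eqP/val_inj.
Qed.

Lemma span_deg0 (A : lmodType R) (s : seq A) (d : seq int) p : span_deg s d p 0.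
Proof. by exists (fun=> 0); rewrite big1 // => i _; rewrite scale0r. Qed.
Lemma span_degD (A : lmodType R) (s : seq A) (d : seq int) p u v :
  span_deg s d p u -> span_deg s d p v -> span_deg s d p (u + v).
Proof.
move=> [c ->] [c' ->]; exists (fun i => c i + c' i).
by rewrite -big_split; apply: eq_bigr => i _; rewrite scalerDl.
Qed.
Lemma span_degW (A : lmodType R) (s : seq A) (d : seq int) (p : int) (P : pred nat) (c : nat -> R) :
  (forall i, P i -> p <= nth 0 d i) ->
  span_deg s d p (\sum_(i < size s | P i) c i *: nth 0 s i).
Proof.
move=> Pp; elim/big_ind: _ => [||i Pi]; [exact: span_deg0|exact: span_degD|].
exists (fun j => if j == i :> nat then c i else 0).
rewrite (bigD1 i) ?Pp //= eqxx big1 ?addr0 // => j /andP[_ ne_j].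
by rewrite ifN ?scale0r.
Qed.

Lemma span_deg_le (A : lmodType R) (s : seq A) (d : seq int) (p q : int) v :
  p <= q -> span_deg s d q v -> span_deg s d p v.
Proof.
move=> pq [c ->]; apply: (@span_degW A s d p (fun i => q <= nth 0 d i) c).
by move=> i; apply: le_trans.
Qed.

Lemma comb_map (A B : lmodType R) (phi : {linear A -> B}) s t :
  phi (comb s t) = comb [seq phi v | v <- s] t.
Proof.
elim: t => [|[c k] t IHt] /=; rewrite ?linear0 // linearD linearZ IHt /=.
congr (_ *: _ + _); have [lt_k|le_k] := ltnP k (size s); first by rewrite (nth_map 0).
by rewrite !nth_default ?size_map ?linear0.
Qed.

Lemma framed_basis (g : finLieAlgType R) (F : int -> {vspace g}) b d t :
  F (-2) = fullv -> framed (fun p => [set` F p]) b d t -> basis_of fullv b.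
Proof.
move=> F2 [_ b_free b_fil _]; apply/andP; split; last first.
  rewrite -[b]/(tval (in_tuple b)); apply/freeP => k k0 i.
  have := b_free (fun i => if insub i is Some j then k j else 0).
  move=> /(_ _ i (ltn_ord i)); rewrite valK; apply.
  by rewrite -[RHS]k0; apply: eq_bigr => j _; rewrite valK.
rewrite eqEsubv subvf; apply/subvP => v _.
have : [set` F (-2)] v by rewrite /= F2 memvf.
rewrite b_fil => -[c ->]; apply: memv_suml => i _.
by apply/memvZ/memv_span/mem_nth.
Qed.

(** An isomorphism carries adapted bases to adapted bases with the same table, and the
    linear map matching two such bases is an isomorphism. Existence and uniqueness of a
    model thus become statements about bases of g. *)
Lemma iso_framed (g : finLieAlgType R) (F : int -> {vspace g})
    (M : filtered_sub R) (s : seq (ambient M)) d t :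
  F (-2) = fullv -> @carrier R M = @filtration R M (-2) ->
  framed (@filtration R M) s d t ->
  filtered_iso F M <->
  exists2 b : seq g, size b = size s & framed (fun p => [set` F p]) b d t.
Proof.
move=> F2 cM [d_ge s_free s_fil s_lie]; split.
  case=> phi [phi_inj phiM phi_im phi_fil].
  have nth_im i : exists v, (i < size s)%N -> phi v = nth 0 s i.
    have [lt_i|_] := boolP (i < size s)%N; last by exists 0.
    have : @carrier R M (nth 0 s i) by rewrite cM s_fil; apply: span_deg_nth.
    by rewrite -phi_im => -[v _ <-]; exists v.
  have [f fP] := choice nth_im.
  pose b := mkseq f (size s).
  have szb : size b = size s by rewrite size_mkseq.
  have map_b : [seq phi v | v <- b] = s.
    apply: (@eq_from_nth _ 0); rewrite size_map szb // => i lt_i.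
    by rewrite (nth_map 0) ?szb // nth_mkseq // fP.
  have phib i : phi (nth 0 b i) = nth 0 s i.
    have [lt_i|le_i] := ltnP i (size s); first by rewrite nth_mkseq // fP.
    by rewrite !nth_default ?szb ?linear0.
  have phi_sum (P : pred nat) (c : nat -> R) : phi (\sum_(i < size b | P i) c i *: nth 0 b i) =
      \sum_(i < size s | P i) c i *: nth 0 s i.
    rewrite linear_sum szb; apply: eq_bigr => i _.
    by rewrite linearZ /= phib.
  exists b => //; split=> //.
  - move=> c c0 i lt_i; apply: s_free; last by rewrite -szb.
    by rewrite -(phi_sum xpredT) c0 linear0.
  - move=> p; apply/seteqP; split=> [v Fv | v [c ->]] /=.
      have : (phi @` [set` F p]) (phi v) by exists v.
      rewrite phi_fil s_fil => -[c]; rewrite -(phi_sum (fun i => p <= nth 0 d i)) => /phi_inj ->.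
      by exists c.
    have : @filtration R M p (phi (\sum_(i < size b | p <= nth 0 d i) c i *: nth 0 b i)).
      by rewrite (phi_sum (fun i => p <= nth 0 d i)) s_fil; exists c.
    by rewrite -phi_fil => -[u Fu /phi_inj <-].
  - move=> i j ij; apply: phi_inj; rewrite phiM !phib s_lie -?szb // -map_b.
    by rewrite comb_map.
case=> b szb frame_b; have /andP[/eqP spb fb] := framed_basis F2 frame_b.
have fullb v : v \in <<b>>%VS by rewrite spb memvf.
case: frame_b => _ _ b_fil b_lie.
pose bt : (size b).-tuple g := in_tuple b.
pose phi_fun (v : g) : ambient M := \sum_(i < size b) coord bt i v *: nth 0 s i.
have phi_lin : linear phi_fun.
  move=> a u v; rewrite /phi_fun scaler_sumr -big_split; apply: eq_bigr => i _ /=.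
  by rewrite linearP scalerDl scalerA.
pose phi : {linear g -> ambient M} := HB.pack phi_fun (GRing.isLinear.Build _ _ _ _ _ phi_lin).
have phib i : phi (nth 0 b i) = nth 0 s i.
  have [lt_i|le_i] := ltnP i (size b); last first.
    by rewrite !nth_default ?linear0 // -szb.
  rewrite /= /phi_fun (bigD1 (Ordinal lt_i)) //= big1 ?addr0.
    by rewrite (coord_free (Ordinal lt_i) (Ordinal lt_i)) // eqxx scale1r.
  move=> j ne_j; rewrite (coord_free (Ordinal lt_i) j) //.
  by rewrite eq_sym (negPf ne_j) scale0r.
have decomp v : v = \sum_(i < size b) coord bt i v *: nth 0 b i.
  exact: (@coord_span _ _ _ bt v (fullb v)).
have phi_sum (P : pred nat) (c : nat -> R) : phi (\sum_(i < size b | P i) c i *: nth 0 b i) =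
    \sum_(i < size s | P i) c i *: nth 0 s i.
  by rewrite linear_sum szb; apply: eq_bigr => i _; rewrite linearZ /= -phib.
have map_b : [seq phi v | v <- b] = s.
  apply: (@eq_from_nth _ 0); rewrite size_map szb // => i lt_i.
  by rewrite (nth_map 0) ?szb // phib.
have phi_lt i j : (i < j < size b)%N ->
    phi (lie (nth 0 b i) (nth 0 b j)) = lie (nth 0 s i) (nth 0 s j).
  move=> ij; rewrite b_lie // comb_map map_b s_lie // -szb //.
have phi_bb i j : (i < size b)%N -> (j < size b)%N ->
    phi (lie (nth 0 b i) (nth 0 b j)) = lie (nth 0 s i) (nth 0 s j).
  move=> lt_i lt_j; case: (ltngtP i j) => [ij|ji|<-].
  - by rewrite phi_lt ?ij.
  - by rewrite lieC linearN phi_lt ?ji // -lieC.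
  - by rewrite !lie_alt linear0.
have phiM : {morph phi : u v / lie u v}.
  move=> u v; rewrite {1}(decomp u) {1}(decomp v) lie_suml linear_sum.
  rewrite [phi u]/(phi_fun u) lie_suml; apply: eq_bigr => i _.
  rewrite [phi v]/(phi_fun v) !lie_sumr linear_sum; apply: eq_bigr => j _.
  have phiZ a w : phi (a *: w) = a *: phi w by exact: linearZ.
  by rewrite !lieZl !lieZr !phiZ phi_bb.
have phi_fil p : phi @` [set` F p] = @filtration R M p.
  rewrite b_fil s_fil; apply/seteqP; split=> [_ [_ [c ->] <-]|_ [c ->]].
    by exists c; rewrite (phi_sum (fun i => p <= nth 0 d i)).
  by exists (\sum_(i < size b | p <= nth 0 d i) c i *: nth 0 b i); rewrite ?(phi_sum (fun i => p <= nth 0 d i)) //; exists c.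
exists phi; split=> //.
- move=> u v /eqP; rewrite -subr_eq0 -linearB => /eqP; set w := u - v => phi0.
  apply/eqP; rewrite -subr_eq0 -/w (decomp w) big1 // => i _.
  have := s_free (fun i => if insub i is Some j then coord bt j w else 0).
  move=> /(_ _ i); rewrite valK => -> //; rewrite ?scale0r // -?szb //.
  rewrite -[RHS]phi0; apply: eq_bigr => j _; by rewrite valK.
- by rewrite cM -phi_fil F2; congr (_ @` _); apply/seteqP; split=> v //=; rewrite memvf.
Qed.

Lemma framed_size (g : finLieAlgType R) (F : int -> {vspace g}) b d t :
  F (-2) = fullv -> framed (fun p => [set` F p]) b d t -> size b = \dim {: g}.
Proof. by move=> F2 /(framed_basis F2)/andP[/eqP <- /eqP ->]. Qed.
End Frames.

(** * Bracket tables *)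

Section Tables.
Variable R : realType.
(** The algebra of 1, x, y, z, x^2, xz, z^2, xw, zw and w^2, isomorphic to sp(4,R), in this
    order, where w = 2 y - x z. *)
Definition tab_projective (i j : nat) : seq (R * nat) :=
  match i, j with
  | 0, 2 => [:: (1, 0%N)] | 0, 7 => [:: (2, 1%N)] | 0, 8 => [:: (2, 3%N)] | 0, 9 => [:: (8, 2%N); (-4, 5%N)]
  | 1, 2 => [:: (1, 1%N)] | 1, 3 => [:: (1, 0%N)] | 1, 5 => [:: (1, 1%N)] | 1, 6 => [:: (2, 3%N)] | 1, 7 => [:: (1, 4%N)] | 1, 8 => [:: (2, 2%N)] | 1, 9 => [:: (2, 7%N)]
  | 2, 4 => [:: (-1, 4%N)] | 2, 6 => [:: (1, 6%N)] | 2, 8 => [:: (1, 8%N)] | 2, 9 => [:: (1, 9%N)]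
  | 3, 4 => [:: (-2, 1%N)] | 3, 5 => [:: (-1, 3%N)] | 3, 7 => [:: (-2, 2%N); (2, 5%N)] | 3, 8 => [:: (1, 6%N)] | 3, 9 => [:: (2, 8%N)]
  | 4, 5 => [:: (2, 4%N)] | 4, 6 => [:: (4, 5%N)] | 4, 8 => [:: (2, 7%N)]
  | 5, 6 => [:: (2, 6%N)] | 5, 7 => [:: (-1, 7%N)] | 5, 8 => [:: (1, 8%N)]
  | 6, 7 => [:: (-2, 8%N)]
  | 7, 8 => [:: (1, 9%N)]
  | _, _ => [::]
  end.
(** The algebra of 1, x, y, z, x^2, xz and z^2. *)
Definition tab_gl2 (i j : nat) : seq (R * nat) :=
  match i, j with
  | 0, 2 => [:: (1, 0%N)]
  | 1, 2 => [:: (1, 1%N)] | 1, 3 => [:: (1, 0%N)] | 1, 5 => [:: (1, 1%N)] | 1, 6 => [:: (2, 3%N)]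
  | 2, 4 => [:: (-1, 4%N)] | 2, 6 => [:: (1, 6%N)]
  | 3, 4 => [:: (-2, 1%N)] | 3, 5 => [:: (-1, 3%N)]
  | 4, 5 => [:: (2, 4%N)] | 4, 6 => [:: (4, 5%N)]
  | 5, 6 => [:: (2, 6%N)]
  | _, _ => [::]
  end.
(** The algebra of 1, x, z, x^2, xz and z^2. *)
Definition tab_sl2 (i j : nat) : seq (R * nat) :=
  match i, j with
  | 1, 2 => [:: (1, 0%N)] | 1, 4 => [:: (1, 1%N)] | 1, 5 => [:: (2, 2%N)]
  | 2, 3 => [:: (-2, 1%N)] | 2, 4 => [:: (-1, 2%N)]
  | 3, 4 => [:: (2, 3%N)] | 3, 5 => [:: (4, 4%N)]
  | 4, 5 => [:: (2, 5%N)]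
  | _, _ => [::]
  end.
(** The algebra of 1, x, z, q, w, x q - 2 z w, z q + 2 x w and q^2 + 4 w^2, isomorphic to
    su(2,1), where q = x^2 + z^2 and w = 2 y - x z. *)
Definition tab_hermitian (i j : nat) : seq (R * nat) :=
  match i, j with
  | 0, 4 => [:: (2, 0%N)] | 0, 5 => [:: (-4, 2%N)] | 0, 6 => [:: (4, 1%N)] | 0, 7 => [:: (16, 4%N)]
  | 1, 2 => [:: (1, 0%N)] | 1, 3 => [:: (2, 2%N)] | 1, 4 => [:: (1, 1%N)] | 1, 5 => [:: (-2, 4%N)] | 1, 6 => [:: (3, 3%N)] | 1, 7 => [:: (4, 6%N)]
  | 2, 3 => [:: (-2, 1%N)] | 2, 4 => [:: (1, 2%N)] | 2, 5 => [:: (-3, 3%N)] | 2, 6 => [:: (-2, 4%N)] | 2, 7 => [:: (-4, 5%N)]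
  | 3, 5 => [:: (-2, 6%N)] | 3, 6 => [:: (2, 5%N)]
  | 4, 5 => [:: (1, 5%N)] | 4, 6 => [:: (1, 6%N)] | 4, 7 => [:: (2, 7%N)]
  | 5, 6 => [:: (1, 7%N)]
  | _, _ => [::]
  end.
(** The algebra of 1, x, z, x^2 + z^2 and w = 2 y - x z. *)
Definition tab_similitude (i j : nat) : seq (R * nat) :=
  match i, j with
  | 0, 4 => [:: (2, 0%N)]
  | 1, 2 => [:: (1, 0%N)] | 1, 3 => [:: (2, 2%N)] | 1, 4 => [:: (1, 1%N)]
  | 2, 3 => [:: (-2, 1%N)] | 2, 4 => [:: (1, 2%N)]
  | _, _ => [::]
  end.

(** For b = 0 this is the algebra of 1, x, z and x^2 + z^2 + alpha w, where w = 2 y - x z. For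
    alpha = 0, it is u(2) when b = 4 and gl(2,R) when b = - 4. *)
Definition tab_circular (alpha b : R) (i j : nat) : seq (R * nat) :=
  match i, j with
  | 0, 1 => [:: (b, 2%N)] | 0, 2 => [:: (- b, 1%N)] | 0, 3 => [:: (2 * alpha, 0%N)]
  | 1, 2 => [:: (1, 0%N)] | 1, 3 => [:: (alpha, 1%N); (2, 2%N)]
  | 2, 3 => [:: (-2, 1%N); (alpha, 2%N)]
  | _, _ => [::]
  end.

Definition deg_projective : seq int := [:: -2; -1; 0; -1; 0; 0; 0; 1; 1; 2].
Definition deg_gl2 : seq int := [:: -2; -1; 0; -1; 0; 0; 0].
Definition deg_sl2 : seq int := [:: -2; -1; -1; 0; 0; 0].
Definition deg_hermitian : seq int := [:: -2; -1; -1; 0; 0; 1; 1; 2].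
Definition deg_similitude : seq int := [:: -2; -1; -1; 0; 0].
Definition deg_circular : seq int := [:: -2; -1; -1; 0].
End Tables.

(** * Graded algebras of contact polynomials *)

Section GradedModels.
Variable R : realType.
Local Open Scope classical_set_scope.
Implicit Types (f g : {mpoly R[3]}) (d : seq int).

Definition weight (m : 'X_{1..3}) := (m ix + 2 * m iy + m iz)%N.
Definition whomog (k : nat) f := forall m, m \in msupp f -> weight m = k.

Lemma weightD m1 m2 : weight (m1 + m2)%MM = (weight m1 + weight m2)%N.
Proof. by rewrite /weight !mnmDE; ring. Qed.
Lemma whomogD k f g : whomog k f -> whomog k g -> whomog k (f + g).
Proof.
by move=> hf hg m /msuppD_le; rewrite mem_cat => /orP[/hf|/hg].
Qed.
Lemma whomogZ k a f : whomog k f -> whomog k (a *: f).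
Proof. by move=> hf m /msuppZ_le/hf. Qed.
Lemma whomogN k f : whomog k f -> whomog k (- f).
Proof. by rewrite -scaleN1r; apply: whomogZ. Qed.
Lemma whomogM k l f g : whomog k f -> whomog l g -> whomog (k + l) (f * g).
Proof.
by move=> hf hg m /msuppM_le/allpairsP[[m1 m2] /= [/hf <- /hg <- ->]]; rewrite weightD.
Qed.
Lemma whomog1 : whomog 0 1.
Proof. by move=> m; rewrite msupp1 inE => /eqP->; rewrite /weight !mnm0E. Qed.
Lemma whomogX i : whomog (if i == iy then 2 else 1) ('X_i : {mpoly R[3]}).
Proof.
move=> m; rewrite msuppX inE => /eqP->; rewrite /weight !mnmE.
by case: i => -[|[|[|//]]].
Qed.

Lemma contact_homogP k (p : int) f : k%:Z = p + 2 -> whomog k f -> contact_homog p f.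
Proof. by move=> kp hf m /hf; rewrite /weight => ->. Qed.

(** A monomial of weight q + 2 occurs only in the generators of degree q, so that the
    others can be omitted. *)
Lemma homog_part (s : seq {mpoly R[3]}) d (q : int) (c : nat -> R) f :
  (forall i, (i < size s)%N -> contact_homog (nth 0 d i) (nth 0 s i)) ->
  contact_homog q f -> f = \sum_(i < size s) c i *: nth 0 s i ->
  f = \sum_(i < size s | nth 0 d i == q) c i *: nth 0 s i.
Proof.
move=> hs hf fE; apply/mpolyP => m.
have s0 (i : 'I_(size s)) : (weight m)%:Z <> nth 0 d i + 2 -> (nth 0 s i)@_m = 0.
  move=> ne; apply: memN_msupp_eq0; apply/negP => /(hs i (ltn_ord i)); exact: ne.
have [wm|wm] := pselect ((weight m)%:Z = q + 2).
  rewrite {1}fE !raddf_sum [RHS]big_mkcond; apply: eq_bigr => i _ /=.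
  case: eqP => // ne; rewrite mcoeffZ s0 ?mulr0 // wm => /addIr e.
  by apply: ne; rewrite e.
rewrite memN_msupp_eq0; last by apply/negP => /hf.
rewrite raddf_sum big1 // => i /eqP di /=; rewrite mcoeffZ s0 ?mulr0 //.
by rewrite di.
Qed.

Lemma graded_fil (s : seq {mpoly R[3]}) d p :
  (forall i, (i < size s)%N -> contact_homog (nth 0 d i) (nth 0 s i)) ->
  graded_filtration (poly_span s) p = span_deg (s : seq (contact_poly R)) d p.
Proof.
move=> hs; apply/seteqP; split=> [f [n [u [uP ->]]]|f [c ->]].
  apply: (big_ind (span_deg (s : seq (contact_poly R)) d p)); [exact: span_deg0|exact: span_degD|].
  move=> i _; have [[c uE] hu] := uP i (ltn_ord i).
  pose c' k := if insub k is Some j then c j else 0.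
  rewrite (@homog_part s d _ c' _ hs hu); last first.
    by rewrite {1}uE; apply: eq_bigr => k _; rewrite /c' valK.
  by apply: (@span_degW R (contact_poly R) s d p (fun k => nth 0 d k == p + i%:Z)) => k /eqP ->; rewrite lerDl.
pose n := (\max_(k < size s) `|(nth 0 d k - p)%R|%N).+1.
exists n, (fun i => \sum_(k < size s | nth 0 d k == p + i%:Z) c k *: nth 0 s k).
split=> [i _|].
  split.
    exists (fun k => if nth 0 d k == p + i%:Z then c k else 0).
    rewrite big_mkcond; apply: eq_bigr => k _ /=.
    by case: ifP; rewrite ?scale0r.
  move=> m; rewrite mcoeff_msupp raddf_sum /= => /eqP nz.
  have [//|wm] := pselect ((weight m)%:Z = p + i%:Z + 2).
  case: nz; rewrite big1 // => k /eqP dk; rewrite mcoeffZ.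
  rewrite memN_msupp_eq0 ?mulr0 //; apply/negP => /(hs k (ltn_ord k)).
  by rewrite dk.
rewrite (exchange_big_dep (fun k : 'I_(size s) => p <= nth 0 d k)) /=; last first.
  by move=> i k _ /eqP ->; rewrite lerDl.
apply: eq_bigr => k le_k.
have lt_n : (`|(nth 0 d k - p)%R| < n)%N by rewrite ltnS; apply: (leq_bigmax k).
have dE : nth 0 d k = p + (`|(nth 0 d k - p)%R|%N)%:Z.
  by rewrite gez0_abs ?subr_ge0 // addrC subrK.
rewrite (bigD1 (Ordinal lt_n)) /=; last by apply/eqP.
rewrite big1 ?addr0 // => i /andP[/eqP di /eqP ne]; case: ne; apply: val_inj => /=.
by rewrite di addrC addKr.
Qed.

(** Independence is asked of the polynomial functions, so that it can be tested on a few
    points. *)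
Lemma graded_framed (s : seq {mpoly R[3]}) d t :
  (forall i, -2 <= nth 0 d i) ->
  (forall i, (i < size s)%N -> contact_homog (nth 0 d i) (nth 0 s i)) ->
  (forall c : nat -> R, (forall v, \sum_(i < size s) c i * (nth 0 s i).@[v] = 0) ->
     forall i, (i < size s)%N -> c i = 0) ->
  (forall i j, (i < j < size s)%N ->
     poly_lie (nth 0 s i) (nth 0 s j) = comb s (t i j)) ->
  framed (@filtration R (graded_sub s)) (s : seq (contact_poly R)) d t /\
  @carrier R (graded_sub s) = @filtration R (graded_sub s) (-2).
Proof.
move=> d_ge hs s_free s_lie; split.
  split=> //= [c c0|p]; last exact: graded_fil.
  apply: s_free => v.
  transitivity (meval v (\sum_(i < size s) c i *: nth 0 s i)).
    by rewrite raddf_sum; apply: eq_bigr => i _; rewrite /= mevalZ.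
  by rewrite -[RHS](meval0 v); congr meval.
rewrite /= (graded_fil _ hs); apply/seteqP; split=> [f [c ->]|f [c ->]].
  pose c' k := if insub k is Some j then c j else 0.
  rewrite (eq_bigr (fun i : 'I__ => c' i *: nth 0 s i)); last first.
    by move=> i _; rewrite /c' valK.
  exact: (@span_degW R (contact_poly R) s d (-2) xpredT c').
exists (fun k => if -2 <= nth 0 d k then c k else 0).
by rewrite big_mkcond; apply: eq_bigr => k _ /=; case: ifP; rewrite ?scale0r.
Qed.
End GradedModels.

(** * Adapted bases of the polynomial algebras *)

Section PolynomialModels.
Variable R : realType.
Local Open Scope classical_set_scope.
Local Notation x := (px R).
Local Notation y := (py R).
Local Notation z := (pz R).
Local Notation w := (2 *: y - x * z).

Lemma whomogM' k l n (f g : {mpoly R[3]}) :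
  whomog k f -> whomog l g -> (k + l = n)%N -> whomog n (f * g).
Proof. by move=> hf hg <-; apply: whomogM. Qed.
Lemma whomog_sq k n (f : {mpoly R[3]}) : whomog k f -> (k + k = n)%N -> whomog n (f ^+ 2).
Proof. by rewrite expr2 => hf; apply: whomogM'. Qed.
Lemma whomog_px : whomog 1 x. Proof. exact: (@whomogX R ix). Qed.
Lemma whomog_py : whomog 2 y. Proof. exact: (@whomogX R iy). Qed.
Lemma whomog_pz : whomog 1 z. Proof. exact: (@whomogX R iz). Qed.

Ltac whomog_tac :=
  lazymatch goal with
  | |- whomog _ 1 => exact: whomog1
  | |- whomog _ (px _) => exact: whomog_px
  | |- whomog _ (py _) => exact: whomog_py
  | |- whomog _ (pz _) => exact: whomog_pz
  | |- whomog _ (_ + _) => eapply whomogD; whomog_tac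
  | |- whomog _ (- _) => eapply whomogN; whomog_tac
  | |- whomog _ (_ *: _) => eapply whomogZ; whomog_tac
  | |- whomog _ (_ * _) => eapply whomogM'; [whomog_tac | whomog_tac | reflexivity]
  | |- whomog _ (_ ^+ 2) => eapply whomog_sq; [whomog_tac | reflexivity]
  end.
Ltac homog_tac := cbn [nth]; eapply contact_homogP; [|whomog_tac]; reflexivity.

Lemma mderiv1 (i : 'I_3) : mderiv i (1 : {mpoly R[3]}) = 0.
Proof. exact: mderivC. Qed.
Local Notation q := (x ^+ 2 + z ^+ 2).
Local Notation p1 := (x * q - 2 *: (z * w)).
Local Notation p2 := (z * q + 2 *: (x * w)).
Local Notation p3 := (q ^+ 2 + 4 *: w ^+ 2).

Ltac deriv_tac :=
  rewrite ?expr2 ?(mderivN, mderivD, mderivB, mderivM, mderivZ, mderiv_var, mderiv1) /=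
    -?mul_mpolyC ?(rmorphM, rmorphN, rmorphD, rmorph_nat, rmorph1) /=; ring.
(** Simplified derivatives of the composite generators: brackets stay small when these
    are used instead of expanding every generator inside every bracket. *)
Lemma deriv_w : (mderiv ix w = - z) * (mderiv iy w = 2) * (mderiv iz w = - x).
Proof. by split; first split; deriv_tac. Qed.
Lemma deriv_q : (mderiv ix q = 2 * x) * (mderiv iy q = 0) * (mderiv iz q = 2 * z).
Proof. by split; first split; deriv_tac. Qed.
Lemma deriv_p1 : (mderiv ix p1 = 3 * q) * (mderiv iy p1 = - 4 * z) *
  (mderiv iz p1 = 4 * x * z - 2 * w).
Proof. by split; first split; deriv_tac. Qed.
Lemma deriv_p2 : (mderiv ix p2 = 2 * w) * (mderiv iy p2 = 4 * x) *
  (mderiv iz p2 = 3 * z ^+ 2 - x ^+ 2).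
Proof. by split; first split; deriv_tac. Qed.
Lemma deriv_p3 : (mderiv ix p3 = 4 * x * q - 8 * z * w) * (mderiv iy p3 = 16 * w) *
  (mderiv iz p3 = 4 * z * q - 8 * x * w).
Proof. by split; first split; deriv_tac. Qed.
Let dpoly := (deriv_p1, deriv_p2, deriv_p3, deriv_q, deriv_w).

Ltac poly_lie_tac :=
  rewrite /comb /= poly_lieE ?dpoly ?expr2
    ?(deriv_w, mderivN, mderivD, mderivB, mderivM, mderivZ, mderiv_var, mderiv1) /=
    -?mul_mpolyC ?(rmorphM, rmorphN, rmorphD, rmorph_nat, rmorph1) /=; ring.
Ltac table_tac :=
  let i := fresh "i" in let j := fresh "j" in
  move=> i j /andP[]; do 11?[case: i => [|i]] => //; do 11?[case: j => [|j]] => //= _ _;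
  poly_lie_tac.
Ltac eval_tac e :=
  let E := fresh "E" in have E := e;
  rewrite !big_ord_recl big_ord0 /= /px /py /pz in E;
  rewrite !(mevalD, mevalN, mevalZ, mevalM, meval1, mevalXU, rmorphXn) /= in E;
  rewrite -[RHS]E; ring.

Lemma framed_projective_poly :
  let s := [:: 1; x; y; z; x ^+ 2; x * z; z ^+ 2; x * w; z * w; w ^+ 2] in
  framed (@filtration R (graded_sub s)) (s : seq (contact_poly R)) deg_projective (tab_projective R) /\
  @carrier R (graded_sub s) = @filtration R (graded_sub s) (-2).
Proof.
cbv zeta; apply: graded_framed.
- by do 11?[case=> //].
- by do 11?[case=> [_|] //]; homog_tac.
- move=> c c0.
  have E (a b e : R) : c 0%N + c 1%N * a + c 2%N * b + c 3%N * e + c 4%N * (a ^+ 2) + c 5%N * (a * e) +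
      c 6%N * (e ^+ 2) + c 7%N * (a * (2 * b - a * e)) + c 8%N * (e * (2 * b - a * e)) +
      c 9%N * ((2 * b - a * e) ^+ 2) = 0.
    by eval_tac (c0 (nth 0 [:: a; b; e])).
  move: (E 0 0 0) (E 0 0 1) (E 0 0 (-1)) (E 0 1 0) (E 0 (-1) 0)
    (E 1 0 0) (E (-1) 0 0) (E 0 1 1) (E 1 0 1) (E 1 1 0) =>
    {c0 E} E0 E1 E2 E3 E4 E5 E6 E7 E8 E9.
  by do 11?[case=> [_|] //]; lra.
- table_tac.
Qed.

Lemma framed_gl2_poly :
  let s := [:: 1; x; y; z; x ^+ 2; x * z; z ^+ 2] in
  framed (@filtration R (graded_sub s)) (s : seq (contact_poly R)) deg_gl2 (tab_gl2 R) /\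
  @carrier R (graded_sub s) = @filtration R (graded_sub s) (-2).
Proof.
cbv zeta; apply: graded_framed.
- by do 11?[case=> //].
- by do 11?[case=> [_|] //]; homog_tac.
- move=> c c0.
  have E (a b e : R) : c 0%N + c 1%N * a + c 2%N * b + c 3%N * e + c 4%N * (a ^+ 2) + c 5%N * (a * e) +
      c 6%N * (e ^+ 2) = 0.
    by eval_tac (c0 (nth 0 [:: a; b; e])).
  move: (E 0 0 0) (E 0 0 1) (E 0 0 (-1)) (E 0 1 0) (E 1 0 0)
    (E (-1) 0 0) (E 1 0 1) =>
    {c0 E} E0 E1 E2 E3 E4 E5 E6.
  by do 11?[case=> [_|] //]; lra.
- table_tac.
Qed.

Lemma framed_sl2_poly :
  let s := [:: 1; x; z; x ^+ 2; x * z; z ^+ 2] in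
  framed (@filtration R (graded_sub s)) (s : seq (contact_poly R)) deg_sl2 (tab_sl2 R) /\
  @carrier R (graded_sub s) = @filtration R (graded_sub s) (-2).
Proof.
cbv zeta; apply: graded_framed.
- by do 11?[case=> //].
- by do 11?[case=> [_|] //]; homog_tac.
- move=> c c0.
  have E (a b e : R) : c 0%N + c 1%N * a + c 2%N * e + c 3%N * (a ^+ 2) + c 4%N * (a * e) +
      c 5%N * (e ^+ 2) = 0.
    by eval_tac (c0 (nth 0 [:: a; b; e])).
  move: (E 0 0 0) (E 0 0 1) (E 0 0 (-1)) (E 1 0 0) (E (-1) 0 0)
    (E 1 0 1) =>
    {c0 E} E0 E1 E2 E3 E4 E5.
  by do 11?[case=> [_|] //]; lra.
- table_tac.
Qed.

Lemma framed_hermitian_poly :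
  let s := [:: 1; x; z; x ^+ 2 + z ^+ 2; w;
      x * (x ^+ 2 + z ^+ 2) - 2 *: (z * w);
      z * (x ^+ 2 + z ^+ 2) + 2 *: (x * w);
      (x ^+ 2 + z ^+ 2) ^+ 2 + 4 *: w ^+ 2] in
  framed (@filtration R (graded_sub s)) (s : seq (contact_poly R)) deg_hermitian (tab_hermitian R) /\
  @carrier R (graded_sub s) = @filtration R (graded_sub s) (-2).
Proof.
cbv zeta; apply: graded_framed.
- by do 11?[case=> //].
- by do 11?[case=> [_|] //]; homog_tac.
- move=> c c0.
  have E (a b e : R) : c 0%N + c 1%N * a + c 2%N * e + c 3%N * (a ^+ 2 + e ^+ 2) +
      c 4%N * ((2 * b - a * e)) +
      c 5%N * (a * (a ^+ 2 + e ^+ 2) - 2 * (e * (2 * b - a * e))) +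
      c 6%N * (e * (a ^+ 2 + e ^+ 2) + 2 * (a * (2 * b - a * e))) +
      c 7%N * ((a ^+ 2 + e ^+ 2) ^+ 2 + 4 * (2 * b - a * e) ^+ 2) = 0.
    by eval_tac (c0 (nth 0 [:: a; b; e])).
  move: (E 0 0 0) (E 0 0 1) (E 0 0 (-1)) (E 0 1 0) (E 0 (-1) 0)
    (E 1 0 0) (E 0 0 2) (E 0 1 1) =>
    {c0 E} E0 E1 E2 E3 E4 E5 E6 E7.
  by do 11?[case=> [_|] //]; lra.
- table_tac.
Qed.

Lemma framed_similitude_poly :
  let s := [:: 1; x; z; x ^+ 2 + z ^+ 2; w] in
  framed (@filtration R (graded_sub s)) (s : seq (contact_poly R)) deg_similitude (tab_similitude R) /\
  @carrier R (graded_sub s) = @filtration R (graded_sub s) (-2).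
Proof.
cbv zeta; apply: graded_framed.
- by do 11?[case=> //].
- by do 11?[case=> [_|] //]; homog_tac.
- move=> c c0.
  have E (a b e : R) : c 0%N + c 1%N * a + c 2%N * e + c 3%N * (a ^+ 2 + e ^+ 2) +
      c 4%N * ((2 * b - a * e)) = 0.
    by eval_tac (c0 (nth 0 [:: a; b; e])).
  move: (E 0 0 0) (E 0 0 1) (E 0 0 (-1)) (E 0 1 0) (E 1 0 0) =>
    {c0 E} E0 E1 E2 E3 E4.
  by do 11?[case=> [_|] //]; lra.
- table_tac.
Qed.

Lemma framed_circular_poly (alpha : R) :
  let s := [:: 1; x; z; x ^+ 2 + z ^+ 2 + alpha *: w] in
  framed (@filtration R (graded_sub s)) (s : seq (contact_poly R)) deg_circular (tab_circular alpha 0) /\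
  @carrier R (graded_sub s) = @filtration R (graded_sub s) (-2).
Proof.
cbv zeta; apply: graded_framed.
- by do 11?[case=> //].
- by do 11?[case=> [_|] //]; homog_tac.
- move=> c c0.
  have E (a b e : R) : c 0%N + c 1%N * a + c 2%N * e + c 3%N * (a ^+ 2 + e ^+ 2 + alpha * (2 * b - a * e)) = 0.
    by eval_tac (c0 (nth 0 [:: a; b; e])).
  move: (E 0 0 0) (E 0 0 1) (E 0 0 (-1)) (E 1 0 0) =>
    {c0 E} E0 E1 E2 E3.
  by do 11?[case=> [_|] //]; lra.
- table_tac.
Qed.

End PolynomialModels.

(** * The filtration of a contact Lie algebra *)

Section ContactStructure.
Variables (R : realType) (g : finLieAlgType R) (F : int -> {vspace g}).
Hypothesis cF : contact F.
Implicit Types (u v w X Y Z h f : g) (p q r : int).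

Lemma F_le p q v : p <= q -> v \in F q -> v \in F p.
Proof. by move=> pq; apply: subvP; apply: filtered_decr pq; case: cF. Qed.
Lemma F_lie p q r v w : v \in F p -> w \in F q -> r <= p + q -> lie v w \in F r.
Proof.
move=> vp wq le_r; apply: F_le le_r _; apply: filtered_lie => //; by case: cF.
Qed.
Lemma F_full p v : p <= -2 -> v \in F p.
Proof. by move=> /(contact_full cF) ->; apply: memvf. Qed.
Lemma F_prolong p v : 0 <= p -> v \in F p ->
  (forall y, y \in F (-1) -> lie v y \in F p) -> v \in F (p + 1).
Proof. by move=> p0 vp vy; apply/(contact_prolong cF p0). Qed.

Lemma F_add p v w : v \in F p -> w \in F p -> v + w \in F p.
Proof. exact: rpredD. Qed.
Lemma F_opp p v : v \in F p -> - v \in F p.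
Proof. by rewrite rpredN. Qed.
Lemma F_scale p a v : v \in F p -> a *: v \in F p.
Proof. exact: memvZ. Qed.
End ContactStructure.

Ltac int_le := first [by clear; lia | lia].
(* The degree of an element, read from the hypotheses and, for a bracket, as the sum of the
   degrees of its arguments. *)
Ltac F_deg u :=
  match goal with
  | H : is_true (@in_mem _ ?w (@mem _ _ (@pred_of_vspace _ _ (?F ?p)))) |- _ =>
      let _ := same u w in constr:(p)
  | _ => lazymatch u with
    | lie ?a ?b => let p := F_deg a in let q := F_deg b in constr:((p + q : int))
    | @GRing.opp _ ?a => F_deg a
    | @GRing.scale _ _ _ ?a => F_deg a
    end
  end.
Ltac in_filt_hyp u r := match goal with
  H : is_true (@in_mem _ ?w (@mem _ _ (@pred_of_vspace _ _ (?F ?p)))), cF : contact _ |- _ =>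
    let _ := same u w in apply: (@F_le _ _ _ cF r p _ _ H); int_le end.
Ltac in_filt_full := match goal with cF : contact _ |- _ => apply: (F_full cF); int_le end.
Ltac in_filt :=
  lazymatch goal with
  |- is_true (@in_mem _ ?u (@mem _ _ (@pred_of_vspace _ _ (?F ?r)))) =>
  lazymatch u with
  | @GRing.add _ _ _ => first [in_filt_hyp u r | apply: F_add; in_filt]
  | @GRing.opp _ _ => apply: F_opp; in_filt
  | @GRing.scale _ _ _ _ => apply: F_scale; in_filt
  | @GRing.zero _ => exact: mem0v
  | lie ?a ?b =>
      first [ in_filt_hyp u r
            | let p := F_deg a in let q := F_deg b in
              match goal with cF : contact _ |- _ =>
              apply: (@F_lie _ _ _ cF p q r); [in_filt | in_filt | int_le] end
            | in_filt_full ]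
  | _ => first [ in_filt_hyp u r | in_filt_full ]
  end end.
Ltac lmod := match goal with R : realType, g : finLieAlgType _ |- _ => lmod_with R g end.
(* Membership of an element through an equal expression e whose terms have visible degrees;
   the next tactic first rewrites by an identity j. *)
Ltac in_filt_by e :=
  lazymatch goal with |- is_true (@in_mem _ ?u _) =>
    let E := fresh "E" in have E : u = e; [rewrite ?lieE; lmod | rewrite E {E}; in_filt] end.
Ltac in_filt_with j e :=
  lazymatch goal with |- is_true (@in_mem _ ?u _) =>
    let E := fresh "E" in have E : u = e; [rewrite j ?lieE; lmod | rewrite E {E}; in_filt] end.

Ltac in_filt_from h :=
  lazymatch goal with |- is_true (@in_mem _ ?u _) =>
    lazymatch type of h with is_true (@in_mem _ ?w _) =>
      let E := fresh "E" in have E : u = w; [lmod | rewrite E {E}; exact: h] end end.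

Section Contact.
Variables (R : realType) (g : finLieAlgType R) (F : int -> {vspace g}).
Hypothesis cF : contact F.
Implicit Types (u v w X Y Z h f : g) (p q r : int).

(** The maximality condition propagates the equality of F p and F (p + 1) to all higher
    degrees, and the filtration is separated. *)
Lemma F_stable p : 0 <= p -> (forall v, v \in F p -> v \in F (p + 1)) ->
  forall v, v \in F p -> v = 0.
Proof.
move=> p0 stab v vp; apply: (contact_sep cF) => q.
have [/(F_le cF)|/ltW pq] := lerP q p; first exact.
rewrite -(subrKC p q) -[q - p]gez0_abs ?subr_ge0 //.
elim: `|q - p|%N v vp => [|n IHn] v vp; first by rewrite addr0.
have -> : p + n.+1%:Z = p + n%:Z + 1 by lia.
have vpn : v \in F (p + n%:Z) by apply: IHn.
case: n IHn vpn => [|n] IHn vpn; first by rewrite addr0; apply: stab.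
apply: (F_prolong cF) => //; first lia.
move=> y yF; apply: IHn.
have : v \in F (p + 1) by apply: stab.
by move=> vp1; in_filt.
Qed.

(** A step of least dimension among those of nonnegative index equals all the later ones. *)
Lemma F_trivial : exists2 N : int, 0 <= N & forall v, v \in F N -> v = 0.
Proof.
suff H : forall k (N : int), 0 <= N -> (\dim (F N) <= k)%N ->
    exists2 N : int, 0 <= N & forall v, v \in F N -> v = 0.
  exact: (H (\dim (F 0)) 0).
elim=> [|k IHk] N N0 dimN.
  exists N => // v; move: dimN; rewrite leqn0 dimv_eq0 => /eqP ->.
  by rewrite memv0 => /eqP.
have [[M NM dM]|noM] := pselect (exists2 M : int, N <= M & (\dim (F M) <= k)%N).
  by apply: (IHk M) => //; lia.
exists N => // v vN; apply: (contact_sep cF) => q.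
have [le_q|/ltW le_q] := lerP q N; first exact: (F_le cF le_q vN).
have sub : (F q <= F N)%VS by apply/subvP => u; apply: (F_le cF).
suff -> : F q = F N by [].
apply/eqP; rewrite eqEdim sub /=; apply: leq_trans dimN _.
by rewrite ltnNge; apply/negP => dq; apply: noM; exists q.
Qed.

(** X and Z induce a basis of F (-1) / F 0. *)
Definition contact_frame X Z := [/\ X \in F (-1), Z \in F (-1) &
  forall a b, a *: X + b *: Z \in F 0 -> a = 0 /\ b = 0].

Lemma dim_pick (U V : {vspace g}) : (\dim U < \dim V)%N -> exists2 v, v \in V & v \notin U.
Proof. by move=> lt; apply/subvPn; apply: contraL lt => /dimvS; rewrite -leqNgt. Qed.

Lemma frame_of X Z : X \in F (-1) -> X \notin F 0 -> Z \in F (-1) ->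
  (forall a, Z - a *: X \notin F 0) -> contact_frame X Z.
Proof.
move=> XF X0 ZF Z0; split=> // a b ab.
have b0 : b = 0.
  apply/eqP/negPn/negP => nb; have /negP[] := Z0 (- (b^-1 * a)).
  have -> : Z - - (b^-1 * a) *: X = b^-1 *: (a *: X + b *: Z).
    by rewrite scalerDr !scalerA mulVf // scale1r scaleNr opprK addrC.
  exact: memvZ.
split=> //; apply/eqP/negPn/negP => na; move: ab; rewrite b0 scale0r addr0.
by move=> aX; case/negP: X0; rewrite -[X](scalerK na); apply: memvZ.
Qed.

Lemma dim_F1 : \dim (F (-1)) = (\dim (F 0)).+2.
Proof. by apply/eqP; rewrite -(eqn_add2r 1) -(contact_codim1 cF) (contact_codim3 cF) !addnS !addn0. Qed.

Lemma frame_exists : exists X Z, contact_frame X Z.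
Proof.
have [|X XF X0] := @dim_pick (F 0) (F (-1)); first by rewrite dim_F1.
have [|Z ZF Z0] := @dim_pick (<[X]> + F 0)%VS (F (-1)).
  rewrite dim_F1 ltnS; apply: leq_trans (dimv_add_leqif _ _) _.
  by rewrite -add1n leq_add2r dim_vline leq_b1.
exists X, Z; apply: frame_of => // a; apply: contra Z0 => Za.
apply/memv_addP; exists (a *: X); first exact/memvZ/memv_line.
by exists (Z - a *: X) => //; rewrite addrC subrK.
Qed.

Lemma frame_span X Z v : contact_frame X Z -> v \in F (-1) ->
  exists a b, exists2 v0, v0 \in F 0 & v = a *: X + b *: Z + v0.
Proof.
case=> XF ZF XZ vF.
have fXZ : free [:: X, Z & vbasis (F 0)].
  rewrite !free_cons (basis_free (vbasisP _)) andbT span_cons !(span_basis (vbasisP _)).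
  apply/andP; split; apply/negP.
    case/memv_addP => _ /vlineP[b ->] [u u0 XE].
    have [] := XZ 1 (- b); last by move/eqP; rewrite oner_eq0.
    by rewrite scaleNr scale1r XE addrAC subrr add0r.
  move=> Z0; have /XZ[_ /eqP] : 0 *: X + 1 *: Z \in F 0 by rewrite scale0r add0r scale1r.
  by rewrite oner_eq0.
have : basis_of (F (-1)) [:: X, Z & vbasis (F 0)].
  rewrite basisEfree fXZ /= size_tuple dim_F1 leqnn andbT.
  apply/span_subvP => u; rewrite !inE => /or3P[/eqP->|/eqP->|] //.
  by move=> /vbasis_mem u0; exact: (F_le cF _ u0).
move=> /span_basis E; move: vF; rewrite -E !span_cons (span_basis (vbasisP _)).
case/memv_addP => _ /vlineP[a ->] [_ /memv_addP[_ /vlineP[b ->] [u u0 ->]] ->].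
by exists a, b, u => //; rewrite addrA.
Qed.

(** Otherwise F (-1) would be a proper subalgebra, against generation. *)
Lemma frame_Y X Z : contact_frame X Z -> lie X Z \notin F (-1).
Proof.
move=> fXZ; have [XF ZF _] := fXZ; apply/negP => YF.
have sub : (liev (F (-1)) (F (-1)) <= F (-1))%VS.
  apply/lievP => u v /(frame_span fXZ)[a [b [u0 u0F ->]]] /(frame_span fXZ)[c [d [v0 v0F ->]]].
  by rewrite !lieE (lieC Z X); in_filt.
have := contact_generate cF; rewrite (addv_idPr sub) => E.
by have := contact_codim1 cF; rewrite E => /eqP; rewrite -{1}[\dim _]addn0 eqn_add2l.
Qed.

Lemma Y_span Y v : Y \notin F (-1) -> exists a, exists2 v0, v0 \in F (-1) & v = a *: Y + v0.
Proof.
move=> YF; have : v \in (<[Y]> + F (-1))%VS.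
  suff -> : (<[Y]> + F (-1))%VS = fullv by apply: memvf.
  apply/eqP; rewrite eqEdim subvf /= (contact_codim1 cF) addn1 ltnNge.
  apply: contra YF => le_dim; suff -> : F (-1) = (<[Y]> + F (-1))%VS.
    by apply: (subvP (addvSl _ _)); apply: memv_line.
  by apply/eqP; rewrite eqEdim addvSr.
case/memv_addP => _ /vlineP[a ->] [u u0 ->].
by exists a, u.
Qed.

(** The maximality condition quantifies over F (-1), but brackets with F 0 raise no
    obstruction. *)
Lemma F_prolongXZ X Z p v : contact_frame X Z -> 0 <= p -> v \in F p ->
  lie v X \in F p -> lie v Z \in F p -> v \in F (p + 1).
Proof.
move=> fXZ p0 vp vX vZ; apply: (F_prolong cF) => // y /(frame_span fXZ)[a [b [y0 y0F ->]]].
by rewrite !lieE; in_filt.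
Qed.

(** * Linear isotropy *)

(** The rows (a, b) and (c, d) are the images of X and Z under h, modulo F 0. *)
Definition isotropy X Z h (a b c d : R) := [/\ h \in F 0,
  lie h X - (a *: X + b *: Z) \in F 0 & lie h Z - (c *: X + d *: Z) \in F 0].

Lemma isotropy_cast X Z h a b c d a' b' c' d' : isotropy X Z h a b c d ->
  a = a' -> b = b' -> c = c' -> d = d' -> isotropy X Z h a' b' c' d'.
Proof. by move=> H <- <- <- <-. Qed.

Lemma isotropy_ex X Z h : contact_frame X Z -> h \in F 0 -> exists a b c d, isotropy X Z h a b c d.
Proof.
move=> fXZ h0; have [XF ZF _] := fXZ.
have [|a [b [r rF rE]]] := @frame_span X Z (lie h X) fXZ; first in_filt.
have [|c [d [s sF sE]]] := @frame_span X Z (lie h Z) fXZ; first in_filt.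
by exists a, b, c, d; split; rewrite // ?rE ?sE addrAC subrr add0r.
Qed.

Lemma isotropy_uniq X Z h a b c d a' b' c' d' : contact_frame X Z ->
  isotropy X Z h a b c d -> isotropy X Z h a' b' c' d' -> [/\ a = a', b = b', c = c' & d = d'].
Proof.
case=> _ _ XZ [_ r1 r2] [_ s1 s2].
have /XZ[/eqP + /eqP] : (a - a') *: X + (b - b') *: Z \in F 0.
  by in_filt_by (lie h X - (a' *: X + b' *: Z) - (lie h X - (a *: X + b *: Z))).
have /XZ[/eqP + /eqP] : (c - c') *: X + (d - d') *: Z \in F 0.
  by in_filt_by (lie h Z - (c' *: X + d' *: Z) - (lie h Z - (c *: X + d *: Z))).
by rewrite !subr_eq0 => /eqP -> /eqP -> /eqP -> /eqP ->.
Qed.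

Lemma isotropy_lin X Z h a b c d h' a' b' c' d' k :
  isotropy X Z h a b c d -> isotropy X Z h' a' b' c' d' ->
  isotropy X Z (k *: h + h') (k * a + a') (k * b + b') (k * c + c') (k * d + d').
Proof.
case=> h0 r1 r2 [h'0 s1 s2]; split; first in_filt.
  by in_filt_by (k *: (lie h X - (a *: X + b *: Z)) + (lie h' X - (a' *: X + b' *: Z))).
by in_filt_by (k *: (lie h Z - (c *: X + d *: Z)) + (lie h' Z - (c' *: X + d' *: Z))).
Qed.

Lemma isotropy_lie X Z h a b c d h' a' b' c' d' : contact_frame X Z ->
  isotropy X Z h a b c d -> isotropy X Z h' a' b' c' d' ->
  isotropy X Z (lie h h') (b' * c - b * c') (a' * b + b' * d - a * b' - b * d')
    (c' * a + d' * c - c * a' - d * c') (c' * b - c * b').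
Proof.
move=> [XF ZF _] [h0 r1 r2] [h'0 s1 s2]; split; first in_filt.
  rewrite lie_jacl.
  by in_filt_by (lie h (lie h' X - (a' *: X + b' *: Z)) - lie h' (lie h X - (a *: X + b *: Z))
    + a' *: (lie h X - (a *: X + b *: Z)) + b' *: (lie h Z - (c *: X + d *: Z))
    - a *: (lie h' X - (a' *: X + b' *: Z)) - b *: (lie h' Z - (c' *: X + d' *: Z))).
rewrite lie_jacl.
by in_filt_by (lie h (lie h' Z - (c' *: X + d' *: Z)) - lie h' (lie h Z - (c *: X + d *: Z))
    + c' *: (lie h X - (a *: X + b *: Z)) + d' *: (lie h Z - (c *: X + d *: Z))
    - c *: (lie h' X - (a' *: X + b' *: Z)) - d *: (lie h' Z - (c' *: X + d' *: Z))).
Qed.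

Lemma isotropy_mod X Z h h' a b c d : contact_frame X Z ->
  isotropy X Z h a b c d -> h' - h \in F 1 -> isotropy X Z h' a b c d.
Proof.
move=> [XF ZF _] [h0 r1 r2] hh; split.
- by in_filt_by (h' - h + h).
- by in_filt_by (lie (h' - h) X + (lie h X - (a *: X + b *: Z))).
- by in_filt_by (lie (h' - h) Z + (lie h Z - (c *: X + d *: Z))).
Qed.

(** This is the maximality condition in degree 0: the isotropy representation is faithful
    on F 0 / F 1. *)
Lemma isotropy_eq0 X Z h : contact_frame X Z -> isotropy X Z h 0 0 0 0 -> h \in F 1.
Proof.
move=> fXZ [h0 r1 r2]; apply: (@F_prolongXZ X Z 0) => //.
  by in_filt_by (lie h X - (0 *: X + 0 *: Z)).
by in_filt_by (lie h Z - (0 *: X + 0 *: Z)).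
Qed.

Lemma isotropy_inj X Z h h' a b c d : contact_frame X Z ->
  isotropy X Z h a b c d -> isotropy X Z h' a b c d -> h - h' \in F 1.
Proof.
move=> fXZ rh rh'; apply: (isotropy_eq0 fXZ).
have -> : h - h' = -1 *: h' + h by lmod.
by apply: (isotropy_cast (isotropy_lin (-1) rh' rh)); ring.
Qed.

Lemma isotropy_F1 X Z h : contact_frame X Z -> h \in F 1 -> isotropy X Z h 0 0 0 0.
Proof.
move=> [XF ZF _] h1; split; first in_filt.
  by rewrite !scale0r addr0 subr0; in_filt.
by rewrite !scale0r addr0 subr0; in_filt.
Qed.
End Contact.

(** * Irreducible isotropy algebras *)

Section Isotropy.
Variables (R : realType) (g : finLieAlgType R) (F : int -> {vspace g}).
Hypotheses (cF : contact F) (irrF : irreducible F).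
Implicit Types (u v w X Y Z V W h f : g) (p q r : int).

Lemma pi_quotv0 (U : {vspace g}) : pi_quotv U 0 = 0.
Proof. by apply: (addrI (pi_quotv U 0)); rewrite -pi_quotvD !addr0. Qed.

(** A line stable under F 0 would be a proper nonzero submodule of the plane F (-1) / F 0. *)
Lemma irr_move V : V \in F (-1) -> V \notin F 0 ->
  exists2 h, h \in F 0 & forall a, lie h V - a *: V \notin F 0.
Proof.
move=> VF V0; have [X [Z [XF ZF XZ]]] := frame_exists cF.
apply: contrapT => noh.
have stab h : h \in F 0 -> exists a, lie h V - a *: V \in F 0.
  move=> h0; apply: contrapT => noa; apply: noh; exists h => // a.
  by apply/negP => ha; apply: noa; exists a.
case: irrF => _ /(_ [set q | exists c, q = pi_quotv (F 0) (c *: V)]%classic) [].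
- split.
  + by exists 0; rewrite scale0r pi_quotv0.
  + move=> a _ _ [c ->] [c' ->]; exists (a * c + c').
    rewrite scalerDl pi_quotvD -scalerA; congr (_ + _).
    exact: esym (pi_quotvZ _ _ _).
  + by move=> _ [c ->]; exists (c *: V) => //=; apply: memvZ.
  + move=> x _ x0 [c ->]; have [a xV] := stab x x0; exists (c * a).
    apply/eqP; rewrite /isotropy_act pi_quotv_eq.
    move: (repr_quotv (F 0) (c *: V)); move: (repr _) => q qV.
    by in_filt_by (lie x (q - c *: V) + c *: (lie x V - a *: V)).
- move=> S0; have : [set q | exists c, q = pi_quotv (F 0) (c *: V)]%classic (pi_quotv (F 0) V).
    by exists 1; rewrite scale1r.
  rewrite S0 /= -(pi_quotv0 (F 0)) => /eqP.
  by rewrite pi_quotv_eq subr0 (negPf V0).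
move=> SM.
have mem v : v \in F (-1) -> exists c, v - c *: V \in F 0.
  move=> vF; have : isotropy_module (F := F) (pi_quotv (F 0) v) by exists v.
  by rewrite -SM => -[c /eqP]; rewrite pi_quotv_eq; exists c.
have [[c Xc] [c' Zc]] := (mem X XF, mem Z ZF).
have /XZ[c'0 /eqP] : c' *: X + (- c) *: Z \in F 0.
  by in_filt_by (c' *: (X - c *: V) - c *: (Z - c' *: V)).
rewrite oppr_eq0 => /eqP c0.
have /XZ[/eqP] : 1 *: X + 0 *: Z \in F 0 by move: Xc; rewrite c0 => Xc; in_filt_by (X - 0 *: V).
by rewrite oner_eq0.
Qed.

Definition isotropy_set X Z a b c d := exists h, isotropy F X Z h a b c d.

Lemma isotropy_set_lin X Z k a b c d a' b' c' d' :
  isotropy_set X Z a b c d -> isotropy_set X Z a' b' c' d' ->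
  isotropy_set X Z (k * a + a') (k * b + b') (k * c + c') (k * d + d').
Proof. by move=> [h rh] [h' rh']; exists (k *: h + h'); apply: isotropy_lin. Qed.
Lemma isotropy_set_lie X Z a b c d a' b' c' d' : contact_frame F X Z ->
  isotropy_set X Z a b c d -> isotropy_set X Z a' b' c' d' ->
  isotropy_set X Z (b' * c - b * c') (a' * b + b' * d - a * b' - b * d')
    (c' * a + d' * c - c * a' - d * c') (c' * b - c * b').
Proof. by move=> fXZ [h rh] [h' rh']; exists (lie h h'); apply: isotropy_lie. Qed.
Lemma isotropy_set_cast X Z a b c d a' b' c' d' : isotropy_set X Z a b c d ->
  a = a' -> b = b' -> c = c' -> d = d' -> isotropy_set X Z a' b' c' d'.
Proof. by move=> H <- <- <- <-. Qed.
Lemma isotropy_set_0 X Z : contact_frame F X Z -> isotropy_set X Z 0 0 0 0.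
Proof. by move=> fXZ; exists 0; apply: (isotropy_F1 cF fXZ); apply: mem0v. Qed.
Lemma isotropy_set_scale X Z k a b c d : contact_frame F X Z -> isotropy_set X Z a b c d ->
  isotropy_set X Z (k * a) (k * b) (k * c) (k * d).
Proof.
by move=> fXZ S; apply: (isotropy_set_cast (isotropy_set_lin k S (isotropy_set_0 fXZ))); rewrite addr0.
Qed.

(** A, H and B act on X and Z as x^2, xz and z^2 act on x and z. *)
Definition sl2_isotropy X Z := exists A H B,
  [/\ isotropy F X Z A 0 0 2 0, isotropy F X Z H (-1) 0 0 1 & isotropy F X Z B 0 (-2) 0 0].

Lemma sl2_of X Z : contact_frame F X Z ->
  isotropy_set X Z 0 0 1 0 -> isotropy_set X Z 0 1 0 0 -> sl2_isotropy X Z.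
Proof.
move=> fXZ Se Sf.
have [A rA] : isotropy_set X Z 0 0 2 0.
  by apply: (isotropy_set_cast (isotropy_set_scale 2 fXZ Se)); ring.
have [B rB] : isotropy_set X Z 0 (-2) 0 0.
  by apply: (isotropy_set_cast (isotropy_set_scale (-2) fXZ Sf)); ring.
have [H rH] : isotropy_set X Z (-1) 0 0 1.
  by apply: (isotropy_set_cast (isotropy_set_lie fXZ Sf Se)); ring.
by exists A, H, B.
Qed.

(** J acts as a rotation by a right angle, times 2, plus a dilation, and all isotropy
    matrices are conformal. *)
Definition co2_isotropy X Z J alpha := [/\ contact_frame F X Z,
  isotropy F X Z J (- alpha) (-2) 2 (- alpha) &
  forall s a b c d, isotropy F X Z s a b c d -> a = d /\ b = - c].

(** The bracket with a rotation annihilates the conformal part of a matrix and turns its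
    symmetric traceless part by a right angle. If that part of some matrix is not zero, it
    therefore spans, with its image, all symmetric traceless matrices, which generate sl(2). *)
Lemma co2_or_sl2 X Z J alpha : contact_frame F X Z -> isotropy F X Z J (- alpha) (-2) 2 (- alpha) ->
  co2_isotropy X Z J alpha \/ sl2_isotropy X Z.
Proof.
move=> fXZ rJ; have SJ : isotropy_set X Z (- alpha) (-2) 2 (- alpha) by exists J.
have [sym0|/existsNP[s /existsNP[a /existsNP[b /existsNP[c /existsNP[d]]]]]] :=
  pselect (forall s a b c d, isotropy F X Z s a b c d -> a = d /\ b = - c).
  by left.
move=> /not_implyP[rs /not_andP ns]; right.
pose u := b + c; pose t := d - a.
have nz : u ^+ 2 + t ^+ 2 != 0.
  apply/eqP => /eqP; rewrite paddr_eq0 ?sqr_ge0 // !sqrf_eq0 => /andP[/eqP u0 /eqP t0].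
  by case: ns; apply; rewrite /u /t in u0 t0; lra.
have Ss : isotropy_set X Z a b c d by exists s.
have S1 : isotropy_set X Z u t t (- u).
  by apply: (isotropy_set_cast (isotropy_set_scale (2^-1) fXZ (isotropy_set_lie fXZ SJ Ss))); rewrite /u /t; field.
have S2 : isotropy_set X Z t (- u) (- u) (- t).
  by apply: (isotropy_set_cast (isotropy_set_scale (4^-1) fXZ (isotropy_set_lie fXZ SJ S1))); field.
have S3 : isotropy_set X Z 0 1 (-1) 0.
  by apply: (isotropy_set_cast (isotropy_set_scale ((2 * (u ^+ 2 + t ^+ 2))^-1) fXZ (isotropy_set_lie fXZ S1 S2))); field.
have S4 : isotropy_set X Z 0 1 1 0.
  apply: (isotropy_set_cast (isotropy_set_scale ((u ^+ 2 + t ^+ 2)^-1) fXZ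
    (isotropy_set_lin t S1 (isotropy_set_scale (- u) fXZ S2)))); by field.
apply: (sl2_of fXZ).
  by apply: (isotropy_set_cast (isotropy_set_scale (2^-1) fXZ (isotropy_set_lin (-1) S3 S4))); field.
by apply: (isotropy_set_cast (isotropy_set_scale (2^-1) fXZ (isotropy_set_lin 1 S3 S4))); field.
Qed.

Lemma frame_swap X Z : contact_frame F X Z -> contact_frame F Z X.
Proof. by case=> XF ZF XZ; split=> // a b; rewrite addrC => /XZ[-> ->]. Qed.

Lemma frame_notin X Z : contact_frame F X Z -> X \notin F 0.
Proof.
case=> _ _ XZ; apply/negP => X0; have /XZ[/eqP] : 1 *: X + 0 *: Z \in F 0 by in_filt_by X.
by rewrite oner_eq0.
Qed.

Lemma frame_comb X Z a b c d : contact_frame F X Z -> a * d - b * c != 0 ->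
  contact_frame F (a *: X + b *: Z) (c *: X + d *: Z).
Proof.
case=> XF ZF XZ dt; split; [in_filt|in_filt|] => k l kl.
have /XZ[e1 e2] : (k * a + l * c) *: X + (k * b + l * d) *: Z \in F 0.
  by in_filt_by (k *: (a *: X + b *: Z) + l *: (c *: X + d *: Z)).
split; apply: (mulIf dt); rewrite mul0r.
  by transitivity (d * (k * a + l * c) - c * (k * b + l * d)); [ring | rewrite e1 e2; ring].
by transitivity (a * (k * b + l * d) - b * (k * a + l * c)); [ring | rewrite e1 e2; ring].
Qed.

Lemma isotropy_move X Z : contact_frame F X Z -> exists a b c d, isotropy_set X Z a b c d /\ b != 0.
Proof.
move=> fXZ; have [XF ZF _] := fXZ.
have [h h0 hX] := irr_move XF (frame_notin fXZ).
have [a [b [c [d rh]]]] := isotropy_ex cF fXZ h0.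
exists a, b, c, d; split; first by exists h.
apply/eqP => b0; have /negP[] := hX a; have [_ r1 _] := rh; rewrite b0 in r1.
by in_filt_by (lie h X - (a *: X + 0 *: Z)).
Qed.

(** By irreducibility some h sends X to a vector independent of it, and h has companion
    form in the basis X, h X. If its discriminant is negative, h is a rotation plus a
    dilation in another basis. Otherwise h has a real eigenline; irreducibility
    provides elements moving the eigenlines out of themselves, and their brackets with h
    isolate the nilpotent matrices generating sl(2). *)
Lemma isotropy_cases : exists X Z, contact_frame F X Z /\
  ((exists J alpha, co2_isotropy X Z J alpha) \/ sl2_isotropy X Z).
Proof.
have [X [Z0 fXZ0]] := frame_exists cF; have [XF _ _] := fXZ0.
have [h h0 hX] := irr_move XF (frame_notin fXZ0).
have [Z ZE] : exists Z, Z = lie h X by exists (lie h X).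
have fXZ : contact_frame F X Z by rewrite ZE; apply: frame_of => //; [exact: frame_notin fXZ0 | in_filt].
have ZF : Z \in F (-1) by case: fXZ.
have [a [b [c [d rh]]]] := isotropy_ex cF fXZ h0.
have {a b rh} rh : isotropy F X Z h 0 1 c d.
  case: rh => _ _ r2; split=> //.
  by rewrite scale0r add0r scale1r ZE subrr mem0v.
have Sh : isotropy_set X Z 0 1 c d by exists h.
have [Dneg|Dge] := ltrP (d ^+ 2 + 4 * c) 0.
  pose s := Num.sqrt (- (d ^+ 2 + 4 * c)) / 2.
  have s2 : 4 * s ^+ 2 = - (d ^+ 2 + 4 * c).
    by rewrite /s expr_div_n sqr_sqrtr ?oppr_ge0 ?ltW //; field.
  have s0 : s != 0.
    by apply/eqP => sE; move: s2; rewrite sE; lra.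
  have [_ r1 r2] := rh.
  have [Z' Z'E] : exists Z', Z' = (d / (2 * s)) *: X + (- s^-1) *: Z by eexists.
  have fXZ' : contact_frame F X Z'.
    have := @frame_comb X Z 1 0 (d / (2 * s)) (- s^-1) fXZ.
    rewrite scale1r scale0r addr0 -Z'E; apply.
    by rewrite mul0r subr0 mul1r oppr_eq0 invr_eq0.
  exists X, Z'; split=> //.
  have rJ : isotropy F X Z' ((2 / s) *: h) (- - (d / s)) (-2) 2 (- - (d / s)).
    split; first by in_filt.
      by rewrite Z'E; in_filt_by ((2 / s) *: (lie h X - (0 *: X + 1 *: Z))).
    rewrite Z'E.
    have cE : c = - s ^+ 2 - d ^+ 2 / 4 by lra.
    move: r2; rewrite cE => {}r2.
    by in_filt_by ((- 2 / s ^+ 2) *: (lie h Z - ((- s ^+ 2 - d ^+ 2 / 4) *: X + d *: Z))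
     + (d / s ^+ 2) *: (lie h X - (0 *: X + 1 *: Z))).
  have [J|sl2] := co2_or_sl2 fXZ' rJ; last by right.
  by left; exists ((2 / s) *: h), (- (d / s)).
pose s := Num.sqrt (d ^+ 2 + 4 * c).
have s2 : s ^+ 2 = d ^+ 2 + 4 * c by rewrite sqr_sqrtr.
pose l1 := (d + s) / 2; pose l2 := (d - s) / 2.
have cE : c = (s ^+ 2 - d ^+ 2) / 4 by lra.
have [_ r1 r2] := rh.
(* A double eigenvalue: V spans the eigenline, and h is a dilation plus a nilpotent
   matrix. *)
have [s0|s0] := eqVneq s 0.
  have [V VE] : exists V, V = (- (d / 2)) *: X + 1 *: Z by eexists.
  have fVX : contact_frame F V X.
    have := @frame_comb X Z (- (d / 2)) 1 1 0 fXZ; rewrite scale0r addr0 !scale1r => H; rewrite VE scale1r; apply: H.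
    by rewrite mulr0 mulr1 sub0r oppr_eq0 oner_eq0.
  exists V, X; split=> //; right.
  have S1 : isotropy_set V X (d / 2) 0 1 (d / 2).
    exists h; split=> //.
      move: r2; rewrite cE s0 => {}r2; rewrite VE.
      by in_filt_by ((- (d / 2)) *: (lie h X - (0 *: X + 1 *: Z)) + (lie h Z - (((0 ^+ 2 - d ^+ 2) / 4) *: X + d *: Z))).
    by rewrite VE; in_filt_by (lie h X - (0 *: X + 1 *: Z)).
  have [a [b [c' [d' [St b0]]]]] := isotropy_move fVX.
  have S2 := isotropy_set_lie fVX S1 St.
  have S3 : isotropy_set V X 0 0 1 0.
    by apply: (isotropy_set_cast (isotropy_set_scale ((- 2 * b)^-1) fVX (isotropy_set_lie fVX S1 S2))); field.
  have S4 : isotropy_set V X 1 0 0 (- 1).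
    by apply: (isotropy_set_cast (isotropy_set_lin (b^-1) S2 (isotropy_set_scale (- (d' - a) / b) fVX S3))); field.
  apply: sl2_of => //.
  by apply: (isotropy_set_cast (isotropy_set_lin (- (2 * b)^-1) (isotropy_set_lie fVX S4 St)
    (isotropy_set_scale (c' / b) fVX S3))); field.
have [V VE] : exists V, V = (- l2) *: X + 1 *: Z by eexists.
have [W WE] : exists W, W = (- l1) *: X + 1 *: Z by eexists.
have fVW : contact_frame F V W.
  rewrite VE WE; apply: frame_comb => //; rewrite !mulr1 mul1r /l1 /l2.
  by rewrite (_ : _ - _ = s) //; field.
exists V, W; split=> //; right.
have S1 : isotropy_set V W l1 0 0 l2.
  move: r2; rewrite cE => {}r2; exists h; split=> //.
    by rewrite VE /l1 /l2; in_filt_by ((- ((d - s) / 2)) *: (lie h X - (0 *: X + 1 *: Z)) + (lie h Z - (((s ^+ 2 - d ^+ 2) / 4) *: X + d *: Z))).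
  by rewrite WE /l1 /l2; in_filt_by ((- ((d + s) / 2)) *: (lie h X - (0 *: X + 1 *: Z)) + (lie h Z - (((s ^+ 2 - d ^+ 2) / 4) *: X + d *: Z))).
(* Two distinct eigenvalues: the iterated brackets with h separate the off-diagonal
   entries, which have opposite weights. *)
have key a b c' d' : isotropy_set V W a b c' d' ->
    isotropy_set V W 0 b 0 0 /\ isotropy_set V W 0 0 c' 0.
  move=> St; have S2 := isotropy_set_lie fVW S1 St; have S3 := isotropy_set_lie fVW S1 S2.
  have l1E : l1 = l2 + s by rewrite /l1 /l2; field.
  split.
    by apply: (isotropy_set_cast (isotropy_set_lin (1 / (2 * s ^+ 2)) S3 (isotropy_set_scale (- 1 / (2 * s)) fVW S2)));
      rewrite l1E; field.
  by apply: (isotropy_set_cast (isotropy_set_lin (1 / (2 * s ^+ 2)) S3 (isotropy_set_scale (1 / (2 * s)) fVW S2)));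
    rewrite l1E; field.
have [a [b [c1 [d1 [/key[St _] b0]]]]] := isotropy_move fVW.
have [a2 [b2 [c2 [d2 [[t rt] b20]]]]] := isotropy_move (frame_swap fVW).
have /key[_ St2] : isotropy_set V W d2 c2 b2 a2.
  by exists t; have [t0 t1 t2] := rt; split=> //; rewrite (addrC (_ *: V)).
apply: sl2_of => //.
  by apply: (isotropy_set_cast (isotropy_set_scale (b2^-1) fVW St2)); field.
by apply: (isotropy_set_cast (isotropy_set_scale (b^-1) fVW St)); field.
Qed.
End Isotropy.

(** * The first prolongation *)

Section FirstProlongation.
Variables (R : realType) (g : finLieAlgType R) (F : int -> {vspace g}).
Hypothesis (cF : contact F).
Implicit Types (u v w X Y Z V W h f : g) (p q r : int).

Lemma isotropyE X Z h a b c d : isotropy F X Z h a b c d -> h \in F 0 /\ exists u v,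
  [/\ u \in F 0, v \in F 0, lie h X = a *: X + b *: Z + u & lie h Z = c *: X + d *: Z + v].
Proof.
case=> h0 r1 r2; split=> //; exists (lie h X - (a *: X + b *: Z)), (lie h Z - (c *: X + d *: Z)).
by split=> //; rewrite addrC subrK.
Qed.

Lemma coef_notin p a v : a *: v \in F p -> v \notin F p -> a = 0.
Proof.
move=> av; apply: contraNeq => a0; rewrite -[v](scalerK a0); exact: memvZ.
Qed.

(** The Jacobi identities for f, X, [X,Z] and f, Z, [X,Z], read modulo F (-1), where [X,Z]
    does not vanish. *)
Lemma first_prolongation X Z f a b c d a' b' c' d' : contact_frame F X Z -> f \in F 1 ->
  isotropy F X Z (lie f X) a b c d -> isotropy F X Z (lie f Z) a' b' c' d' ->
  a + 2 * d = b' /\ 2 * a' + d' = c.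
Proof.
move=> fXZ f1; have [XF ZF _] := fXZ; have Y1 := frame_Y cF fXZ.
have := lie_jacr f X (lie X Z); have := lie_jacr f Z (lie X Z).
rewrite (lie_jacr f X Z); move: (lie f X) (lie f Z) => h1 h2.
rewrite (lie_jacr h1 X Z) (lie_jacr h2 X Z).
move=> j2 j1 /isotropyE[h10 [r1 [s1 [r10 s10 e1 e2]]]] /isotropyE[h20 [r2 [s2 [r20 s20 e3 e4]]]].
rewrite (lieC X h2) e1 e2 e3 in j1; rewrite (lieC X h2) e2 e3 e4 in j2.
have X2 := F_full cF (lie X (lie X Z)) (lexx (-2)).
have Z2 := F_full cF (lie Z (lie X Z)) (lexx (-2)).
split; apply/eqP; rewrite -subr_eq0; apply/eqP; apply: coef_notin Y1.
  by in_filt_with j1 (lie f (lie X (lie X Z)) - (lie r1 Z + 2 *: lie X s1 - lie X r2)).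
have -> : (2 * a' + d' - c) *: lie X Z =
  lie f (lie Z (lie X Z)) - (lie X s2 + lie Z s1 + lie r2 Z - lie Z r2).
  by rewrite j2 !lieE (lieC Z X); lmod.
by in_filt.
Qed.

(** The action of F 0 on first prolongations, by the Jacobi identity for h, f and X or Z. *)
Lemma isotropy_ad1 X Z h f a b c d a1 b1 c1 d1 a2 b2 c2 d2 : contact_frame F X Z -> f \in F 1 ->
  isotropy F X Z h a b c d ->
  isotropy F X Z (lie f X) a1 b1 c1 d1 -> isotropy F X Z (lie f Z) a2 b2 c2 d2 ->
  isotropy F X Z (lie (lie h f) X) (b1 * c - b * c1 - a * a1 - b * a2)
    (a1 * b + b1 * d - a * b1 - b * d1 - a * b1 - b * b2)
    (c1 * a + d1 * c - c * a1 - d * c1 - a * c1 - b * c2)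
    (c1 * b - c * b1 - a * d1 - b * d2) /\
  isotropy F X Z (lie (lie h f) Z) (b2 * c - b * c2 - c * a1 - d * a2)
    (a2 * b + b2 * d - a * b2 - b * d2 - c * b1 - d * b2)
    (c2 * a + d2 * c - c * a2 - d * c2 - c * c1 - d * c2)
    (c2 * b - c * b2 - c * d1 - d * d2).
Proof.
move=> fXZ f1 rh r1 r2; have [h0 [u [v [u0 v0 e1 e2]]]] := isotropyE rh.
split.
  apply: (@isotropy_mod _ _ _ cF _ _ ((- b) *: lie f Z + ((- a) *: lie f X + lie h (lie f X)))) => //.
    apply: (isotropy_cast (isotropy_lin cF (- b) r2 (isotropy_lin cF (- a) r1 (isotropy_lie cF fXZ rh r1)))); ring.
  have -> : lie (lie h f) X - ((- b) *: lie f Z + ((- a) *: lie f X + lie h (lie f X)))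
    = - lie f u by rewrite lie_jacl e1 !lieE; lmod.
  by in_filt.
apply: (@isotropy_mod _ _ _ cF _ _ ((- d) *: lie f Z + ((- c) *: lie f X + lie h (lie f Z)))) => //.
  apply: (isotropy_cast (isotropy_lin cF (- d) r2 (isotropy_lin cF (- c) r1 (isotropy_lie cF fXZ rh r2)))); ring.
have -> : lie (lie h f) Z - ((- d) *: lie f Z + ((- c) *: lie f X + lie h (lie f Z)))
  = - lie f v by rewrite lie_jacl e2 !lieE; lmod.
by in_filt.
Qed.

Lemma isotropy_combE X Z A H e k l a b c d : contact_frame F X Z ->
  isotropy F X Z A 0 0 2 0 -> isotropy F X Z H (-1) 0 0 1 -> isotropy F X Z e a b c d ->
  a = - k -> b = 0 -> c = 2 * l -> d = k -> e - (k *: H + l *: A) \in F 1.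
Proof.
move=> fXZ rA rH re ea eb ec ed; rewrite ea eb ec ed in re; apply: (isotropy_inj cF fXZ re).
have -> : k *: H + l *: A = k *: H + (l *: A + 0) by lmod.
have r0 := isotropy_F1 cF fXZ (mem0v (F 1)).
by apply: (isotropy_cast (isotropy_lin cF k rH (isotropy_lin cF l rA r0))); ring.
Qed.

(** In contact polynomials, f is x^2 z + (e / 3) x^3, while v and w are proportional to x^n
    and x^(n+1); the conclusion is the hypothesis for w and [f,w] in place of v and w. *)
Lemma cubic_step X Z A H f v w (e n : R) p : contact_frame F X Z -> f \in F 1 -> 0 <= p ->
  isotropy F X Z A 0 0 2 0 -> isotropy F X Z H (-1) 0 0 1 ->
  lie f X + A \in F 1 -> lie f Z - (2 *: H + e *: A) \in F 1 ->
  w = lie f v -> v \in F (p - 1) -> w \in F p ->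
  lie A v \in F p -> lie H v + n *: v \in F p ->
  lie w X \in F p -> lie w Z + ((n + 1) * n) *: v \in F p ->
  [/\ lie A w \in F (p + 1), lie H w + (n + 1) *: w \in F (p + 1),
    lie (lie f w) X \in F (p + 1) &
    lie (lie f w) Z + ((n + 2) * (n + 1)) *: w \in F (p + 1)].
Proof.
move=> fXZ f1 p0 rA rH; have [XF ZF _] := fXZ.
have [A0 [Ax [Az [AxF AzF AX AZ]]]] := isotropyE rA.
have [H0 [Hx [Hz [HxF HzF HX HZ]]]] := isotropyE rH.
rewrite !scale0r !add0r in AX; rewrite scale0r addr0 in AZ.
rewrite scale0r addr0 scaleN1r in HX; rewrite scale0r add0r scale1r in HZ.
set u1 := lie f X + A; set u2 := lie f Z - _; set h := lie H v + _.
set z := lie w Z + _ => u1F u2F wE vF wF Av hF wX zF.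
have fX : lie f X = - A + u1 by rewrite /u1; lmod.
have fZ : lie f Z = 2 *: H + e *: A + u2 by rewrite /u2; lmod.
have HvE : lie H v = h - n *: v by rewrite /h; lmod.
have wZE : lie w Z = z - ((n + 1) * n) *: v by rewrite /z; lmod.
move: h z u1 u2 u1F u2F hF zF HvE wZE fX fZ => h z u1 u2 u1F u2F hF zF HvE wZE fX fZ.
have AwF : lie A w \in F p by in_filt.
have HwF : lie H w \in F p by in_filt.
have Aw : lie A w \in F (p + 1).
  apply: (F_prolongXZ cF fXZ p0 AwF).
    by rewrite lie_jacl AX; in_filt.
  by rewrite lie_jacl AZ wZE !lieE; in_filt.
have Hw : lie H w + (n + 1) *: w \in F (p + 1).
  apply: (F_prolongXZ cF fXZ p0); first by in_filt.
    by rewrite lieDl lieZl lie_jacl HX !lieE; in_filt.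
  rewrite lieDl lieZl lie_jacl HZ wZE !lieE HvE wZE.
  by in_filt_by (lie H z - (n * (n + 1)) *: h + n *: z - lie w Hz).
split=> //.
  by rewrite lie_jacl fX !lieE (lieC w A); in_filt.
rewrite lie_jacl fZ wZE !lieE -wE (lieC w H) (lieC w A).
by in_filt_by (lie f z + 2 *: (lie H w + (n + 1) *: w) + e *: lie A w - lie w u2).
Qed.

(** With x^2 z one raises the degree forever: the n-th iterated bracket of f with X acts
    like a nonzero multiple of x^(n+1), hence is nonzero in degree n - 1, and g
    would be infinite-dimensional. *)
Lemma cubic_unbounded X Z A H f (e : R) : contact_frame F X Z -> f \in F 1 ->
  isotropy F X Z A 0 0 2 0 -> isotropy F X Z H (-1) 0 0 1 ->
  isotropy F X Z (lie f X) 0 0 (-2) 0 -> isotropy F X Z (lie f Z) (-2) 0 (2 * e) 2 -> False.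
Proof.
move=> fXZ f1 rA rH rX rZ; have [XF ZF _] := fXZ.
have fX : lie f X + A \in F 1.
  have -> : lie f X + A = lie f X - (0 *: H + (- 1) *: A) by lmod.
  by apply: (isotropy_combE fXZ rA rH rX); ring.
have fZ : lie f Z - (2 *: H + e *: A) \in F 1.
  by apply: (isotropy_combE fXZ rA rH rZ); ring.
pose b := fix b n := if n is n'.+1 then lie f (b n') else X.
have bS k : b k.+1 = lie f (b k) by [].
have bF k : b k \in F (k%:Z - 1).
  elim: k => [|k IHk]; first by rewrite /=; in_filt.
  by rewrite bS; in_filt.
have main k : [/\ lie A (b k) \in F k%:Z, lie H (b k) + k.+1%:R *: b k \in F k%:Z,
    lie (b k.+1) X \in F k%:Z & lie (b k.+1) Z + (k.+2 * k.+1)%:R *: b k \in F k%:Z].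
  elim: k => [|k [IA IH IX IZ]].
    have [_ [u [v [uF vF qXX qXZ]]]] := isotropyE rX.
    have [_ [Ax [_ [AxF _ AX _]]]] := isotropyE rA.
    have [_ [Hx [_ [HxF _ HX _]]]] := isotropyE rH.
    rewrite bS /= AX HX qXX qXZ; split.
    - by in_filt_by Ax.
    - by in_filt_by Hx.
    - by in_filt_by u.
    - by in_filt_by v.
  have [c1 c2 c3] : [/\ k.+2%:R = k.+1%:R + 1 :> R, (k.+2 * k.+1)%:R = (k.+1%:R + 1) * k.+1%:R :> R
      & (k.+3 * k.+2)%:R = (k.+1%:R + 2) * (k.+1%:R + 1) :> R].
    by rewrite !natrM -!(natr1 k.+2) -!(natr1 k.+1); split; ring.
  move: IA IH IX IZ; rewrite (bS k.+1) c1 c2 c3.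
  have := bF k.+1; have := bF k.
  have -> : k.+1%:Z - 1 = k%:Z by lia.
  have -> : k.+1%:Z = k%:Z + 1 by lia.
  by move=> vF wF IA IH IX IZ; apply: (cubic_step (e := e) (v := b k)).
have notin k : b k \notin F k%:Z.
  elim: k => [|k IHk]; first exact: frame_notin fXZ.
  apply: contra IHk => bk; have [_ _ _ bZ] := main k.
  rewrite -[b k](@scalerK _ _ (k.+2 * k.+1)%:R) ?pnatr_eq0 //; apply: F_scale.
  have -> : (k.+2 * k.+1)%:R *: b k = lie (b k.+1) Z + (k.+2 * k.+1)%:R *: b k - lie (b k.+1) Z.
    by lmod.
  have : b k.+1 \in F (k%:Z + 1) by have -> : k%:Z + 1 = k.+1%:Z by lia.
  by move=> bk1; in_filt.
have [N N0 FN] := F_trivial cF.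
have := notin `|N|%N.+1; rewrite (FN (b `|N|%N.+1)) ?mem0v //.
by have := bF `|N|%N.+1; have -> : `|N|%N.+1%:Z - 1 = N by lia.
Qed.

Lemma isotropy_scale X Z h a b c d k : contact_frame F X Z -> isotropy F X Z h a b c d ->
  isotropy F X Z (k *: h) (k * a) (k * b) (k * c) (k * d).
Proof.
move=> fXZ rh; rewrite -[k *: h]addr0.
by apply: (isotropy_cast (isotropy_lin cF k rh (isotropy_F1 cF fXZ (mem0v _)))); rewrite addr0.
Qed.

Lemma isotropy_ex1 X Z f : contact_frame F X Z -> f \in F 1 -> exists a1 b1 c1 d1 a2 b2 c2 d2,
  isotropy F X Z (lie f X) a1 b1 c1 d1 /\ isotropy F X Z (lie f Z) a2 b2 c2 d2.
Proof.
move=> fXZ f1; have [XF ZF _] := fXZ.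
have [|a1 [b1 [c1 [d1 r1]]]] := @isotropy_ex _ _ _ cF X Z (lie f X) fXZ; first by in_filt.
have [|a2 [b2 [c2 [d2 r2]]]] := @isotropy_ex _ _ _ cF X Z (lie f Z) fXZ; first by in_filt.
by exists a1, b1, c1, d1, a2, b2, c2, d2.
Qed.

(** The entry b is a multiple of the coefficient of z^3 in f. Two brackets with A carry
    z^3 to x^2 z, and would give an element excluded by [cubic_unbounded], where the
    parameter e allows for an x^3 term. *)
Lemma sl2_symbolZ X Z A H f a b c d : contact_frame F X Z ->
  isotropy F X Z A 0 0 2 0 -> isotropy F X Z H (-1) 0 0 1 ->
  f \in F 1 -> isotropy F X Z (lie f X) a b c d -> b = 0.
Proof.
move=> fXZ rA rH f1 r1; apply/eqP/negPn/negP => b0; have [XF ZF _] := fXZ.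
have [A0 _] := isotropyE rA.
have [|a2 [b2 [c2 [d2 r2]]]] := @isotropy_ex _ _ _ cF X Z (lie f Z) fXZ; first by in_filt.
have [r1' r2'] := isotropy_ad1 fXZ f1 rA r1 r2.
have f1' : lie A f \in F 1 by in_filt.
have [r1'' r2''] := isotropy_ad1 fXZ f1' rA r1' r2'.
have q1 : (4 * b)^-1 *: lie A (lie A f) \in F 1 by in_filt.
have := isotropy_scale (4 * b)^-1 fXZ r2''; rewrite -lieZl => rZ.
have := isotropy_scale (4 * b)^-1 fXZ r1''; rewrite -lieZl => rX.
have rX' : isotropy F X Z (lie ((4 * b)^-1 *: lie A (lie A f)) X) 0 0 (-2) 0.
  by apply: (isotropy_cast rX); field.
have [eq0 rZ'] : exists e, isotropy F X Z (lie ((4 * b)^-1 *: lie A (lie A f)) Z) (-2) 0 (2 * e) 2.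
  eexists; apply: (isotropy_cast rZ); last by field.
  - by field.
  - by field.
  - by apply: esym; apply: mulVKf; rewrite pnatr_eq0.
exact: (cubic_unbounded fXZ q1 rA rH rX' rZ').
Qed.

(** Brackets with B carry each cubic monomial to a multiple of z^3, whose coefficient
    vanishes. What remains are the two quadratic multiples xw and zw of w = 2 y - x z. *)
Lemma sl2_symbol X Z A H B f : contact_frame F X Z ->
  isotropy F X Z A 0 0 2 0 -> isotropy F X Z H (-1) 0 0 1 -> isotropy F X Z B 0 (-2) 0 0 ->
  f \in F 1 -> exists a d, isotropy F X Z (lie f X) a 0 d 0 /\ isotropy F X Z (lie f Z) 0 a 0 d.
Proof.
move=> fXZ rA rH rB f1; have [B0 _] := isotropyE rB.
have [a1 [b1 [c1 [d1 [a2 [b2 [c2 [d2 [r1 r2]]]]]]]]] := isotropy_ex1 fXZ f1.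
have ad_B a1' b1' c1' d1' a2' b2' c2' d2' f' : f' \in F 1 ->
    isotropy F X Z (lie f' X) a1' b1' c1' d1' -> isotropy F X Z (lie f' Z) a2' b2' c2' d2' ->
    [/\ lie B f' \in F 1,
      isotropy F X Z (lie (lie B f') X) (2 * (c1' + a2')) (2 * (d1' - a1' + b2'))
        (2 * c2') (2 * (d2' - c1')) &
      isotropy F X Z (lie (lie B f') Z) (2 * c2') (2 * (d2' - a2')) 0 (- 2 * c2')].
  move=> f1' r1' r2'; have [s1 s2] := isotropy_ad1 fXZ f1' rB r1' r2'; split; first by in_filt.
    by apply: (isotropy_cast s1); ring.
  by apply: (isotropy_cast s2); ring.
have [f1' r1' r2'] := ad_B _ _ _ _ _ _ _ _ _ f1 r1 r2.
have [f2 s1 s2] := ad_B _ _ _ _ _ _ _ _ _ f1' r1' r2'.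
have [f3 t1 t2] := ad_B _ _ _ _ _ _ _ _ _ f2 s1 s2.
have E0 := sl2_symbolZ fXZ rA rH f1 r1.
have E1 := sl2_symbolZ fXZ rA rH f1' r1'.
have E2 := sl2_symbolZ fXZ rA rH f2 s1.
have E3 := sl2_symbolZ fXZ rA rH f3 t1.
have [C1 C2] := first_prolongation fXZ f1 r1 r2.
clear - R r1 r2 E0 E1 E2 E3 C1 C2.
by exists a1, d2; split; [apply: (isotropy_cast r1)|apply: (isotropy_cast r2)]; lra.
Qed.

(** Conformality leaves four parameters for the brackets with X and Z, and the two
    relations of the first prolongation halve their number. *)
Lemma co2_symbol X Z J alpha f : co2_isotropy F X Z J alpha -> f \in F 1 ->
  exists a b, isotropy F X Z (lie f X) a (- 3 * b) (3 * b) a /\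
              isotropy F X Z (lie f Z) b (3 * a) (- 3 * a) b.
Proof.
case=> fXZ rJ co f1.
have [a1 [b1 [c1 [d1 [a2 [b2 [c2 [d2 [r1 r2]]]]]]]]] := isotropy_ex1 fXZ f1.
have [C1 C2] := first_prolongation fXZ f1 r1 r2.
have [D1 D2] := co _ _ _ _ _ r1; have [D3 D4] := co _ _ _ _ _ r2.
by exists a1, a2; split; [apply: (isotropy_cast r1)|apply: (isotropy_cast r2)]; lra.
Qed.

Lemma F1_eq0 X Z f : contact_frame F X Z -> f \in F 1 ->
  isotropy F X Z (lie f X) 0 0 0 0 -> isotropy F X Z (lie f Z) 0 0 0 0 -> f \in F 2.
Proof.
move=> fXZ f1 /(isotropy_eq0 cF fXZ) fX /(isotropy_eq0 cF fXZ) fZ.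
exact: (F_prolongXZ cF fXZ _ f1 fX fZ).
Qed.
End FirstProlongation.

(** * From layers to adapted bases *)

Section Layers.
Variables (R : realType) (g : finLieAlgType R) (F : int -> {vspace g}).
Hypothesis (cF : contact F).
Local Open Scope classical_set_scope.

(** A basis may be tested one layer F p / F (p + 1) at a time; successive approximations
    end because F 3 vanishes. *)
Lemma framed_layers (b : seq g) (d : seq int) t :
  (forall i, -2 <= nth 0 d i) ->
  (forall i, (i < size b)%N -> nth 0 b i \in F (nth 0 d i)) ->
  (forall v, v \in F 3 -> v = 0) -> (forall i, (i < size b)%N -> nth 0 d i <= 2) ->
  (forall p, p \in [:: -2; -1; 0; 1; 2] -> forall v, v \in F p -> exists c : nat -> R,
     v - \sum_(i < size b | nth 0 d i == p) c i *: nth 0 b i \in F (p + 1)) ->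
  (forall p, p \in [:: -2; -1; 0; 1; 2] -> forall c : nat -> R,
     \sum_(i < size b | nth 0 d i == p) c i *: nth 0 b i \in F (p + 1) ->
     forall i, (i < size b)%N -> nth 0 d i = p -> c i = 0) ->
  (forall i j, (i < j < size b)%N -> lie (nth 0 b i) (nth 0 b j) = comb b (t i j)) ->
  framed (fun p => [set` F p]) b d t.
Proof.
move=> d_ge bF F3 d_le span indep tab.
have small (p : int) : -2 <= p -> p <= 2 -> p \in [:: -2; -1; 0; 1; 2].
  by case: p => [[|[|[|n]]]|[|[|n]]].
have span_all (p : int) v : v \in F p ->
    exists2 u, span_deg b d p u & v - u \in F (p + 1).
  move=> vF; have [lt_p|ge_p] := ltrP p (-2).
    by exists 0; [exact: span_deg0|apply: (F_full cF); lia].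
  have [le_p|lt_p] := lerP p 2.
    have [c vc] := span p (small p ge_p le_p) v vF.
    eexists; last exact: vc.
    by apply: (@span_degW _ _ b d p (fun i => nth 0 d i == p)) => i /eqP ->.
  have v0 : v = 0 by apply: F3; apply: (F_le cF _ vF); lia.
  by exists 0; [exact: span_deg0|rewrite v0 subrr mem0v].
split=> //.
- move=> c c0 i lt_i.
  have main (n : nat) j : (j < size b)%N -> nth 0 d j < n%:Z - 2 -> c j = 0.
    elim: n j => [|n IHn] j lt_j; first by have := d_ge j; lia.
    have [/IHn->//|ge_j lt_jn] := ltrP (nth 0 d j) (n%:Z - 2).
    have dj : nth 0 d j = n%:Z - 2 by lia.
    have le2 := d_le j lt_j.
    apply: (indep (n%:Z - 2)) lt_j dj.
      by apply: small; lia.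
    move: c0; rewrite (bigID (fun i : 'I__ => nth 0 d i == n%:Z - 2)) /=.
    move/eqP; rewrite addr_eq0 => /eqP ->; rewrite rpredN.
    apply: memv_suml => k ne_k; have [lt_k|ge_k] := ltrP (nth 0 d k) (n%:Z - 2).
      by rewrite (IHn k) // scale0r mem0v.
    apply: memvZ; apply: (F_le cF _ (bF k (ltn_ord k))).
    by rewrite lezD1 lt_neqAle eq_sym ne_k.
  have [n lt_n] : exists n : nat, nth 0 d i < n%:Z - 2.
    by exists 5; have := d_le i lt_i; lia.
  exact: main lt_n.
- move=> p; apply/seteqP; split=> [v /= vF|v [c ->]] /=; last first.
    by apply: memv_suml => i pi; apply/memvZ/(F_le cF pi)/bF.
  have approx n : forall (q : int) w, w \in F q ->
      exists2 u, span_deg b d q u & w - u \in F (q + n%:Z).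
    elim: n => [|n IHn] q w wF.
      by exists 0; [exact: span_deg0|rewrite subr0 addr0].
    have [u1 u1q wu1] := span_all q w wF; have [u2 u2q wu2] := IHn _ _ wu1.
    exists (u1 + u2); first by apply: span_degD => //; apply: span_deg_le u2q; lia.
    by rewrite opprD addrA (_ : q + _ = q + 1 + n%:Z) //; lia.
  have [u uq vu] := approx `|(3 - p)%R|%N p v vF.
  suff -> : v = u by [].
  apply/eqP; rewrite -subr_eq0; apply/eqP/F3; apply: (F_le cF _ vu); lia.
Qed.
End Layers.

(** * Grading elements *)

Section Grading.
Variables (R : realType) (g : finLieAlgType R) (F : int -> {vspace g}).
Hypothesis (cF : contact F).
Implicit Types (u v w X Y Z V W h f : g) (p q r : int).
Variables (X0 Z0 E : g).
Hypotheses (fXZ0 : contact_frame F X0 Z0) (rE : isotropy F X0 Z0 E (-1) 0 0 (-1)).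

(** Membership in the summand of degree p of the grading defined by E. *)
Definition eig p v := lie E v = p%:~R *: v.

(** E acts as minus the identity in degree -1, hence as -2 on brackets [X,Z]; in
    nonnegative degrees the bracket with X or Z lowers both the degree and the eigenvalue
    by one, and these brackets determine an element modulo the next step. *)
Lemma E_act p v : -2 <= p -> v \in F p -> lie E v - p%:~R *: v \in F (p + 1).
Proof.
have [XF ZF _] := fXZ0; have [E0 [r [s [r0 s0 EX EZ]]]] := isotropyE rE.
rewrite scale0r addr0 scaleN1r in EX; rewrite scale0r add0r scaleN1r in EZ.
have act1 u : u \in F (-1) -> lie E u - (-1)%:~R *: u \in F 0.
  move=> /(frame_span cF fXZ0)[a [b [u0 u0F ->]]]; rewrite rmorphN1 !lieE EX EZ.
  by in_filt_by (a *: r + b *: s + lie E u0 + u0).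
have act2 u : lie E u - (-2)%:~R *: u \in F (-1).
  have [a [u0 u0F ->]] := Y_span cF u (frame_Y cF fXZ0).
  rewrite !lieE lie_jacr EX EZ !lieE (_ : (-2)%:~R = - 2 :> R); last by rewrite rmorphN.
  by in_filt_by (a *: (lie r Z0 + lie X0 s) + lie E u0 + 2 *: u0).
have step q : 0 <= q ->
    (forall u, u \in F (q - 1) -> lie E u - (q - 1)%:~R *: u \in F q) ->
    forall u, u \in F q -> lie E u - q%:~R *: u \in F (q + 1).
  move=> q0 IH u uF.
  have wF : lie E u - q%:~R *: u \in F q by in_filt.
  have qE : (q - 1)%:~R = q%:~R - 1 :> R by rewrite rmorphB.
  have IHX := IH (lie u X0); have IHZ := IH (lie u Z0); rewrite qE in IHX IHZ.
  have {}IHX : lie E (lie u X0) - (q%:~R - 1) *: lie u X0 \in F q by apply: IHX; in_filt.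
  have {}IHZ : lie E (lie u Z0) - (q%:~R - 1) *: lie u Z0 \in F q by apply: IHZ; in_filt.
  apply: (F_prolongXZ cF fXZ0 q0 wF).
    rewrite lieDl lieNl lieZl lie_jacl EX; move: (q%:~R) IHX => k IHX.
    by in_filt_by (lie E (lie u X0) - (k - 1) *: lie u X0 - lie u r).
  rewrite lieDl lieNl lieZl lie_jacl EZ; move: (q%:~R) IHZ => k IHZ.
  by in_filt_by (lie E (lie u Z0) - (k - 1) *: lie u Z0 - lie u s).
have nonneg (n : nat) u : u \in F n%:Z -> lie E u - n%:Z%:~R *: u \in F (n%:Z + 1).
  elim: n u => [|n IHn] u; first exact: step.
  apply: step => // w; have -> : n.+1%:Z - 1 = n%:Z by lia.
  by move=> /IHn; have -> : n%:Z + 1 = n.+1%:Z by lia.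
case: p => [n|[|[|n]]] // _ vF; [exact: nonneg|exact: act1].
Qed.

(** The defect E v' - p v' of an approximate eigenvector lies in some step
    F (p + n + 1), where E - p is invertible as multiplication by n + 1 up to the next
    step; subtracting the preimage improves the approximation, and the filtration is finite. *)
Lemma eig_lift p v : -2 <= p -> v \in F p ->
  exists2 v', eig p v' & v' - v \in F (p + 1).
Proof.
move=> p2 vF.
have approx n : exists2 v', v' - v \in F (p + 1) & lie E v' - p%:~R *: v' \in F (p + 1 + n%:Z).
  elim: n => [|n [v' v'v]]; first by exists v; rewrite ?subrr ?mem0v ?addr0 ?E_act.
  set u := lie E v' - _ => uF.
  have Eu := @E_act (p + 1 + n%:Z) u _ uF; move: Eu.
  have -> : (p + 1 + n%:Z)%:~R = p%:~R + n.+1%:R :> R by rewrite -addrA rmorphD /= -[1 + n%:Z]/(1 + n)%N%:Z.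
  have -> : p + 1 + n%:Z + 1 = p + 1 + n.+1%:Z by lia.
  move=> Eu; have {}Eu := Eu ltac:(lia).
  have n0 : n.+1%:R != 0 :> R by rewrite pnatr_eq0.
  exists (v' - n.+1%:R^-1 *: u).
    have u1 : u \in F (p + 1) by apply: (F_le cF _ uF); lia.
    rewrite addrAC; apply: rpredB => //; exact: memvZ.
  have -> : lie E (v' - n.+1%:R^-1 *: u) - p%:~R *: (v' - n.+1%:R^-1 *: u) =
     (- n.+1%:R^-1) *: (lie E u - (p%:~R + n.+1%:R) *: u).
    have EvE : lie E v' = u + p%:~R *: v' by rewrite /u; lmod.
    by move: u EvE {uF Eu} => u EvE; rewrite !lieE EvE; move: n.+1%:R n0 => k k0; lmod.
  exact: memvZ.
have [N N0 FN] := F_trivial cF; have [v' v'v ev'] := approx `|(N - p - 1)%R|%N.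
exists v' => //; apply/eqP; rewrite -subr_eq0; apply/eqP/FN; apply: (F_le cF _ ev'); lia.
Qed.

(** On F q and above, E - p acts on each layer as a nonzero number, so v descends the
    filtration forever. *)
Lemma eig_zero p q v : -2 <= q -> p < q -> eig p v -> v \in F q -> v = 0.
Proof.
move=> q2 pq ev vF; apply: (contact_sep cF) => r.
have main (n : nat) : v \in F (q + n%:Z).
  elim: n => [|n IHn]; first by rewrite addr0.
  have := @E_act (q + n%:Z) v _ IHn; rewrite ev -scalerBl -rmorphB /=.
  move=> /(_ ltac:(lia)) H; have -> : q + n.+1%:Z = q + n%:Z + 1 by lia.
  have nz : (p - (q + n%:Z))%:~R != 0 :> R by rewrite intr_eq0; lia.
  by rewrite -[v](scalerK nz); apply: memvZ.
by apply: (F_le cF _ (main `|(r - q)%R|%N)); lia.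
Qed.

Lemma eig_mem p v : -2 <= p -> eig p v -> v \in F p.
Proof.
move=> p2 ev.
have main (n : nat) : n%:Z - 2 <= p -> v \in F (n%:Z - 2).
  elim: n => [|n IHn] le_p; first exact: (F_full cF).
  have := @E_act (n%:Z - 2) v _ (IHn _); rewrite ev -scalerBl -rmorphB /=.
  move=> /(_ ltac:(lia) ltac:(lia)) H; have -> : n.+1%:Z - 2 = n%:Z - 2 + 1 by lia.
  have nz : (p - (n%:Z - 2))%:~R != 0 :> R by rewrite intr_eq0; lia.
  by rewrite -[v](scalerK nz); apply: memvZ.
have pE : `|(p + 2)%R|%N%:Z - 2 = p by lia.
by have := main `|(p + 2)%R|%N; rewrite pE => /(_ (lexx p)).
Qed.

Lemma eig_lie p q v w : eig p v -> eig q w -> eig (p + q) (lie v w).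
Proof.
by move=> ev ew; rewrite /eig lie_jacr ev ew lieZl lieZr rmorphD scalerDl.
Qed.
Lemma eigD p v w : eig p v -> eig p w -> eig p (v + w).
Proof. by move=> ev ew; rewrite /eig lieDr ev ew scalerDr. Qed.
Lemma eigZ p a v : eig p v -> eig p (a *: v).
Proof. by move=> ev; rewrite /eig lieZr ev !scalerA mulrC. Qed.
Lemma eigN p v : eig p v -> eig p (- v).
Proof. by move=> ev; rewrite /eig lieNr ev scalerN. Qed.

(** Correcting X0 and Z0 by elements of F 0 makes them homogeneous and does not change
    isotropy matrices. *)
Lemma graded_frame : exists X Z, [/\ contact_frame F X Z, eig (-1) X, eig (-1) Z &
  forall h a b c d, isotropy F X0 Z0 h a b c d -> isotropy F X Z h a b c d].
Proof.
have [X0F Z0F XZ0] := fXZ0.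
have [|X eX X1] := @eig_lift (-1) X0 _ X0F => //.
have [|Z eZ Z1] := @eig_lift (-1) Z0 _ Z0F => //.
move: X1 Z1; rewrite addNr => X1 Z1.
have XE : X = X0 + (X - X0) by lmod.
have ZE : Z = Z0 + (Z - Z0) by lmod.
move: (X - X0) (Z - Z0) X1 Z1 XE ZE => x z xF zF XE ZE.
exists X, Z; split=> //.
  split; [by rewrite XE; in_filt|by rewrite ZE; in_filt|] => a b ab; apply: XZ0.
  by rewrite XE ZE in ab; in_filt_by (a *: (X0 + x) + b *: (Z0 + z) - a *: x - b *: z).
move=> h a b c d [h0 r1 r2]; rewrite XE ZE; split=> //.
  by in_filt_by (lie h X0 - (a *: X0 + b *: Z0) + lie h x - a *: x - b *: z).
by in_filt_by (lie h Z0 - (c *: X0 + d *: Z0) + lie h z - c *: x - d *: z).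
Qed.

End Grading.

Section Graded.
Variables (R : realType) (g : finLieAlgType R) (F : int -> {vspace g}).
Hypothesis (cF : contact F).
Implicit Types (u v w h f : g) (p q r : int).
Variables (X Z E : g).
Hypotheses (fXZ : contact_frame F X Z) (rE : isotropy F X Z E (-1) 0 0 (-1)).
Hypotheses (eX : eig E (-1) X) (eZ : eig E (-1) Z).

(** The difference of the two sides is homogeneous of degree -1 and lies in F 0. *)
Lemma eig0_exact h a b c d : eig E 0 h -> isotropy F X Z h a b c d ->
  lie h X = a *: X + b *: Z /\ lie h Z = c *: X + d *: Z.
Proof.
move=> eh [_ r1 r2]; split; apply/eqP; rewrite -subr_eq0; apply/eqP.
  apply: (@eig_zero _ _ _ cF _ _ _ fXZ rE (-1) 0 _ _ _ _ r1) => //.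
  by apply: eigD; [exact: (eig_lie eh eX)|apply: eigN; apply: eigD; apply: eigZ].
apply: (@eig_zero _ _ _ cF _ _ _ fXZ rE (-1) 0 _ _ _ _ r2) => //.
by apply: eigD; [exact: (eig_lie eh eZ)|apply: eigN; apply: eigD; apply: eigZ].
Qed.

Lemma eig0_lift h a b c d : isotropy F X Z h a b c d ->
  exists h', [/\ eig E 0 h', isotropy F X Z h' a b c d,
    lie h' X = a *: X + b *: Z & lie h' Z = c *: X + d *: Z].
Proof.
move=> rh; have [h0 _] := isotropyE rh.
have [//|h' eh' hh'] := @eig_lift _ _ _ cF _ _ _ fXZ rE 0 h _ h0.
have rh' : isotropy F X Z h' a b c d by apply: (isotropy_mod cF fXZ rh).
have [e1 e2] := eig0_exact eh' rh'.
by exists h'.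
Qed.

Lemma eig_trans p v : 0 <= p -> eig E p v -> lie v X = 0 -> lie v Z = 0 -> v = 0.
Proof.
move=> p0 ev vX vZ; have vF : v \in F p by apply: (eig_mem cF fXZ rE) => //; lia.
apply: (@eig_zero _ _ _ cF _ _ _ fXZ rE p (p + 1)) => //; try lia.
by apply: (F_prolongXZ cF fXZ) => //; rewrite ?vX ?vZ mem0v.
Qed.

(** This makes computation in the graded algebra possible: an element of nonnegative degree
    is known from its brackets with X and Z. *)
Lemma eig_eq p v w : 0 <= p -> eig E p v -> eig E p w ->
  lie v X = lie w X -> lie v Z = lie w Z -> v = w.
Proof.
move=> p0 ev ew vX vZ; apply/eqP; rewrite -subr_eq0; apply/eqP.
by apply: (eig_trans p0); rewrite ?lieDl ?lieNl ?vX ?vZ ?subrr //; apply: eigD => //; apply: eigN.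
Qed.

Lemma eig_Y : eig E (-2) (lie X Z).
Proof. exact: (eig_lie eX eZ). Qed.

(** There is nothing in degree -3. *)
Lemma YX0 : lie (lie X Z) X = 0.
Proof.
apply: (eig_zero cF fXZ rE _ _ (eig_lie eig_Y eX) (F_full cF _ (lexx (-2)))) => //.
Qed.
Lemma YZ0 : lie (lie X Z) Z = 0.
Proof.
apply: (eig_zero cF fXZ rE _ _ (eig_lie eig_Y eZ) (F_full cF _ (lexx (-2)))) => //.
Qed.

Lemma eig_F p v : -2 <= p -> v \in F p -> exists v', [/\ eig E p v', v' \in F p & v - v' \in F (p + 1)].
Proof.
move=> p2 vF; have [v' ev vv'] := eig_lift cF fXZ rE p2 vF.
exists v'; split=> //; first exact: (eig_mem cF fXZ rE).
by rewrite -opprB rpredN.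
Qed.
End Graded.

(** * Isotropy algebra gl(2) *)

Section SplitGraded.
Variables (R : realType) (g : finLieAlgType R) (F : int -> {vspace g}).
Hypothesis (cF : contact F).
Implicit Types (u v w h f : g) (p q r : int).
(* In contact polynomials X, Z, Y, A, H, B, E and D are x, z, 1, x^2, xz, z^2, w = 2 y - x z
   and y. *)
Variables (X Z E A H B : g).
Hypotheses (fXZ : contact_frame F X Z) (rE : isotropy F X Z E (-1) 0 0 (-1)).
Hypotheses (eX : eig E (-1) X) (eZ : eig E (-1) Z).
Hypotheses (eA : eig E 0 A) (eH : eig E 0 H) (eB : eig E 0 B).
Hypotheses (rA : isotropy F X Z A 0 0 2 0) (rH : isotropy F X Z H (-1) 0 0 1)
  (rB : isotropy F X Z B 0 (-2) 0 0).

Variables (D Y : g).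
Hypotheses (DE : D = 2^-1 *: (E + H)) (YE : Y = lie X Z).
Let eE : eig E 0 E. Proof. by rewrite /eig lie_alt scale0r. Qed.
Let eD : eig E 0 D. Proof. by rewrite DE; apply/eigZ/eigD. Qed.

Let AX : lie A X = 0. Proof. by have [-> _] := eig0_exact cF fXZ rE eX eZ eA rA; lmod. Qed.
Let AZ : lie A Z = 2 *: X. Proof. by have [_ ->] := eig0_exact cF fXZ rE eX eZ eA rA; lmod. Qed.
Let HX : lie H X = - X. Proof. by have [-> _] := eig0_exact cF fXZ rE eX eZ eH rH; lmod. Qed.
Let HZ : lie H Z = Z. Proof. by have [_ ->] := eig0_exact cF fXZ rE eX eZ eH rH; lmod. Qed.
Let BX : lie B X = (-2) *: Z. Proof. by have [-> _] := eig0_exact cF fXZ rE eX eZ eB rB; lmod. Qed.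
Let BZ : lie B Z = 0. Proof. by have [_ ->] := eig0_exact cF fXZ rE eX eZ eB rB; lmod. Qed.
Let EX : lie E X = - X. Proof. by rewrite eX rmorphN1 scaleN1r. Qed.
Let EZ : lie E Z = - Z. Proof. by rewrite eZ rmorphN1 scaleN1r. Qed.
Let DX : lie D X = - X. Proof. by rewrite DE !lieE EX HX; lmod. Qed.
Let DZ : lie D Z = 0. Proof. by rewrite DE !lieE EZ HZ; lmod. Qed.

Let YX : lie Y X = 0. Proof. rewrite YE; exact: (YX0 cF fXZ rE eX eZ). Qed.
Let YZ : lie Y Z = 0. Proof. rewrite YE; exact: (YZ0 cF fXZ rE eX eZ). Qed.
Let XY : lie X Y = 0. Proof. by rewrite lieC YX oppr0. Qed.
Let ZY : lie Z Y = 0. Proof. by rewrite lieC YZ oppr0. Qed.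
Let ZX : lie Z X = - Y. Proof. by rewrite YE lieC. Qed.
Let XZE : lie X Z = Y. Proof. by rewrite YE. Qed.
Let XD : lie X D = X. Proof. by rewrite lieC DX opprK. Qed.
Let XA : lie X A = 0. Proof. by rewrite lieC AX oppr0. Qed.
Let XH : lie X H = X. Proof. by rewrite lieC HX opprK. Qed.
Let XB : lie X B = 2 *: Z. Proof. by rewrite lieC BX; lmod. Qed.
Let ZD : lie Z D = 0. Proof. by rewrite lieC DZ oppr0. Qed.
Let ZA : lie Z A = (-2) *: X. Proof. by rewrite lieC AZ; lmod. Qed.
Let ZH : lie Z H = - Z. Proof. by rewrite lieC HZ. Qed.
Let ZB : lie Z B = 0. Proof. by rewrite lieC BZ oppr0. Qed.

Let DY : lie D Y = - Y. Proof. by rewrite YE lie_jacr DX DZ !lieE; lmod. Qed.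
Let AY : lie A Y = 0. Proof. by rewrite YE lie_jacr AX AZ !lieE; lmod. Qed.
Let HY : lie H Y = 0. Proof. by rewrite YE lie_jacr HX HZ !lieE addNr. Qed.
Let BY : lie B Y = 0. Proof. by rewrite YE lie_jacr BX BZ !lieE; lmod. Qed.
Let YD : lie Y D = Y. Proof. by rewrite lieC DY opprK. Qed.
Let YA : lie Y A = 0. Proof. by rewrite lieC AY oppr0. Qed.
Let YH : lie Y H = 0. Proof. by rewrite lieC HY oppr0. Qed.
Let YB : lie Y B = 0. Proof. by rewrite lieC BY oppr0. Qed.

Let act0 := (AX, AZ, HX, HZ, BX, BZ, DX, DZ).

Let eq0 u v h : eig E 0 u -> eig E 0 v -> eig E 0 h ->
  lie u (lie v X) - lie v (lie u X) = lie h X ->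
  lie u (lie v Z) - lie v (lie u Z) = lie h Z -> lie u v = h.
Proof.
move=> eu ev eh hX hZ; apply: (eig_eq cF fXZ rE (lexx 0)) => //; rewrite ?lie_jacl //.
exact: (eig_lie eu ev).
Qed.
Let DA : lie D A = - A.
Proof. by apply: (eq0 eD eA (eigN eA)); rewrite !(act0, lieE); lmod. Qed.
Let DB : lie D B = B.
Proof. by apply: (eq0 eD eB eB); rewrite !(act0, lieE); lmod. Qed.
Let DH : lie D H = 0.
Proof. by rewrite -[RHS](scale0r H); apply: (eq0 eD eH (eigZ 0 eH)); rewrite !(act0, lieE); lmod. Qed.
Let AH : lie A H = 2 *: A.
Proof. by apply: (eq0 eA eH (eigZ 2 eA)); rewrite !(act0, lieE); lmod. Qed.
Let AB : lie A B = 4 *: H.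
Proof. by apply: (eq0 eA eB (eigZ 4 eH)); rewrite !(act0, lieE); lmod. Qed.
Let HB : lie H B = 2 *: B.
Proof. by apply: (eq0 eH eB (eigZ 2 eB)); rewrite !(act0, lieE); lmod. Qed.

Let deg0_span v : v \in F 0 -> exists a b c d,
  v - (a *: D + b *: A + c *: H + d *: B) \in F 1.
Proof.
move=> v0; have [a [b [c [d rv]]]] := isotropy_ex cF fXZ v0.
exists (- a - d), (c / 2), d, (- b / 2); apply: (isotropy_inj cF fXZ rv).
have r0 := isotropy_F1 cF fXZ (mem0v (F 1)).
have -> : (- a - d) *: D + (c / 2) *: A + d *: H + (- b / 2) *: B =
  ((- a - d) / 2) *: E + (((- a - d) / 2 + d) *: H + ((c / 2) *: A + ((- b / 2) *: B + 0))).
  by rewrite DE; lmod.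
apply: (isotropy_cast (isotropy_lin cF _ rE (isotropy_lin cF _ rH (isotropy_lin cF _ rA (isotropy_lin cF _ rB r0))))); by field.
Qed.

Let deg0_free a b c d : a *: D + b *: A + c *: H + d *: B \in F 1 ->
  [/\ a = 0, b = 0, c = 0 & d = 0].
Proof.
have [XF ZF XZ] := fXZ.
set v := _ + _ => vF.
have vX : lie v X = (- a - c) *: X + (- 2 * d) *: Z by rewrite /v !(act0, lieE); lmod.
have vZ : lie v Z = (2 * b) *: X + c *: Z by rewrite /v !(act0, lieE); lmod.
have : lie v X \in F 0 by in_filt.
rewrite vX => /XZ[e1 e2]; have : lie v Z \in F 0 by in_filt.
by rewrite vZ => /XZ[e3 e4]; split; lra.
Qed.

Lemma framed_gl2_affine : (forall v, v \in F 1 -> v = 0) ->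
  exists2 b : seq g, size b = 7 & framed (fun p => [set` F p])%classic b deg_gl2 (tab_gl2 R).
Proof.
move=> F1; have [XF ZF XZ] := fXZ; have := frame_Y cF fXZ; rewrite -YE => Y1.
have F_zero p v : 1 <= p -> v \in F p -> v = 0 by move=> p1 vF; apply/F1/(F_le cF p1 vF).
exists [:: Y; X; D; Z; A; H; B] => //; apply: framed_layers => //.
- by do 8?[case=> //].
- do 8?[case=> [_|] //] => /=; apply: (eig_mem cF fXZ rE) => //.
  by rewrite YE; exact: (eig_Y eX eZ).
- by move=> v; apply: F_zero.
- by do 8?[case=> [_|] //].
- move=> p; rewrite !inE => /or4P[/eqP->|/eqP->|/eqP->|/orP[/eqP->|/eqP->]] v vF.
  + have [a [u uF ->]] := Y_span cF v Y1; exists (fun=> a).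
    by rewrite big_mkcond !big_ord_recl big_ord0 /=; in_filt_by u.
  + have [a [b [u uF ->]]] := frame_span cF fXZ vF; exists (nth 0 [:: 0; a; 0; b]).
    by rewrite big_mkcond !big_ord_recl big_ord0 /=; in_filt_by u.
  + have [a [b [c [d vE]]]] := deg0_span vF; exists (nth 0 [:: 0; 0; a; 0; b; c; d]).
    by rewrite big_mkcond !big_ord_recl big_ord0 /=; in_filt_by (v - (a *: D + b *: A + c *: H + d *: B)).
  + have -> : v = 0 by exact: F_zero vF.
    by exists (fun=> 0); rewrite big1 ?subr0 ?mem0v // => i _; rewrite scale0r.
  + have -> : v = 0 by exact: F_zero vF.
    by exists (fun=> 0); rewrite big1 ?subr0 ?mem0v // => i _; rewrite scale0r.
- move=> p; rewrite !inE => /or4P[/eqP->|/eqP->|/eqP->|/orP[/eqP->|/eqP->]] c;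
    rewrite big_mkcond !big_ord_recl big_ord0 /= => hF.
  + have c0 : c 0%N = 0 by apply: (coef_notin _ Y1); in_filt_from hF.
    by do 8?[case=> [//|] //].
  + have /XZ[c1 c3] : c 1%N *: X + c 3%N *: Z \in F 0 by in_filt_from hF.
    by do 8?[case=> [//|] //].
  + have /deg0_free[c2 c4 c5 c6] : c 2%N *: D + c 4%N *: A + c 5%N *: H + c 6%N *: B \in F 1 by in_filt_from hF.
    by do 8?[case=> [//|] //].
  + by do 8?[case=> [//|] //].
  + by do 8?[case=> [//|] //].
- move=> i j /andP[]; do 8?[case: i => [|i]] => //; do 8?[case: j => [|j]] => //= _ _; rewrite /comb /= ?(XZE, YX, YZ, XY, ZY, ZX, XD, XA, XH, XB, ZD, ZA, ZH, ZB, DY, AY, HY, BY, YD, YA, YH, YB, DA, DB, DH, AH, AB, HB, AX, AZ, HX, HZ, BX, BZ, DX, DZ); by lmod.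
Qed.

Let deg1_eq f : eig E 1 f -> exists a d,
  lie f X = (- a) *: D + (d / 2) *: A /\ lie f Z = (- a / 2) *: B + d *: (H - D).
Proof.
move=> ef; have f1 : f \in F 1 by exact: (eig_mem cF fXZ rE).
have [a [d [r1 r2]]] := sl2_symbol cF fXZ rA rH rB f1.
have [e1 e2] := eig0_exact cF fXZ rE eX eZ (eig_lie ef eX) r1.
have [e3 e4] := eig0_exact cF fXZ rE eX eZ (eig_lie ef eZ) r2.
exists a, d; split.
  apply: (eig_eq cF fXZ rE (lexx 0) (eig_lie ef eX)).
  - by apply: eigD; apply: eigZ.
  - by rewrite e1 !(act0, lieE); lmod.
  - by rewrite e2 !(act0, lieE); lmod.
apply: (eig_eq cF fXZ rE (lexx 0) (eig_lie ef eZ)).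
- by apply: eigD; apply: eigZ => //; apply: eigD => //; apply: eigN.
- by rewrite e3 !(act0, lieE); lmod.
- by rewrite e4 !(act0, lieE); lmod.
Qed.

Let AD : lie A D = A. Proof. by rewrite lieC DA opprK. Qed.
Let BD : lie B D = - B. Proof. by rewrite lieC DB. Qed.
Let HD : lie H D = 0. Proof. by rewrite lieC DH oppr0. Qed.
Let HA : lie H A = (- 2) *: A. Proof. by rewrite lieC AH; lmod. Qed.
Let BA : lie B A = (- 4) *: H. Proof. by rewrite lieC AB; lmod. Qed.
Let BH : lie B H = (- 2) *: B. Proof. by rewrite lieC HB; lmod. Qed.
Let com0 := (AD, BD, HD, HA, BA, BH, DA, DB, DH, AH, AB, HB).
Let actY := (DY, AY, HY, BY, YD, YA, YH, YB, YX, YZ, XY, ZY, ZX, XZE).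
Let actX := (XD, XA, XH, XB, ZD, ZA, ZH, ZB).

(** P and Q stand for xw and zw. They span an irreducible module under A, H and B, so each
    nonzero combination of them yields both, by brackets with A and B. *)
Lemma split_quadrics : (exists2 f, f \in F 1 & f \notin F 2) -> exists P Q,
  [/\ eig E 1 P /\ eig E 1 Q, lie P X = - A, lie P Z = 2 *: D - 2 *: H,
    lie Q X = (- 2) *: D & lie Q Z = - B].
Proof.
have eqA f a d : eig E 1 f -> lie f X = (- a) *: D + (d / 2) *: A ->
    lie f Z = (- a / 2) *: B + d *: (H - D) ->
    [/\ eig E 1 (lie A f), lie (lie A f) X = (- a) *: A &
      lie (lie A f) Z = (2 * a) *: D - (2 * a) *: H].
  move=> ef fX fZ; split; first exact: (eig_lie eA ef).
    by rewrite lie_jacl fX !(act0, com0, lieE); lmod.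
  by rewrite lie_jacl fZ !(act0, com0, lieE) fX; lmod.
have eqB f a d : eig E 1 f -> lie f X = (- a) *: D + (d / 2) *: A ->
    lie f Z = (- a / 2) *: B + d *: (H - D) ->
    [/\ eig E 1 (lie B f), lie (lie B f) X = (- 2 * d) *: D &
      lie (lie B f) Z = (- d) *: B].
  move=> ef fX fZ; split; first exact: (eig_lie eB ef).
    by rewrite lie_jacl fX !(act0, com0, lieE) fZ; lmod.
  by rewrite lie_jacl fZ !(act0, com0, lieE); lmod.
case=> f0 f1 f2; have [//|f [ef ff ff0]] := eig_F cF fXZ rE _ f1.
have [a [d [fX fZ]]] := deg1_eq ef.
have [a0|a0] := eqVneq a 0; last first.
  have [eP PX PZ] := eqA f a d ef fX fZ.
  have {}eP := eigZ a^-1 eP.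
  have PX' : lie (a^-1 *: lie A f) X = (- 0) *: D + (- 2 / 2) *: A.
    by rewrite lieZl PX; lmod.
  have PZ' : lie (a^-1 *: lie A f) Z = (- 0 / 2) *: B + (- 2) *: (H - D).
    by rewrite lieZl PZ; lmod.
  have [eQ QX QZ] := eqB _ 0 (- 2) eP PX' PZ'.
  exists (a^-1 *: lie A f), ((- 2^-1) *: lie B (a^-1 *: lie A f)); split.
  - by split=> //; apply: eigZ.
  - by rewrite PX'; lmod.
  - by rewrite PZ'; lmod.
  - by rewrite lieZl QX; lmod.
  - by rewrite lieZl QZ; lmod.
have d0 : d != 0.
  apply: contra f2 => /eqP d0.
  suff f00 : f = 0 by move: ff0; rewrite f00 subr0.
  apply: (eig_trans cF fXZ rE (ler01 : 0 <= 1)) => //.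
    by rewrite fX a0 d0; lmod.
  by rewrite fZ a0 d0; lmod.
have [eQ QX QZ] := eqB f a d ef fX fZ.
have {}eQ := eigZ d^-1 eQ.
have QX' : lie (d^-1 *: lie B f) X = (- 2) *: D + (0 / 2) *: A.
  by rewrite lieZl QX; lmod.
have QZ' : lie (d^-1 *: lie B f) Z = (- 2 / 2) *: B + 0 *: (H - D).
  by rewrite lieZl QZ; lmod.
have [eP PX PZ] := eqA _ 2 0 eQ QX' QZ'.
exists (2^-1 *: lie A (d^-1 *: lie B f)), (d^-1 *: lie B f); split.
- by split=> //; apply: eigZ.
- by rewrite lieZl PX; lmod.
- by rewrite lieZl PZ; lmod.
- by rewrite QX'; lmod.
- by rewrite QZ'; lmod.
Qed.

Section Projective.
Variables (P Q r : g).
Hypotheses (eP : eig E 1 P) (eQ : eig E 1 Q) (rE' : r = lie P Q).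
Hypotheses (PX : lie P X = - A) (PZ : lie P Z = 2 *: D - 2 *: H)
  (QX : lie Q X = (- 2) *: D) (QZ : lie Q Z = - B).

Let act1 := (PX, PZ, QX, QZ).
Let er : eig E 2 r. Proof. by rewrite rE'; exact: (eig_lie eP eQ). Qed.
Let eq1 p u v q h : 0 <= p + q -> eig E p u -> eig E q v -> eig E (p + q) h ->
  lie u (lie v X) - lie v (lie u X) = lie h X ->
  lie u (lie v Z) - lie v (lie u Z) = lie h Z -> lie u v = h.
Proof.
move=> pq eu ev eh hX hZ; apply: (eig_eq cF fXZ rE pq) => //; rewrite ?lie_jacl //.
exact: (eig_lie eu ev).
Qed.
Let XP : lie X P = A. Proof. by rewrite lieC PX opprK. Qed.
Let XQ : lie X Q = 2 *: D. Proof. by rewrite lieC QX; lmod. Qed.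
Let ZP : lie Z P = (- 2) *: D + 2 *: H. Proof. by rewrite lieC PZ; lmod. Qed.
Let ZQ : lie Z Q = B. Proof. by rewrite lieC QZ opprK. Qed.
Let YP : lie Y P = 2 *: X.
Proof. by rewrite YE lie_jacl XP ZP !(lieE, actX, ZX); lmod. Qed.
Let YQ : lie Y Q = 2 *: Z.
Proof. by rewrite YE lie_jacl XQ ZQ !(lieE, actX, ZX); lmod. Qed.
Let DP : lie D P = 0.
Proof. by rewrite -[RHS](scale0r P); apply: (eq1 _ eD eP (eigZ 0 eP)); rewrite // !(act0, com0, act1, lieE); lmod. Qed.
Let DQ : lie D Q = Q.
Proof. by apply: (eq1 _ eD eQ eQ); rewrite // !(act0, com0, act1, lieE); lmod. Qed.
Let AP : lie A P = 0.
Proof. by rewrite -[RHS](scale0r P); apply: (eq1 _ eA eP (eigZ 0 eP)); rewrite // !(act0, com0, act1, lieE); lmod. Qed.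
Let AQ : lie A Q = 2 *: P.
Proof. by apply: (eq1 _ eA eQ (eigZ 2 eP)); rewrite // !(act0, com0, act1, lieE); lmod. Qed.
Let HP : lie H P = - P.
Proof. by apply: (eq1 _ eH eP (eigN eP)); rewrite // !(act0, com0, act1, lieE); lmod. Qed.
Let HQ : lie H Q = Q.
Proof. by apply: (eq1 _ eH eQ eQ); rewrite // !(act0, com0, act1, lieE); lmod. Qed.
Let BP : lie B P = (- 2) *: Q.
Proof. by apply: (eq1 _ eB eP (eigZ (- 2) eQ)); rewrite // !(act0, com0, act1, lieE); lmod. Qed.
Let BQ : lie B Q = 0.
Proof. by rewrite -[RHS](scale0r P); apply: (eq1 _ eB eQ (eigZ 0 eP)); rewrite // !(act0, com0, act1, lieE); lmod. Qed.
Let com1 := (DP, DQ, AP, AQ, HP, HQ, BP, BQ).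
Let PD : lie P D = 0. Proof. by rewrite lieC DP oppr0. Qed.
Let PB : lie P B = 2 *: Q. Proof. by rewrite lieC BP; lmod. Qed.
Let QD : lie Q D = - Q. Proof. by rewrite lieC DQ. Qed.
Let QA : lie Q A = (- 2) *: P. Proof. by rewrite lieC AQ; lmod. Qed.
Let rX : lie r X = (- 2) *: P.
Proof. by rewrite rE' lie_jacl PX QX !(lieE, QA, PD); lmod. Qed.
Let rZ : lie r Z = (- 2) *: Q.
Proof. by rewrite rE' lie_jacl PZ QZ !(lieE, PB, QD) (lieC Q H) HQ; lmod. Qed.
Let Xr : lie X r = 2 *: P. Proof. by rewrite lieC rX; lmod. Qed.
Let Zr : lie Z r = 2 *: Q. Proof. by rewrite lieC rZ; lmod. Qed.
Let Yr : lie Y r = 8 *: D - 4 *: H.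
Proof. by rewrite YE lie_jacl Zr Xr !(lieE, XQ, ZP); lmod. Qed.
Let Dr : lie D r = r.
Proof. by rewrite {1}rE' lie_jacr DP DQ -rE' !lieE; lmod. Qed.
Let Ar : lie A r = 0.
Proof. by rewrite rE' lie_jacr AP AQ !lieE; lmod. Qed.
Let Hr : lie H r = 0.
Proof. by rewrite rE' lie_jacr HP HQ !lieE; lmod. Qed.
Let Br : lie B r = 0.
Proof. by rewrite rE' lie_jacr BP BQ !lieE; lmod. Qed.
Let rY : lie r Y = (- 8) *: D + 4 *: H. Proof. by rewrite lieC Yr; lmod. Qed.

Let deg1_span f : eig E 1 f -> exists a b, f = a *: P + b *: Q.
Proof.
move=> ef; have [a [d [fX fZ]]] := deg1_eq ef; exists (- d / 2), (a / 2).
apply: (eig_eq cF fXZ rE ler01 ef); first by apply: eigD; apply: eigZ.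
  by rewrite fX !(lieE, act1); lmod.
by rewrite fZ !(lieE, act1); lmod.
Qed.

(** The brackets [f,X] and [f,Z] are combinations of P and Q; the Jacobi identities
    expressing [X,Y] = 0 and [Z,Y] = 0 leave only multiples of those of r. The same
    identities exclude degree 3. *)
Let deg2_span f : eig E 2 f -> exists a, f = a *: r.
Proof.
move=> ef; have [XF ZF XZ] := fXZ.
have [a [b fX]] := deg1_span (eig_lie ef eX).
have [c [d fZ]] := deg1_span (eig_lie ef eZ).
have fY : lie f Y = lie (a *: P + b *: Q) Z + lie X (c *: P + d *: Q).
  by rewrite YE lie_jacr fX fZ.
have : (2 * d - 2 * a) *: X + (- 4 * b) *: Z \in F 0.
  have <- : lie f (lie X Y) = (2 * d - 2 * a) *: X + (- 4 * b) *: Z.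
    by rewrite lie_jacr fX fY !(lieE, act1, XP, XQ, actX) (lieC P Y) (lieC Q Y) YP YQ; lmod.
  by rewrite XY lie0r mem0v.
have : (- 4 * c) *: X + (2 * a - 2 * d) *: Z \in F 0.
  have <- : lie f (lie Z Y) = (- 4 * c) *: X + (2 * a - 2 * d) *: Z.
    by rewrite lie_jacr fZ fY !(lieE, act1, XP, XQ, actX) (lieC P Y) (lieC Q Y) YP YQ; lmod.
  by rewrite ZY lie0r mem0v.
move=> /XZ[c0 _] /XZ[ad b0].
have {}b0 : b = 0 by lra.
have {}c0 : c = 0 by lra.
have {}ad : d = a by lra.
exists (- a / 2); apply: (eig_eq cF fXZ rE (ler0n _ 2) ef); first exact: eigZ.
  by rewrite fX lieZl rX b0; lmod.
by rewrite fZ lieZl rZ c0 ad; lmod.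
Qed.

Let deg3_zero f : eig E 3 f -> f = 0.
Proof.
move=> ef; have [a fX] := deg2_span (eig_lie ef eX).
have [b fZ] := deg2_span (eig_lie ef eZ).
have fY : lie f Y = lie (a *: r) Z + lie X (b *: r).
  by rewrite YE lie_jacr fX fZ.
have : (- 12 * a) *: D + (2 * b) *: A + (4 * a) *: H + 0 *: B \in F 1.
  have <- : lie f (lie X Y) = (- 12 * a) *: D + (2 * b) *: A + (4 * a) *: H + 0 *: B.
    by rewrite lie_jacr fX fY !(lieE, rX, rZ, rY, Xr, XP, XQ); lmod.
  by rewrite XY lie0r mem0v.
move=> /deg0_free[a0 b0 _ _].
have {}a0 : a = 0 by lra.
have {}b0 : b = 0 by lra.
apply: (eig_trans cF fXZ rE (ler0n _ 3) ef).
  by rewrite fX a0 scale0r.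
by rewrite fZ b0 scale0r.
Qed.

Let F3 v : v \in F 3 -> v = 0.
Proof.
move: v; apply: (F_stable cF) => // v v3.
have [//|u [eu _ vu]] := eig_F cF fXZ rE _ v3.
by move: vu; rewrite (deg3_zero eu) subr0.
Qed.

Lemma framed_projective :
  exists2 b : seq g, size b = 10 & framed (fun p => [set` F p])%classic b deg_projective (tab_projective R).
Proof.
have [XF ZF XZ] := fXZ; have := frame_Y cF fXZ; rewrite -YE => Y1.
have P1 : P \in F 1 by exact: (eig_mem cF fXZ rE).
have Q1 : Q \in F 1 by exact: (eig_mem cF fXZ rE).
have r2 : r \in F 2 by exact: (eig_mem cF fXZ rE).
exists [:: Y; X; D; Z; A; H; B; P; Q; r] => //; apply: framed_layers => //.
- by do 11?[case=> //].
- do 11?[case=> [_|] //] => /=; apply: (eig_mem cF fXZ rE) => //.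
  by rewrite YE; exact: (eig_Y eX eZ).
- by do 11?[case=> [_|] //].
- move=> p; rewrite !inE => /or4P[/eqP->|/eqP->|/eqP->|/orP[/eqP->|/eqP->]] v vF.
  + have [a [u uF ->]] := Y_span cF v Y1; exists (fun=> a).
    by rewrite big_mkcond !big_ord_recl big_ord0 /=; in_filt_by u.
  + have [a [b [u uF ->]]] := frame_span cF fXZ vF; exists (nth 0 [:: 0; a; 0; b]).
    by rewrite big_mkcond !big_ord_recl big_ord0 /=; in_filt_by u.
  + have [a [b [c [d vE]]]] := deg0_span vF; exists (nth 0 [:: 0; 0; a; 0; b; c; d]).
    by rewrite big_mkcond !big_ord_recl big_ord0 /=; in_filt_by (v - (a *: D + b *: A + c *: H + d *: B)).
  + have [//|u [eu _ vu]] := eig_F cF fXZ rE _ vF; have [a [b uE]] := deg1_span eu.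
    exists (nth 0 [:: 0; 0; 0; 0; 0; 0; 0; a; b]).
    by rewrite big_mkcond !big_ord_recl big_ord0 /=; rewrite uE in vu; in_filt_by (v - (a *: P + b *: Q)).
  + have [//|u [eu _ vu]] := eig_F cF fXZ rE _ vF; have [a uE] := deg2_span eu.
    exists (fun=> a).
    by rewrite big_mkcond !big_ord_recl big_ord0 /=; rewrite uE in vu; in_filt_by (v - a *: r).
- move=> p; rewrite !inE => /or4P[/eqP->|/eqP->|/eqP->|/orP[/eqP->|/eqP->]] c;
    rewrite big_mkcond !big_ord_recl big_ord0 /= => hF.
  + have c0 : c 0%N = 0 by apply: (coef_notin _ Y1); in_filt_from hF.
    by do 11?[case=> [//|] //].
  + have /XZ[c1 c3] : c 1%N *: X + c 3%N *: Z \in F 0 by in_filt_from hF.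
    by do 11?[case=> [//|] //].
  + have /deg0_free[c2 c4 c5 c6] : c 2%N *: D + c 4%N *: A + c 5%N *: H + c 6%N *: B \in F 1 by in_filt_from hF.
    by do 11?[case=> [//|] //].
  + have {}hF : c 7%N *: P + c 8%N *: Q \in F 2 by in_filt_from hF.
    have : lie (c 7%N *: P + c 8%N *: Q) X \in F 1 by in_filt.
    have -> : lie (c 7%N *: P + c 8%N *: Q) X =
        (- 2 * c 8%N) *: D + (- c 7%N) *: A + 0 *: H + 0 *: B.
      by rewrite !(lieE, act1); lmod.
    move=> /deg0_free[c8 c7 _ _].
    have {}c8 : c 8%N = 0 by lra.
    have {}c7 : c 7%N = 0 by lra.
    by do 11?[case=> [//|] //].
  + have /F3 r0 : c 9%N *: r \in F 3 by in_filt_from hF.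
    have : lie (lie (c 9%N *: r) X) Z \in F 1 by rewrite r0 !lie0l mem0v.
    have -> : lie (lie (c 9%N *: r) X) Z = (- 4 * c 9%N) *: D + 0 *: A + (4 * c 9%N) *: H + 0 *: B.
      by rewrite !(lieE, rX, act1); lmod.
    move=> /deg0_free[c9 _ _ _].
    have {}c9 : c 9%N = 0 by lra.
    by do 11?[case=> [//|] //].
- have Pr : lie P r = 0.
    by apply: deg3_zero; exact: (eig_lie eP er).
  have Qr : lie Q r = 0.
    by apply: deg3_zero; exact: (eig_lie eQ er).
  move=> i j /andP[]; do 11?[case: i => [|i]] => //; do 11?[case: j => [|j]] => //= _ _;
    rewrite /comb /= ?(actX, actY, com0, act0, XP, XQ, ZP, ZQ, YP, YQ, com1, Xr, Zr, Yr, Dr, Ar, Hr, Br, Pr, Qr) -?rE'; by lmod.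
Qed.
End Projective.

End SplitGraded.

(** * Conformal isotropy with a grading element *)

Section ConformalGraded.
Variables (R : realType) (g : finLieAlgType R) (F : int -> {vspace g}).
Hypothesis (cF : contact F).
Implicit Types (u v w h f : g) (p q : int).
(* In contact polynomials X, Z, Y, J and E are x, z, 1, x^2 + z^2 and w = 2 y - x z; J' is
   any generator with dilation part alpha, of which J is the rotation part. *)
Variables (X Z E J Y : g) (alpha : R) (J' : g).
Hypotheses (co : co2_isotropy F X Z J' alpha) (rE : isotropy F X Z E (-1) 0 0 (-1)).
Hypotheses (eX : eig E (-1) X) (eZ : eig E (-1) Z) (eJ : eig E 0 J).
Hypotheses (rJ : isotropy F X Z J 0 (-2) 2 0) (YE : Y = lie X Z).

Let fXZ : contact_frame F X Z. Proof. by case: co. Qed.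
Let eE : eig E 0 E. Proof. by rewrite /eig lie_alt scale0r. Qed.

Let JX : lie J X = (- 2) *: Z. Proof. by have [-> _] := eig0_exact cF fXZ rE eX eZ eJ rJ; lmod. Qed.
Let JZ : lie J Z = 2 *: X. Proof. by have [_ ->] := eig0_exact cF fXZ rE eX eZ eJ rJ; lmod. Qed.
Let EX : lie E X = - X. Proof. by rewrite eX rmorphN1 scaleN1r. Qed.
Let EZ : lie E Z = - Z. Proof. by rewrite eZ rmorphN1 scaleN1r. Qed.
Let XZE : lie X Z = Y. Proof. by rewrite YE. Qed.
Let YX : lie Y X = 0. Proof. rewrite YE; exact: (YX0 cF fXZ rE eX eZ). Qed.
Let YZ : lie Y Z = 0. Proof. rewrite YE; exact: (YZ0 cF fXZ rE eX eZ). Qed.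
Let XY : lie X Y = 0. Proof. by rewrite lieC YX oppr0. Qed.
Let ZY : lie Z Y = 0. Proof. by rewrite lieC YZ oppr0. Qed.
Let ZX : lie Z X = - Y. Proof. by rewrite YE lieC. Qed.
Let XJ : lie X J = 2 *: Z. Proof. by rewrite lieC JX; lmod. Qed.
Let ZJ : lie Z J = (- 2) *: X. Proof. by rewrite lieC JZ; lmod. Qed.
Let XE : lie X E = X. Proof. by rewrite lieC EX opprK. Qed.
Let ZE : lie Z E = Z. Proof. by rewrite lieC EZ opprK. Qed.
Let JY : lie J Y = 0. Proof. by rewrite YE lie_jacr JX JZ !lieE !scaler0 addr0. Qed.
Let EY : lie E Y = (- 2) *: Y. Proof. by rewrite YE lie_jacr EX EZ !lieE; lmod. Qed.
Let YJ : lie Y J = 0. Proof. by rewrite lieC JY oppr0. Qed.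
Let YE' : lie Y E = 2 *: Y. Proof. by rewrite lieC EY; lmod. Qed.
Let EJ : lie E J = 0. Proof. by rewrite eJ scale0r. Qed.
Let JE : lie J E = 0. Proof. by rewrite lieC EJ oppr0. Qed.
Let act0 := (JX, JZ, EX, EZ, JY, EY, EJ, JE).
Let actX := (XJ, ZJ, XE, ZE, YJ, YE', YX, YZ, XY, ZY, ZX, XZE).

Let deg0_span v : v \in F 0 -> exists a b, v - (a *: J + b *: E) \in F 1.
Proof.
move=> v0; have [a [b [c [d rv]]]] := isotropy_ex cF fXZ v0.
have [_ _ conf] := co; have [ad bc] := conf _ _ _ _ _ rv.
exists (c / 2), (- d); apply: (isotropy_inj cF fXZ rv).
have r0 := isotropy_F1 cF fXZ (mem0v (F 1)).
have -> : (c / 2) *: J + (- d) *: E = (c / 2) *: J + ((- d) *: E + 0) by lmod.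
by apply: (isotropy_cast (isotropy_lin cF _ rJ (isotropy_lin cF _ rE r0))); rewrite ?ad ?bc; field.
Qed.

Let deg0_free a b : a *: J + b *: E \in F 1 -> a = 0 /\ b = 0.
Proof.
have [XF ZF XZ] := fXZ.
set v := _ + _ => vF.
have vX : lie v X = (- b) *: X + (- 2 * a) *: Z by rewrite /v !(act0, lieE); lmod.
have : lie v X \in F 0 by in_filt.
by rewrite vX => /XZ[e1 e2]; split; lra.
Qed.

Lemma framed_similitude : (forall v, v \in F 1 -> v = 0) ->
  exists2 b : seq g, size b = 5 & framed (fun p => [set` F p])%classic b deg_similitude (tab_similitude R).
Proof.
move=> F1; have [XF ZF XZ] := fXZ; have := frame_Y cF fXZ; rewrite -YE => Y1.
have F_zero p v : 1 <= p -> v \in F p -> v = 0 by move=> p1 vF; apply/F1/(F_le cF p1 vF).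
exists [:: Y; X; Z; J; E] => //; apply: framed_layers => //.
- by do 8?[case=> //].
- by do 8?[case=> [_|] //] => /=; apply: (eig_mem cF fXZ rE) => //.
- by move=> v; apply: F_zero.
- by do 8?[case=> [_|] //].
- move=> p; rewrite !inE => /or4P[/eqP->|/eqP->|/eqP->|/orP[/eqP->|/eqP->]] v vF.
  + have [a [u uF ->]] := Y_span cF v Y1; exists (fun=> a).
    by rewrite big_mkcond !big_ord_recl big_ord0 /=; in_filt_by u.
  + have [a [b [u uF ->]]] := frame_span cF fXZ vF; exists (nth 0 [:: 0; a; b]).
    by rewrite big_mkcond !big_ord_recl big_ord0 /=; in_filt_by u.
  + have [a [b vE]] := deg0_span vF; exists (nth 0 [:: 0; 0; 0; a; b]).
    by rewrite big_mkcond !big_ord_recl big_ord0 /=; in_filt_by (v - (a *: J + b *: E)).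
  + have -> : v = 0 by exact: F_zero vF.
    by exists (fun=> 0); rewrite big1 ?subr0 ?mem0v // => i _; rewrite scale0r.
  + have -> : v = 0 by exact: F_zero vF.
    by exists (fun=> 0); rewrite big1 ?subr0 ?mem0v // => i _; rewrite scale0r.
- move=> p; rewrite !inE => /or4P[/eqP->|/eqP->|/eqP->|/orP[/eqP->|/eqP->]] c;
    rewrite big_mkcond !big_ord_recl big_ord0 /= => hF.
  + have c0 : c 0%N = 0 by apply: (coef_notin _ Y1); in_filt_from hF.
    by do 8?[case=> [//|] //].
  + have /XZ[c1 c3] : c 1%N *: X + c 2%N *: Z \in F 0 by in_filt_from hF.
    by do 8?[case=> [//|] //].
  + have /deg0_free[c2 c4] : c 3%N *: J + c 4%N *: E \in F 1 by in_filt_from hF.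
    by do 8?[case=> [//|] //].
  + by do 8?[case=> [//|] //].
  + by do 8?[case=> [//|] //].
- move=> i j /andP[]; do 8?[case: i => [|i]] => //; do 8?[case: j => [|j]] => //= _ _; rewrite /comb /= ?(actX, act0); by lmod.
Qed.

Let deg1_eq f : eig E 1 f -> exists a b,
  lie f X = (3 * b / 2) *: J + (- a) *: E /\ lie f Z = (- 3 * a / 2) *: J + (- b) *: E.
Proof.
move=> ef; have f1 : f \in F 1 by exact: (eig_mem cF fXZ rE).
have [a [b [r1 r2]]] := co2_symbol cF co f1.
have [e1 e2] := eig0_exact cF fXZ rE eX eZ (eig_lie ef eX) r1.
have [e3 e4] := eig0_exact cF fXZ rE eX eZ (eig_lie ef eZ) r2.
exists a, b; split.
  apply: (eig_eq cF fXZ rE (lexx 0) (eig_lie ef eX)).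
  - by apply: eigD; apply: eigZ.
  - by rewrite e1 !(act0, lieE); lmod.
  - by rewrite e2 !(act0, lieE); lmod.
apply: (eig_eq cF fXZ rE (lexx 0) (eig_lie ef eZ)).
- by apply: eigD; apply: eigZ.
- by rewrite e3 !(act0, lieE); lmod.
- by rewrite e4 !(act0, lieE); lmod.
Qed.

(** The candidates form a plane on which J acts as a rotation, so that one nonzero
    element f and [J,f] span it. P and Q stand for x q - 2 z w and z q + 2 x w, where
    q = x^2 + z^2. *)
Lemma conformal_cubics : (exists2 f, f \in F 1 & f \notin F 2) -> exists P Q,
  [/\ eig E 1 P /\ eig E 1 Q, lie P X = 2 *: E, lie P Z = 3 *: J,
    lie Q X = (- 3) *: J & lie Q Z = 2 *: E].
Proof.
case=> f0 f1 f2; have [//|f [ef ff ff0]] := eig_F cF fXZ rE _ f1.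
have [a [b [fX fZ]]] := deg1_eq ef.
have n0 : a ^+ 2 + b ^+ 2 != 0.
  apply: contra f2; rewrite paddr_eq0 ?sqr_ge0 // !sqrf_eq0 => /andP[/eqP a0 /eqP b0].
  suff f00 : f = 0 by move: ff0; rewrite f00 subr0.
  apply: (eig_trans cF fXZ rE (ler01 : 0 <= 1)) => //.
    by rewrite fX a0 b0; lmod.
  by rewrite fZ a0 b0; lmod.
have eJf := eig_lie eJ ef.
have JfX : lie (lie J f) X = (- 3 * a) *: J + (- 2 * b) *: E.
  by rewrite lie_jacl fX !(act0, lieE) fZ; lmod.
have JfZ : lie (lie J f) Z = (- 3 * b) *: J + (2 * a) *: E.
  by rewrite lie_jacl fZ !(act0, lieE) fX; lmod.
(* The parameters of [J,f] are 2 b and - 2 a, and those of P and Q are -2, 0 and 0, -2. *)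
exists ((- 2 * a / (a ^+ 2 + b ^+ 2)) *: f + (- b / (a ^+ 2 + b ^+ 2)) *: lie J f).
exists ((- 2 * b / (a ^+ 2 + b ^+ 2)) *: f + (a / (a ^+ 2 + b ^+ 2)) *: lie J f).
split.
- by split; apply: eigD; apply: eigZ.
- by rewrite !lieE fX JfX; lmod.
- by rewrite !lieE fZ JfZ; lmod.
- by rewrite !lieE fX JfX; lmod.
- by rewrite !lieE fZ JfZ; lmod.
Qed.

Section Hermitian.
Variables (P Q r : g).
Hypotheses (eP : eig E 1 P) (eQ : eig E 1 Q) (rPQ : r = lie P Q).
Hypotheses (PX : lie P X = 2 *: E) (PZ : lie P Z = 3 *: J)
  (QX : lie Q X = (- 3) *: J) (QZ : lie Q Z = 2 *: E).

Let act1 := (PX, PZ, QX, QZ).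
Let er : eig E 2 r. Proof. by rewrite rPQ; exact: (eig_lie eP eQ). Qed.
Let eq1 p u v q h : 0 <= p + q -> eig E p u -> eig E q v -> eig E (p + q) h ->
  lie u (lie v X) - lie v (lie u X) = lie h X ->
  lie u (lie v Z) - lie v (lie u Z) = lie h Z -> lie u v = h.
Proof.
move=> pq eu ev eh hX hZ; apply: (eig_eq cF fXZ rE pq) => //; rewrite ?lie_jacl //.
exact: (eig_lie eu ev).
Qed.
Let XP : lie X P = (- 2) *: E. Proof. by rewrite lieC PX; lmod. Qed.
Let XQ : lie X Q = 3 *: J. Proof. by rewrite lieC QX; lmod. Qed.
Let ZP : lie Z P = (- 3) *: J. Proof. by rewrite lieC PZ; lmod. Qed.
Let ZQ : lie Z Q = (- 2) *: E. Proof. by rewrite lieC QZ; lmod. Qed.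
Let YP : lie Y P = (- 4) *: Z.
Proof. by rewrite YE lie_jacl XP ZP !(lieE, actX, ZX); lmod. Qed.
Let YQ : lie Y Q = 4 *: X.
Proof. by rewrite YE lie_jacl XQ ZQ !(lieE, actX, ZX); lmod. Qed.
Let JP : lie J P = (- 2) *: Q.
Proof. by apply: (eq1 _ eJ eP (eigZ (- 2) eQ)); rewrite // !(act0, act1, lieE); lmod. Qed.
Let JQ : lie J Q = 2 *: P.
Proof. by apply: (eq1 _ eJ eQ (eigZ 2 eP)); rewrite // !(act0, act1, lieE); lmod. Qed.
Let EP : lie E P = P. Proof. by rewrite eP scale1r. Qed.
Let EQ : lie E Q = Q. Proof. by rewrite eQ scale1r. Qed.
Let Er : lie E r = 2 *: r. Proof. by rewrite er. Qed.
Let PJ : lie P J = 2 *: Q. Proof. by rewrite lieC JP; lmod. Qed.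
Let QE : lie Q E = - Q. Proof. by rewrite lieC EQ. Qed.
Let QJ : lie Q J = (- 2) *: P. Proof. by rewrite lieC JQ; lmod. Qed.
Let PE : lie P E = - P. Proof. by rewrite lieC EP. Qed.
Let rX : lie r X = (- 4) *: Q.
Proof. by rewrite rPQ lie_jacl PX QX !(lieE, PJ, QE); lmod. Qed.
Let rZ : lie r Z = 4 *: P.
Proof. by rewrite rPQ lie_jacl PZ QZ !(lieE, PE, QJ); lmod. Qed.
Let Xr : lie X r = 4 *: Q. Proof. by rewrite lieC rX; lmod. Qed.
Let Zr : lie Z r = (- 4) *: P. Proof. by rewrite lieC rZ; lmod. Qed.
Let Yr : lie Y r = 16 *: E.
Proof. by rewrite YE lie_jacl Zr Xr !(lieE, XP, ZQ); lmod. Qed.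
Let Jr : lie J r = 0.
Proof. by rewrite rPQ lie_jacr JP JQ !lieE !scaler0 addr0. Qed.
Let rY : lie r Y = (- 16) *: E. Proof. by rewrite lieC Yr; lmod. Qed.

Let deg1_span f : eig E 1 f -> exists a b, f = a *: P + b *: Q.
Proof.
move=> ef; have [a [b [fX fZ]]] := deg1_eq ef; exists (- a / 2), (- b / 2).
apply: (eig_eq cF fXZ rE ler01 ef); first by apply: eigD; apply: eigZ.
  by rewrite fX !(lieE, act1); lmod.
by rewrite fZ !(lieE, act1); lmod.
Qed.

Let deg2_span f : eig E 2 f -> exists a, f = a *: r.
Proof.
move=> ef; have [XF ZF XZ] := fXZ.
have [a [b fX]] := deg1_span (eig_lie ef eX).
have [c [d fZ]] := deg1_span (eig_lie ef eZ).
have fY : lie f Y = lie (a *: P + b *: Q) Z + lie X (c *: P + d *: Q).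
  by rewrite YE lie_jacr fX fZ.
have : (- 2 * b - 2 * c) *: X + (10 * a + 6 * d) *: Z \in F 0.
  have <- : lie f (lie X Y) = (- 2 * b - 2 * c) *: X + (10 * a + 6 * d) *: Z.
    by rewrite lie_jacr fX fY !(lieE, act1, XP, XQ, actX) (lieC P Y) (lieC Q Y) YP YQ; lmod.
  by rewrite XY lie0r mem0v.
have : (- 10 * d - 6 * a) *: X + (2 * b + 2 * c) *: Z \in F 0.
  have <- : lie f (lie Z Y) = (- 10 * d - 6 * a) *: X + (2 * b + 2 * c) *: Z.
    by rewrite lie_jacr fZ fY !(lieE, act1, XP, XQ, actX) (lieC P Y) (lieC Q Y) YP YQ; lmod.
  by rewrite ZY lie0r mem0v.
move=> /XZ[e1 _] /XZ[e2 e3].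
have a0 : a = 0 by lra.
have d0 : d = 0 by lra.
have cb : c = - b by lra.
exists (- b / 4); apply: (eig_eq cF fXZ rE (ler0n _ 2) ef); first exact: eigZ.
  by rewrite fX lieZl rX a0; lmod.
by rewrite fZ lieZl rZ cb d0; lmod.
Qed.

Let deg3_zero f : eig E 3 f -> f = 0.
Proof.
move=> ef; have [a fX] := deg2_span (eig_lie ef eX).
have [b fZ] := deg2_span (eig_lie ef eZ).
have fY : lie f Y = lie (a *: r) Z + lie X (b *: r).
  by rewrite YE lie_jacr fX fZ.
have : (12 * b) *: J + (- 24 * a) *: E \in F 1.
  have <- : lie f (lie X Y) = (12 * b) *: J + (- 24 * a) *: E.
    by rewrite lie_jacr fX fY !(lieE, rX, rZ, rY, Xr, XP, XQ); lmod.
  by rewrite XY lie0r mem0v.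
move=> /deg0_free[b0 a0].
have {}a0 : a = 0 by lra.
have {}b0 : b = 0 by lra.
apply: (eig_trans cF fXZ rE (ler0n _ 3) ef).
  by rewrite fX a0 scale0r.
by rewrite fZ b0 scale0r.
Qed.

Let F3 v : v \in F 3 -> v = 0.
Proof.
move: v; apply: (F_stable cF) => // v v3.
have [//|u [eu _ vu]] := eig_F cF fXZ rE _ v3.
by move: vu; rewrite (deg3_zero eu) subr0.
Qed.

Lemma framed_hermitian :
  exists2 b : seq g, size b = 8 & framed (fun p => [set` F p])%classic b deg_hermitian (tab_hermitian R).
Proof.
have [XF ZF XZ] := fXZ; have := frame_Y cF fXZ; rewrite -YE => Y1.
have P1 : P \in F 1 by exact: (eig_mem cF fXZ rE).
have Q1 : Q \in F 1 by exact: (eig_mem cF fXZ rE).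
have r2 : r \in F 2 by exact: (eig_mem cF fXZ rE).
exists [:: Y; X; Z; J; E; P; Q; r] => //; apply: framed_layers => //.
- by do 11?[case=> //].
- by do 11?[case=> [_|] //] => /=; apply: (eig_mem cF fXZ rE) => //.
- by do 11?[case=> [_|] //].
- move=> p; rewrite !inE => /or4P[/eqP->|/eqP->|/eqP->|/orP[/eqP->|/eqP->]] v vF.
  + have [a [u uF ->]] := Y_span cF v Y1; exists (fun=> a).
    by rewrite big_mkcond !big_ord_recl big_ord0 /=; in_filt_by u.
  + have [a [b [u uF ->]]] := frame_span cF fXZ vF; exists (nth 0 [:: 0; a; b]).
    by rewrite big_mkcond !big_ord_recl big_ord0 /=; in_filt_by u.
  + have [a [b vE]] := deg0_span vF; exists (nth 0 [:: 0; 0; 0; a; b]).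
    by rewrite big_mkcond !big_ord_recl big_ord0 /=; in_filt_by (v - (a *: J + b *: E)).
  + have [//|u [eu _ vu]] := eig_F cF fXZ rE _ vF; have [a [b uE]] := deg1_span eu.
    exists (nth 0 [:: 0; 0; 0; 0; 0; a; b]).
    by rewrite big_mkcond !big_ord_recl big_ord0 /=; rewrite uE in vu; in_filt_by (v - (a *: P + b *: Q)).
  + have [//|u [eu _ vu]] := eig_F cF fXZ rE _ vF; have [a uE] := deg2_span eu.
    exists (fun=> a).
    by rewrite big_mkcond !big_ord_recl big_ord0 /=; rewrite uE in vu; in_filt_by (v - a *: r).
- move=> p; rewrite !inE => /or4P[/eqP->|/eqP->|/eqP->|/orP[/eqP->|/eqP->]] c;
    rewrite big_mkcond !big_ord_recl big_ord0 /= => hF.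
  + have c0 : c 0%N = 0 by apply: (coef_notin _ Y1); in_filt_from hF.
    by do 11?[case=> [//|] //].
  + have /XZ[c1 c3] : c 1%N *: X + c 2%N *: Z \in F 0 by in_filt_from hF.
    by do 11?[case=> [//|] //].
  + have /deg0_free[c2 c4] : c 3%N *: J + c 4%N *: E \in F 1 by in_filt_from hF.
    by do 11?[case=> [//|] //].
  + have {}hF : c 5%N *: P + c 6%N *: Q \in F 2 by in_filt_from hF.
    have : lie (c 5%N *: P + c 6%N *: Q) X \in F 1 by in_filt.
    have -> : lie (c 5%N *: P + c 6%N *: Q) X = (- 3 * c 6%N) *: J + (2 * c 5%N) *: E.
      by rewrite !(lieE, act1); lmod.
    move=> /deg0_free[c8 c7].
    have {}c8 : c 6%N = 0 by lra.
    have {}c7 : c 5%N = 0 by lra.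
    by do 11?[case=> [//|] //].
  + have /F3 r0 : c 7%N *: r \in F 3 by in_filt_from hF.
    have : lie (lie (c 7%N *: r) X) Z \in F 1 by rewrite r0 !lie0l mem0v.
    have -> : lie (lie (c 7%N *: r) X) Z = 0 *: J + (- 8 * c 7%N) *: E.
      by rewrite !(lieE, rX, act1); lmod.
    move=> /deg0_free[_ c9].
    have {}c9 : c 7%N = 0 by lra.
    by do 11?[case=> [//|] //].
- have Pr : lie P r = 0.
    by apply: deg3_zero; exact: (eig_lie eP er).
  have Qr : lie Q r = 0.
    by apply: deg3_zero; exact: (eig_lie eQ er).
  move=> i j /andP[]; do 11?[case: i => [|i]] => //; do 11?[case: j => [|j]] => //= _ _;
    rewrite /comb /= ?(actX, act0, XP, XQ, ZP, ZQ, YP, YQ, JP, JQ, EP, EQ, Er, Xr, Zr, Yr, Jr, Pr, Qr) -?rPQ; by lmod.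
Qed.
End Hermitian.
End ConformalGraded.

(** * Isotropy algebra sl(2) *)

Section SpecialLinear.
Variables (R : realType) (g : finLieAlgType R) (F : int -> {vspace g}).
Hypothesis (cF : contact F).
Implicit Types (u v w h f : g) (p q : int).

Lemma isotropy_frame X Z x z h a b c d : contact_frame F X Z -> x \in F 0 -> z \in F 0 ->
  isotropy F X Z h a b c d -> isotropy F (X + x) (Z + z) h a b c d.
Proof.
move=> [XF ZF XZ] xF zF [h0 r1 r2]; split=> //.
  by in_filt_by (lie h X - (a *: X + b *: Z) + lie h x - a *: x - b *: z).
by in_filt_by (lie h Z - (c *: X + d *: Z) + lie h z - c *: x - d *: z).
Qed.

Lemma frame_shift X Z x z : contact_frame F X Z -> x \in F 0 -> z \in F 0 -> contact_frame F (X + x) (Z + z).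
Proof.
move=> [XF ZF XZ] xF zF; split; [in_filt|in_filt|] => a b ab; apply: XZ.
by in_filt_by (a *: (X + x) + b *: (Z + z) - a *: x - b *: z).
Qed.

Hypothesis F1 : forall v, v \in F 1 -> v = 0.

Lemma isotropy_eq X Z h h' a b c d : contact_frame F X Z ->
  isotropy F X Z h a b c d -> isotropy F X Z h' a b c d -> h = h'.
Proof.
by move=> fXZ r1 r2; apply/eqP; rewrite -subr_eq0; apply/eqP/F1/(isotropy_inj cF fXZ r1).
Qed.

Section Triple.
Variables (A H B : g).
Hypotheses (HA : lie H A = (- 2) *: A) (HB : lie H B = 2 *: B).
Hypothesis span0 : forall v, v \in F 0 -> exists a b c, v = a *: A + b *: H + c *: B.
Hypothesis free0 : forall a b c, a *: A + b *: H + c *: B = 0 -> [/\ a = 0, b = 0 & c = 0].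

(** The weights of H on F 0 are -2, 0 and 2. *)
Lemma weight_zero u k : u \in F 0 -> lie H u = k *: u -> k != 0 -> k != 2 -> k != - 2 -> u = 0.
Proof.
move=> /span0[a [b [c ->]]]; rewrite !lieE HA HB => e k0 k2 k2'.
have /free0[/eqP + /eqP + /eqP] : ((k + 2) * a) *: A + (k * b) *: H + ((k - 2) * c) *: B = 0.
  have -> : ((k + 2) * a) *: A + (k * b) *: H + ((k - 2) * c) *: B =
    k *: (a *: A + b *: H + c *: B) - (a *: (- 2 *: A) + b *: 0 + c *: (2 *: B)) by lmod.
  by rewrite -e subrr.
rewrite !mulf_eq0 addr_eq0 subr_eq0 (negPf k0) (negPf k2) (negPf k2') /=.
by move=> /eqP -> /eqP -> /eqP ->; lmod.
Qed.
End Triple.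

(** The weights -1 and 1 of H on F (-1) / F 0 do not occur in F 0, so X and Z can be chosen
    to be weight vectors. The defects in the action of A and B have odd weights and
    lie in F 0, hence vanish, and [[X,Z],X] and [[X,Z],Z] are multiples of X and Z. Invariance
    under A makes the two factors equal, and [Y,Y] = 0 with Y = [X,Z] makes
    them opposite. *)
Lemma framed_sl2 X0 Z0 A H B : contact_frame F X0 Z0 -> isotropy F X0 Z0 A 0 0 2 0 ->
  isotropy F X0 Z0 H (-1) 0 0 1 -> isotropy F X0 Z0 B 0 (-2) 0 0 ->
  (forall h a b c d, isotropy F X0 Z0 h a b c d -> d = - a) ->
  exists2 b : seq g, size b = 6 & framed (fun p => [set` F p])%classic b deg_sl2 (tab_sl2 R).
Proof.
move=> fXZ0 rA0 rH0 rB0 traceless.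
have [A0 _] := isotropyE rA0; have [H0 _] := isotropyE rH0; have [B0 _] := isotropyE rB0.
have r0 := isotropy_F1 cF fXZ0 (mem0v (F 1)).
have HA : lie H A = (- 2) *: A.
  apply: (isotropy_eq fXZ0 (isotropy_lie cF fXZ0 rH0 rA0)).
  by apply: (isotropy_cast (isotropy_scale cF (- 2) fXZ0 rA0)); ring.
have HB : lie H B = 2 *: B.
  apply: (isotropy_eq fXZ0 (isotropy_lie cF fXZ0 rH0 rB0)).
  by apply: (isotropy_cast (isotropy_scale cF 2 fXZ0 rB0)); ring.
have AB : lie A B = 4 *: H.
  apply: (isotropy_eq fXZ0 (isotropy_lie cF fXZ0 rA0 rB0)).
  by apply: (isotropy_cast (isotropy_scale cF 4 fXZ0 rH0)); ring.
have repABH a b c : isotropy F X0 Z0 (a *: A + b *: H + c *: B) (- b) (- 2 * c) (2 * a) b.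
  have -> : a *: A + b *: H + c *: B = a *: A + (b *: H + (c *: B + 0)) by lmod.
  by apply: (isotropy_cast (isotropy_lin cF _ rA0 (isotropy_lin cF _ rH0 (isotropy_lin cF _ rB0 r0)))); ring.
have span0 v : v \in F 0 -> exists a b c, v = a *: A + b *: H + c *: B.
  move=> v0; have [a [b [c [d rv]]]] := isotropy_ex cF fXZ0 v0.
  exists (c / 2), (- a), (- b / 2); apply: (isotropy_eq fXZ0 rv).
  by apply: (isotropy_cast (repABH _ _ _)); rewrite ?(traceless _ _ _ _ _ rv); field.
have free0 a b c : a *: A + b *: H + c *: B = 0 -> [/\ a = 0, b = 0 & c = 0].
  move=> e; have := repABH a b c; rewrite e => /(isotropy_uniq cF fXZ0 r0)[e1 e2 e3 e4].
  by split; lra.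
have wz := weight_zero HA HB span0 free0.
have [X [Z [fXZ rH rB HX HZ]]] : exists X Z, [/\ contact_frame F X Z /\ isotropy F X Z A 0 0 2 0,
    isotropy F X Z H (-1) 0 0 1, isotropy F X Z B 0 (-2) 0 0, lie H X = - X & lie H Z = Z].
  have [_ [x [z [xF zF HX HZ]]]] := isotropyE rH0.
  have [a1 [b1 [c1 xE]]] := span0 _ xF; have [a2 [b2 [c2 zE]]] := span0 _ zF.
  (* On the weight vectors A, H and B, the operators ad H + 1 and ad H - 1 act as -1, 1, 3
     and -3, -1, 1; the shifts are minus the preimages of the defects x and z. *)
  exists (X0 + (a1 *: A + (- b1) *: H + (- c1 / 3) *: B)).
  exists (Z0 + ((a2 / 3) *: A + b2 *: H + (- c2) *: B)).
  split; try by [split; [apply: frame_shift => //; in_filt | apply: isotropy_frame => //; in_filt] | apply: isotropy_frame => //; in_filt].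
    by rewrite !lieE HX HA HB xE; lmod.
  by rewrite !lieE HZ HA HB zE; lmod.
have [{}fXZ rA] := fXZ; have [XF ZF XZ] := fXZ.
have nz (k l : int) : k != l -> k%:~R != l%:~R :> R by move=> kl; rewrite eqr_int.
have wz' (k : int) u : k \notin [:: 0; 2; - 2] -> u \in F 0 -> lie H u = k%:~R *: u -> u = 0.
  rewrite !inE !negb_or => /and3P[k0 k2 k2'] uF uE; apply: (wz u k%:~R) => //.
  - exact: (nz k 0).
  - exact: (nz k 2).
  - by rewrite -[- 2](rmorphN (intr : int -> R) 2); exact: (nz k (- 2)).
have AX : lie A X = 0.
  apply: (wz' (- 3)) => //; first by have [_ + _] := rA; rewrite !scale0r addr0 subr0.
  by rewrite lie_jacr HA HX !lieE; lmod.
have AZ : lie A Z = 2 *: X.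
  apply/eqP; rewrite -subr_eq0; apply/eqP; apply: (wz' (- 1)) => //.
    by have [_ _ +] := rA; rewrite !scale0r addr0.
  by rewrite !lieE lie_jacr HA HX HZ !lieE; lmod.
have BX : lie B X = (- 2) *: Z.
  apply/eqP; rewrite -subr_eq0; apply/eqP; apply: (wz' 1) => //.
    by have [_ + _] := rB; rewrite !scale0r add0r.
  by rewrite !lieE lie_jacr HB HX HZ !lieE; lmod.
have BZ : lie B Z = 0.
  apply: (wz' 3) => //; first by have [_ _] := rB; rewrite !scale0r addr0 subr0.
  by rewrite lie_jacr HB HZ !lieE; lmod.
have [Y YE] : exists Y, Y = lie X Z by eexists.
have := frame_Y cF fXZ; rewrite -YE => Y1.
have AY : lie A Y = 0 by rewrite YE lie_jacr AX AZ !lieE; lmod.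
have HY : lie H Y = 0 by rewrite YE lie_jacr HX HZ !lieE; lmod.
have BY : lie B Y = 0 by rewrite YE lie_jacr BX BZ !lieE; lmod.
(* Y, X and Z have weights 0, -1 and 1, so an eigenvector has only components of its
   weight. *)
have wt u k : lie H u = k *: u -> exists a b c w, [/\ w \in F 0 /\ u = a *: Y + b *: X + c *: Z + w,
    k * a = 0, (k + 1) * b = 0, (k - 1) * c = 0 & lie H w = k *: w].
  have [a [u1 u1F ->]] := Y_span cF u Y1; have [b [c [w wF ->]]] := frame_span cF fXZ u1F.
  rewrite !lieE HY HX HZ => e.
  have HwF : lie H w \in F 0 by in_filt.
  have ka : k * a = 0.
    apply: (coef_notin _ Y1).
    have -> : (k * a) *: Y = k *: (a *: Y + (b *: X + c *: Z + w)) - k *: (b *: X + c *: Z + w) by lmod.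
    by rewrite -e; in_filt.
  have /XZ[kb kc] : ((k + 1) * b) *: X + ((k - 1) * c) *: Z \in F 0.
    have -> : ((k + 1) * b) *: X + ((k - 1) * c) *: Z =
      k *: (a *: Y + (b *: X + c *: Z + w)) - (k * a) *: Y - (b *: - X + c *: Z + lie H w)
        + lie H w - k *: w by lmod.
    by rewrite -e ka; in_filt_by (lie H w - k *: w).
  exists a, b, c, w; split=> //; first by split=> //; lmod.
  have -> : k *: w = k *: (a *: Y + (b *: X + c *: Z + w)) - (k * a) *: Y
     - ((k + 1) * b) *: X - ((k - 1) * c) *: Z + b *: X - c *: Z by lmod.
  by rewrite -e ka kb kc; lmod.
have YX : exists b, lie Y X = b *: X.
  have [|a [b [c [w [[wF uE] a0 _ c0 Hw]]]]] := wt (lie Y X) (- 1).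
    by rewrite lie_jacr HY HX !lieE; lmod.
  have w0 : w = 0 by apply: (wz' (- 1)) => //; rewrite Hw rmorphN1.
  have {}a0 : a = 0 by lra.
  have {}c0 : c = 0 by lra.
  by exists b; rewrite uE a0 c0 w0; lmod.
have YZ : exists b, lie Y Z = b *: Z.
  have [|a [b [c [w [[wF uE] a0 b0 _ Hw]]]]] := wt (lie Y Z) 1.
    by rewrite lie_jacr HY HZ !lieE; lmod.
  have w0 : w = 0 by apply: (wz' 1).
  have {}a0 : a = 0 by lra.
  have {}b0 : b = 0 by lra.
  by exists c; rewrite uE a0 b0 w0; lmod.
have [b YbX] := YX; have [b' YbZ] := YZ.
have /XZ[bb _] : (b' - b) *: X + 0 *: Z \in F 0.
  have e : lie A (lie Y Z) = 2 *: lie Y X by rewrite lie_jacr AY AZ !lieE; lmod.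
  rewrite YbX YbZ !lieE AZ in e.
  have -> : (b' - b) *: X + 0 *: Z = 2^-1 *: (b' *: (2 *: X) - 2 *: (b *: X)) by lmod.
  by rewrite e subrr scaler0 mem0v.
have b0 : b = 0.
  have : (b + b') *: Y \in F (-1).
    have -> : (b + b') *: Y = lie Y Y by rewrite {3}YE lie_jacr YbX YbZ !lieE -YE; lmod.
    by rewrite lie_alt mem0v.
  by move=> /coef_notin/(_ Y1); lra.
have b'0 : b' = 0 by lra.
have {}YX : lie Y X = 0 by rewrite YbX b0 scale0r.
have {}YZ : lie Y Z = 0 by rewrite YbZ b'0 scale0r.
have F_zero p v : 1 <= p -> v \in F p -> v = 0 by move=> p1 vF; apply/F1/(F_le cF p1 vF).
exists [:: Y; X; Z; A; H; B] => //; apply: framed_layers => //.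
- by do 8?[case=> //].
- do 8?[case=> [_|] //] => /=; exact: F_full.
- by move=> v; apply: F_zero.
- by do 8?[case=> [_|] //].
- move=> p; rewrite !inE => /or4P[/eqP->|/eqP->|/eqP->|/orP[/eqP->|/eqP->]] v vF.
  + have [a [u uF ->]] := Y_span cF v Y1; exists (fun=> a).
    by rewrite big_mkcond !big_ord_recl big_ord0 /=; in_filt_by u.
  + have [a [d [u uF ->]]] := frame_span cF fXZ vF; exists (nth 0 [:: 0; a; d]).
    by rewrite big_mkcond !big_ord_recl big_ord0 /=; in_filt_by u.
  + have [a [d [c ->]]] := span0 _ vF; exists (nth 0 [:: 0; 0; 0; a; d; c]).
    rewrite big_mkcond !big_ord_recl big_ord0 /=.
    by rewrite (_ : _ - _ = 0) ?mem0v //; lmod.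
  + have -> : v = 0 by exact: F_zero vF.
    by exists (fun=> 0); rewrite big1 ?subr0 ?mem0v // => i _; rewrite scale0r.
  + have -> : v = 0 by exact: F_zero vF.
    by exists (fun=> 0); rewrite big1 ?subr0 ?mem0v // => i _; rewrite scale0r.
- move=> p; rewrite !inE => /or4P[/eqP->|/eqP->|/eqP->|/orP[/eqP->|/eqP->]] c;
    rewrite big_mkcond !big_ord_recl big_ord0 /= => hF.
  + have c0 : c 0%N = 0 by apply: (coef_notin _ Y1); in_filt_from hF.
    by do 8?[case=> [//|] //].
  + have /XZ[c1 c3] : c 1%N *: X + c 2%N *: Z \in F 0 by in_filt_from hF.
    by do 8?[case=> [//|] //].
  + have /F1/free0[c3 c4 c5] : c 3%N *: A + c 4%N *: H + c 5%N *: B \in F 1 by in_filt_from hF.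
    by do 8?[case=> [//|] //].
  + by do 8?[case=> [//|] //].
  + by do 8?[case=> [//|] //].
- move=> i j /andP[]; do 8?[case: i => [|i]] => //; do 8?[case: j => [|j]] => //= _ _;
    rewrite /comb /= ?YX ?YZ -?YE ?AB ?HB ?(lieC A H) ?HA
      ?(lieC X A) ?(lieC X H) ?(lieC X B) ?(lieC Z A) ?(lieC Z H) ?(lieC Z B)
      ?(lieC Y A) ?(lieC Y H) ?(lieC Y B) ?AX ?AZ ?HX ?HZ ?BX ?BZ ?AY ?HY ?BY; by lmod.
Qed.
End SpecialLinear.

(** * One-dimensional isotropy *)

Section FourDimensional.
Variables (R : realType) (g : finLieAlgType R) (F : int -> {vspace g}).
Hypothesis (cF : contact F).
Implicit Types (u v w h f : g) (p q : int).

(** The normal form when J spans F 0 and F 1 vanishes. The constant b is the curvature. *)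
Record circular X Z J (alpha b : R) : Prop := Circular {
  circ_frame : contact_frame F X Z;
  circ_J : J \in F 0;
  circ_span : forall v, v \in F 0 -> exists k, v = k *: J;
  circ_JX : lie J X = (- alpha) *: X + (- 2) *: Z;
  circ_JZ : lie J Z = 2 *: X + (- alpha) *: Z;
  circ_YX : lie (lie X Z) X = b *: Z;
  circ_YZ : lie (lie X Z) Z = (- b) *: X;
  circ_ab : alpha * b = 0
}.

Lemma sq_alpha (alpha k x : R) : k != 0 -> (alpha ^+ 2 + k ^+ 2) * x = 0 -> x = 0.
Proof.
move=> k0 /eqP; rewrite mulf_eq0 paddr_eq0 ?sqr_ge0 // !sqrf_eq0 (negPf k0) andbF /=.
by move/eqP.
Qed.

(** An isotropy matrix which is not a multiple of that of J would yield minus the identity,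
    so J spans F 0 and F 1 vanishes. The matrix of J on F (-1) / F 0 is invertible and J
    commutes with itself, so X and Z can be corrected by multiples of J until J acts on them
    exactly. Equivariance under J and [Y,Y] = 0, where Y = [X,Z], then leave b only. *)
Lemma circular_exists X0 Z0 J alpha : co2_isotropy F X0 Z0 J alpha ->
  (forall h, ~ isotropy F X0 Z0 h (-1) 0 0 (-1)) ->
  exists X Z b, circular X Z J alpha b /\ forall v, v \in F 1 -> v = 0.
Proof.
move=> co noE; have [fXZ0 rJ0 conf] := co; have [J0 _] := isotropyE rJ0.
(* The relation says that the conformal matrix of s is proportional to that of J. *)
have key s a b c d : isotropy F X0 Z0 s a b c d -> 2 * a = alpha * b.
  move=> rs; have [ad bc] := conf _ _ _ _ _ rs.
  apply/eqP; rewrite -subr_eq0; apply/eqP; apply: contrapT => /eqP nz.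
  apply: (noE ((- 2 / (2 * a - alpha * b)) *: ((b / 2) *: J + s))).
  apply: (isotropy_cast (isotropy_scale cF _ fXZ0 (isotropy_lin cF _ rJ0 rs))); rewrite -?ad ?bc; field;
    by move: nz; rewrite bc.
have F12 f : f \in F 1 -> f \in F 2.
  move=> f1; have [a [b [r1 r2]]] := co2_symbol cF co f1.
  have k1 := key _ _ _ _ _ r1; have k2 := key _ _ _ _ _ r2.
  have a0 : a = 0.
    apply: (@sq_alpha (3 * alpha) 2); rewrite ?pnatr_eq0 //.
    rewrite mulrDl [X in _ + X](_ : _ = 2 * (2 * a)); last by ring.
    by rewrite k1 (_ : _ + _ = (- 3 * alpha) * (2 * b - alpha * (3 * a))); [rewrite k2 subrr mulr0|ring].
  have b0 : b = 0 by move: k2; rewrite a0; lra.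
  by apply: (F1_eq0 cF fXZ0 f1); [apply: (isotropy_cast r1)|apply: (isotropy_cast r2)]; rewrite ?a0 ?b0; ring.
have F1 v : v \in F 1 -> v = 0 by move: v; apply: (F_stable cF).
have span0 v : v \in F 0 -> exists k, v = k *: J.
  move=> v0; have [a [b [c [d rv]]]] := isotropy_ex cF fXZ0 v0.
  have [ad bc] := conf _ _ _ _ _ rv; have k := key _ _ _ _ _ rv.
  exists (- b / 2); apply: (isotropy_eq cF F1 fXZ0 rv).
  by apply: (isotropy_cast (isotropy_scale cF _ fXZ0 rJ0)); lra.
have [X [Z [fXZ JX JZ]]] : exists X Z, [/\ contact_frame F X Z,
    lie J X = (- alpha) *: X + (- 2) *: Z & lie J Z = 2 *: X + (- alpha) *: Z].
  have [_ [x [z [/span0[u ->] /span0[v ->] JX JZ]]]] := isotropyE rJ0.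
  have n0 : alpha ^+ 2 + 4 != 0 by rewrite gt_eqF // ltr_wpDl ?sqr_ge0.
  (* The shifts of X0 and Z0 by multiples s and t of J make the action of J exact when
     2 t + alpha s = - u and alpha t - 2 s = - v. *)
  exists (X0 + ((2 * v - alpha * u) / (alpha ^+ 2 + 4)) *: J).
  exists (Z0 + ((- alpha * v - 2 * u) / (alpha ^+ 2 + 4)) *: J).
  split; first exact: (frame_shift cF fXZ0 (F_scale _ J0) (F_scale _ J0)).
    by rewrite !lieE JX; lmod.
  by rewrite !lieE JZ; lmod.
have [XF ZF XZ] := fXZ.
have [Y YE] : exists Y, Y = lie X Z by eexists.
have := frame_Y cF fXZ; rewrite -YE => Y1.
have J_nz : J != 0.
  apply/eqP => e; have /XZ[_] : (- alpha) *: X + (- 2) *: Z \in F 0.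
    by rewrite -JX e lie0l mem0v.
  by lra.
have span v : exists a b c d, v = a *: Y + b *: X + c *: Z + d *: J.
  have [a [u1 u1F ->]] := Y_span cF v Y1; have [b [c [w wF ->]]] := frame_span cF fXZ u1F.
  by have [d ->] := span0 _ wF; exists a, b, c, d; rewrite !addrA.
have free a b c d : a *: Y + b *: X + c *: Z + d *: J = 0 -> [/\ a = 0, b = 0, c = 0 & d = 0].
  move=> e; have a0 : a = 0.
    apply: (coef_notin _ Y1).
    have -> : a *: Y = 0 - (b *: X + c *: Z + d *: J) by rewrite -e; lmod.
    by in_filt.
  have /XZ[b0 c0] : b *: X + c *: Z \in F 0.
    have -> : b *: X + c *: Z = 0 - (a *: Y + d *: J) by rewrite -e; lmod.
    by rewrite a0 scale0r add0r; in_filt.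
  split=> //; move: e; rewrite a0 b0 c0 !scale0r !add0r => /eqP.
  by rewrite scaler_eq0 (negPf J_nz) orbF => /eqP.
have JY : lie J Y = (- 2 * alpha) *: Y by rewrite YE lie_jacr JX JZ !lieE; lmod.
have JYX : lie J (lie Y X) = (- 3 * alpha) *: lie Y X + (- 2) *: lie Y Z.
  by rewrite lie_jacr JY JX !lieE; lmod.
have JYZ : lie J (lie Y Z) = 2 *: lie Y X + (- 3 * alpha) *: lie Y Z.
  by rewrite lie_jacr JY JZ !lieE; lmod.
have YY : lie (lie Y X) Z + lie X (lie Y Z) = 0 by rewrite -lie_jacr -YE lie_alt.
have [uY [uX [uZ [uJ uE]]]] := span (lie Y X).
have [vY [vX [vZ [vJ vE]]]] := span (lie Y Z).
have actE a b c d : lie J (a *: Y + b *: X + c *: Z + d *: J) =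
   (- 2 * alpha * a) *: Y + (- alpha * b + 2 * c) *: X + (- 2 * b - alpha * c) *: Z + 0 *: J.
  by rewrite !lieE JY JX JZ; lmod.
have [e1 e2 e3 e4] : [/\ alpha * uY + 2 * vY = 0, 2 * alpha * uX + 2 * uZ + 2 * vX = 0,
    2 * alpha * uZ - 2 * uX + 2 * vZ = 0 & 3 * alpha * uJ + 2 * vJ = 0].
  apply: free; transitivity (lie J (lie Y X) - ((- 3 * alpha) *: lie Y X + (- 2) *: lie Y Z)).
    by rewrite uE actE vE; lmod.
  by rewrite JYX subrr.
have [e5 e6 e7 e8] : [/\ alpha * vY - 2 * uY = 0, 2 * alpha * vX + 2 * vZ - 2 * uX = 0,
    2 * alpha * vZ - 2 * vX - 2 * uZ = 0 & 3 * alpha * vJ - 2 * uJ = 0].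
  apply: free; transitivity (lie J (lie Y Z) - (2 *: lie Y X + (- 3 * alpha) *: lie Y Z)).
    by rewrite vE actE uE; lmod.
  by rewrite JYZ subrr.
have uY0 : uY = 0.
  apply: (@sq_alpha alpha 2); rewrite ?pnatr_eq0 //.
  by rewrite (_ : (_ + _) * uY = alpha * (alpha * uY + 2 * vY) - 2 * (alpha * vY - 2 * uY)); [rewrite e1 e5; ring|ring].
have vY0 : vY = 0 by move: e1; rewrite uY0; lra.
have uJ0 : uJ = 0.
  apply: (@sq_alpha (3 * alpha) 2); rewrite ?pnatr_eq0 //.
  by rewrite (_ : (_ + _) * uJ = 3 * alpha * (3 * alpha * uJ + 2 * vJ) - 2 * (3 * alpha * vJ - 2 * uJ)); [rewrite e4 e8; ring|ring].
have vJ0 : vJ = 0 by move: e4; rewrite uJ0; lra.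
have vZE : vZ = - uX.
  have : (uX + vZ) *: Y = 0.
    by rewrite -[RHS]YY uE vE uY0 uJ0 vY0 vJ0 !lieE -YE; lmod.
  move=> e; have : (uX + vZ) *: Y \in F (-1) by rewrite e mem0v.
  by move=> /coef_notin/(_ Y1); lra.
have uX0 : uX = 0.
  apply: (@sq_alpha alpha 2); rewrite ?pnatr_eq0 //.
  rewrite (_ : (_ + _) * uX = alpha * (2 * alpha * uX + 2 * uZ + 2 * vX) / 2
    - (2 * alpha * uZ - 2 * uX + 2 * vZ) / 2 - (2 * alpha * vX + 2 * vZ - 2 * uX) / 2).
    by rewrite e2 e3 e6; lra.
  by rewrite vZE; field.
have vZ0 : vZ = 0 by rewrite vZE uX0 oppr0.
have vXE : vX = - uZ by move: e2; rewrite uX0; lra.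
exists X, Z, uZ; split=> //; split=> //.
- by rewrite -YE uE uY0 uX0 uJ0; lmod.
- by rewrite -YE vE vY0 vZ0 vJ0 vXE; lmod.
- by move: e3; rewrite uX0 vZ0; lra.
Qed.

(** The reflection exchanging X and Z reverses the rotation, whence the signs. *)
Lemma circular_swap X Z J alpha b : circular X Z J alpha b -> circular Z X (- J) (- alpha) b.
Proof.
case=> fXZ J0 span JX JZ YX YZ ab; split.
- exact: frame_swap.
- by rewrite rpredN.
- by move=> v /span[k ->]; exists (- k); lmod.
- by rewrite lieNl JZ; lmod.
- by rewrite lieNl JX; lmod.
- by rewrite (lieC Z X) lieNl YZ; lmod.
- by rewrite (lieC Z X) lieNl YX; lmod.
- by rewrite mulNr ab oppr0.
Qed.

Lemma circular_scale X Z J alpha b k : k != 0 -> circular X Z J alpha b ->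
  circular (k *: X) (k *: Z) J alpha (k ^+ 2 * b).
Proof.
move=> k0 [fXZ J0 span JX JZ YX YZ ab]; have [XF ZF XZ] := fXZ; split=> //.
- split; [in_filt|in_filt|] => a c; rewrite !scalerA => /XZ[/eqP + /eqP].
  by rewrite !mulf_eq0 (negPf k0) !orbF => /eqP -> /eqP ->.
- by rewrite lieZr JX; lmod.
- by rewrite lieZr JZ; lmod.
- by rewrite !lieE YX; lmod.
- by rewrite !lieE YZ; lmod.
- by rewrite mulrCA ab mulr0.
Qed.

(** The sign of alpha is changed by the reflection, and b is scaled by squares. *)
Lemma circular_normal X Z J alpha b : circular X Z J alpha b ->
  exists X Z J alpha b, [/\ circular X Z J alpha b, 0 <= alpha & [\/ b = 0, b = 4 | b = - 4]].
Proof.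
wlog alpha0 : X Z J alpha / 0 <= alpha.
  move=> W c; have [a0|a0] := lerP 0 alpha; first exact: (W X Z J alpha).
  by apply: (W Z X (- J) (- alpha)); [rewrite oppr_ge0 ltW|exact: circular_swap].
move=> c; have [b0|b0] := eqVneq b 0.
  by exists X, Z, J, alpha, b; split=> //; exact: Or31.
pose k := Num.sqrt (4 / `|b|).
have k2 : k ^+ 2 = 4 / `|b| by rewrite sqr_sqrtr // divr_ge0.
have k0 : k != 0 by rewrite sqrtr_eq0 -ltNge divr_gt0 // normr_gt0.
exists (k *: X), (k *: Z), J, alpha, (k ^+ 2 * b); split=> //.
  exact: circular_scale.
rewrite k2; have [b1|b1] := lerP 0 b.
  by rewrite (ger0_norm b1); apply: Or32; rewrite mulfVK.
by rewrite (ltr0_norm b1) invrN mulrN mulNr mulfVK //; exact: Or33.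
Qed.

Lemma framed_circular X Z J alpha b : (forall v, v \in F 1 -> v = 0) ->
  circular X Z J alpha b ->
  exists2 s : seq g, size s = 4 & framed (fun p => [set` F p])%classic s deg_circular (tab_circular alpha b).
Proof.
move=> F1 [fXZ J0 span0 JX JZ YX YZ ab]; have [XF ZF XZ] := fXZ.
have [Y YE] : exists Y, Y = lie X Z by eexists.
rewrite -YE in YX YZ; have := frame_Y cF fXZ; rewrite -YE => Y1.
have JY : lie J Y = (- 2 * alpha) *: Y by rewrite YE lie_jacr JX JZ !lieE; lmod.
have J_nz : J \notin F 1.
  apply/negP => /F1 e; have /XZ[_] : (- alpha) *: X + (- 2) *: Z \in F 0.
    by rewrite -JX e lie0l mem0v.
  by lra.
have F_zero p v : 1 <= p -> v \in F p -> v = 0 by move=> p1 vF; apply/F1/(F_le cF p1 vF).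
exists [:: Y; X; Z; J] => //; apply: framed_layers => //.
- by do 8?[case=> //].
- do 8?[case=> [_|] //] => /=; exact: F_full.
- by move=> v; apply: F_zero.
- by do 8?[case=> [_|] //].
- move=> p; rewrite !inE => /or4P[/eqP->|/eqP->|/eqP->|/orP[/eqP->|/eqP->]] v vF.
  + have [a [u uF ->]] := Y_span cF v Y1; exists (fun=> a).
    by rewrite big_mkcond !big_ord_recl big_ord0 /=; in_filt_by u.
  + have [a [d [u uF ->]]] := frame_span cF fXZ vF; exists (nth 0 [:: 0; a; d]).
    by rewrite big_mkcond !big_ord_recl big_ord0 /=; in_filt_by u.
  + have [a ->] := span0 _ vF; exists (fun=> a).
    rewrite big_mkcond !big_ord_recl big_ord0 /=.
    by rewrite (_ : _ - _ = 0) ?mem0v //; lmod.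
  + have -> : v = 0 by exact: F_zero vF.
    by exists (fun=> 0); rewrite big1 ?subr0 ?mem0v // => i _; rewrite scale0r.
  + have -> : v = 0 by exact: F_zero vF.
    by exists (fun=> 0); rewrite big1 ?subr0 ?mem0v // => i _; rewrite scale0r.
- move=> p; rewrite !inE => /or4P[/eqP->|/eqP->|/eqP->|/orP[/eqP->|/eqP->]] c;
    rewrite big_mkcond !big_ord_recl big_ord0 /= => hF.
  + have c0 : c 0%N = 0 by apply: (coef_notin _ Y1); in_filt_from hF.
    by do 8?[case=> [//|] //].
  + have /XZ[c1 c3] : c 1%N *: X + c 2%N *: Z \in F 0 by in_filt_from hF.
    by do 8?[case=> [//|] //].
  + have c3 : c 3%N = 0 by apply: (coef_notin _ J_nz); in_filt_from hF.
    by do 8?[case=> [//|] //].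
  + by do 8?[case=> [//|] //].
  + by do 8?[case=> [//|] //].
- move=> i j /andP[]; do 8?[case: i => [|i]] => //; do 8?[case: j => [|j]] => //= _ _;
    rewrite /comb /= ?YX ?YZ -?YE ?(lieC Y J) ?(lieC X J) ?(lieC Z J) ?JY ?JX ?JZ; by lmod.
Qed.
End FourDimensional.

(** * Existence of a normal form *)

Section Existence.
Variables (R : realType) (g : finLieAlgType R) (F : int -> {vspace g}).
Hypotheses (cF : contact F) (irrF : irreducible F).
Implicit Types (u v w h f : g) (p q : int).

Definition has_frame d t := exists2 b : seq g, size b = size d &
  framed (fun p => [set` F p])%classic b d (t : nat -> nat -> seq (R * nat)).

Lemma F12_cases : (forall v, v \in F 1 -> v = 0) \/ exists2 f, f \in F 1 & f \notin F 2.
Proof.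
have [H|H] := pselect (exists2 f, f \in F 1 & f \notin F 2); first by right.
left; apply: (F_stable cF) => // v vF.
by apply: contrapT => v2; apply: H; exists v => //; apply/negP.
Qed.

Lemma classification : [\/ has_frame deg_projective (tab_projective R) \/ has_frame deg_gl2 (tab_gl2 R),
  has_frame deg_sl2 (tab_sl2 R), has_frame deg_hermitian (tab_hermitian R) \/ has_frame deg_similitude (tab_similitude R) |
  exists alpha b : R, [/\ has_frame deg_circular (tab_circular alpha b), 0 <= alpha,
    alpha * b = 0 & [\/ b = 0, b = 4 | b = - 4]]].
Proof.
have [X0 [Z0 [fXZ0 cases]]] := isotropy_cases cF irrF.
have [[E rE0]|noE] := pselect (exists E, isotropy F X0 Z0 E (-1) 0 0 (-1)); last first.
  case: cases => [[J [alpha co]]|[A [H [B [rA rH rB]]]]].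
    have [|X [Z [b [circ F1]]]] := circular_exists cF co.
      by move=> h rh; apply: noE; exists h.
    have [X' [Z' [J' [al [b' [circ' al0 b'0]]]]]] := circular_normal cF circ.
    by apply: Or44; exists al, b'; split=> //; [exact: (framed_circular cF F1 circ')|case: circ'].
  have traceless h a b c d : isotropy F X0 Z0 h a b c d -> d = - a.
    move=> rh; apply/eqP; rewrite -addr_eq0; apply: contrapT => /negP nz.
    apply: noE; exists ((- 2 / (d + a)) *: ((- (c / 2)) *: A + ((- (d - a) / 2) *: H + ((b / 2) *: B + h)))).
    apply: (isotropy_cast (isotropy_scale cF _ fXZ0 (isotropy_lin cF _ rA (isotropy_lin cF _ rH (isotropy_lin cF _ rB rh))))); by field.
  have F1 v : v \in F 1 -> v = 0.
    move: v; apply: (F_stable cF) => // f f1.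
    have [a [d [r1 r2]]] := sl2_symbol cF fXZ0 rA rH rB f1.
    have a0 := traceless _ _ _ _ _ r1; have d0 := traceless _ _ _ _ _ r2.
    by apply: (F1_eq0 cF fXZ0 f1); [apply: (isotropy_cast r1)|apply: (isotropy_cast r2)]; lra.
  by apply: Or42; have [b sb fb] := framed_sl2 cF F1 fXZ0 rA rH rB traceless; exists b.
have [X [Z [fXZ eX eZ repXZ]]] := graded_frame cF fXZ0 rE0.
have rE := repXZ _ _ _ _ _ rE0.
have lift h a b c d : isotropy F X0 Z0 h a b c d -> exists2 h', eig E 0 h' & isotropy F X Z h' a b c d.
  by move=> /repXZ/(eig0_lift cF fXZ rE eX eZ)[h' [e r _ _]]; exists h'.
case: cases => [[J0 [alpha co]]|[A0 [H0 [B0 [rA0 rH0 rB0]]]]].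
  have {}co : co2_isotropy F X Z J0 alpha.
    have [_ rJ conf] := co; split=> //; first exact: repXZ.
    move=> s a b c d rs; have [s0 _] := isotropyE rs.
    have [a' [b' [c' [d' rs']]]] := isotropy_ex cF fXZ0 s0.
    have [-> -> -> ->] := isotropy_uniq cF fXZ rs (repXZ _ _ _ _ _ rs').
    exact: conf rs'.
  have rJ' : isotropy F X Z (J0 + (- alpha) *: E) 0 (-2) 2 0.
    have [_ rJ _] := co; rewrite addrC.
    by apply: (isotropy_cast (isotropy_lin cF _ rE rJ)); ring.
  have [J [eJ rJ _ _]] := eig0_lift cF fXZ rE eX eZ rJ'.
  apply: Or43; have [F1|/(conformal_cubics cF co rE eX eZ eJ rJ)] := F12_cases.
    right; have [b sb fb] := framed_similitude cF co rE eX eZ eJ rJ erefl F1.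
    by exists b.
  move=> [P [Q [[eP eQ] PX PZ QX QZ]]]; left.
  have [b sb fb] := framed_hermitian cF co rE eX eZ eJ rJ erefl eP eQ erefl PX PZ QX QZ.
  by exists b.
have [A eA rA] := lift _ _ _ _ _ rA0; have [H eH rH] := lift _ _ _ _ _ rH0.
have [B eB rB] := lift _ _ _ _ _ rB0; apply: Or41.
have [F1|] := F12_cases.
  right; have [b sb fb] := framed_gl2_affine cF fXZ rE eX eZ eA eH eB rA rH rB erefl erefl F1.
  by exists b.
move=> /(split_quadrics cF fXZ rE eX eZ eA eH eB rA rH rB erefl)[P [Q [[eP eQ] PX PZ QX QZ]]].
left; have [b sb fb] := framed_projective cF fXZ rE eX eZ eA eH eB rA rH rB erefl erefl
  eP eQ erefl PX PZ QX QZ.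
by exists b.
Qed.
End Existence.

(** * Rigidity of the four-dimensional algebras *)

Section Uniqueness.
Variables (R : realType) (g : finLieAlgType R) (F : int -> {vspace g}).
Hypotheses (F2 : F (-2) = fullv).
Implicit Types (u v w h f : g) (p q : int).
Local Open Scope classical_set_scope.

Lemma circular_coordinates alpha b : has_frame F deg_circular (tab_circular alpha b) ->
  exists Y X Z J : g,
  [/\ [/\ lie X Z = Y, lie X J = alpha *: X + 2 *: Z & lie Z J = (-2) *: X + alpha *: Z],
      [/\ lie Y X = b *: Z, lie Y Z = (- b) *: X & lie Y J = (2 * alpha) *: Y],
      forall a1 a2 a3 a4, a1 *: Y + a2 *: X + a3 *: Z + a4 *: J = 0 ->
        [/\ a1 = 0, a2 = 0, a3 = 0 & a4 = 0],
      forall v, v \in F 0 <-> exists a, v = a *: J &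
      forall v, v \in F (-1) <-> exists a1 a2 a3, v = a1 *: X + a2 *: Z + a3 *: J].
Proof.
case=> [[|Y [|X [|Z [|J []]]]]] //= _ [_ free_b fil tab]; exists Y, X, Z, J; split.
- have := tab 1%N 2 isT; have := tab 1%N 3 isT; have := tab 2%N 3 isT.
  by rewrite /comb /= => -> -> ->; split; lmod.
- have := tab 0%N 1%N isT; have := tab 0%N 2 isT; have := tab 0%N 3 isT.
  by rewrite /comb /= => -> -> ->; split; lmod.
- move=> a1 a2 a3 a4 e; have := free_b (nth 0 [:: a1; a2; a3; a4]).
  rewrite !big_ord_recl big_ord0 /= => H.
  have {}H i : (i < 4)%N -> nth 0 [:: a1; a2; a3; a4] i = 0.
    by apply: H; rewrite -[RHS]e; lmod.
  by split; [exact: (H 0%N)|exact: (H 1%N)|exact: (H 2%N)|exact: (H 3%N)].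
- move=> v; have -> : v \in F 0 <-> span_deg [:: Y; X; Z; J] deg_circular 0 v by rewrite -fil.
  split=> [[c ->]|[a ->]].
    by exists (c 3%N); rewrite big_mkcond !big_ord_recl big_ord0 /=; lmod.
  by exists (fun=> a); rewrite big_mkcond !big_ord_recl big_ord0 /=; lmod.
move=> v; have -> : v \in F (-1) <-> span_deg [:: Y; X; Z; J] deg_circular (-1) v by rewrite -fil.
split=> [[c ->]|[a [b' [c ->]]]].
  by exists (c 1%N), (c 2%N), (c 3%N); rewrite big_mkcond !big_ord_recl big_ord0 /=; lmod.
by exists (nth 0 [:: 0; a; b'; c]); rewrite big_mkcond !big_ord_recl big_ord0 /=; lmod.
Qed.

(** The lines F 0 of the two bases agree, so J' = k J. As X' and Z' form an invariant
    complement of F 0 in F (-1), they are combinations of X and Z alone. The eigenvalues of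
    J, up to the factor k, then give k^2 = 1, and the change of basis is a similitude, which
    multiplies b by the square n of its ratio. *)
Lemma circular_unique alpha b alpha' b' : 0 <= alpha -> 0 <= alpha' ->
  has_frame F deg_circular (tab_circular alpha b) -> has_frame F deg_circular (tab_circular alpha' b') ->
  alpha = alpha' /\ exists2 n : R, 0 < n & b' = n * b.
Proof.
move=> al0 al'0 /circular_coordinates[Y [X [Z [J [[XZ XJ ZJ] [YX YZ YJ] free F0 F1]]]]].
move=> /circular_coordinates[Y' [X' [Z' [J' [[XZ' XJ' ZJ'] [YX' YZ' YJ'] free' F0' F1']]]]].
have [k J'E] : exists k, J' = k *: J.
  by apply/F0/F0'; exists 1; rewrite scale1r.
have [x1 [x2 [x3 X'E]]] : exists a1 a2 a3, X' = a1 *: X + a2 *: Z + a3 *: J.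
  by apply/F1/F1'; exists 1, 0, 0; lmod.
have [z1 [z2 [z3 Z'E]]] : exists a1 a2 a3, Z' = a1 *: X + a2 *: Z + a3 *: J.
  by apply/F1/F1'; exists 0, 1, 0; lmod.
have [_ eX1 eX2 eX3] : [/\ 0 = 0 :> R, k * (alpha * x1 - 2 * x2) - (alpha' * x1 + 2 * z1) = 0,
    k * (2 * x1 + alpha * x2) - (alpha' * x2 + 2 * z2) = 0 & - (alpha' * x3 + 2 * z3) = 0].
  apply: free; transitivity (lie X' J' - (alpha' *: X' + 2 *: Z')); last by rewrite XJ' subrr.
  by rewrite J'E X'E Z'E !lieE XJ ZJ; lmod.
have [_ eZ1 eZ2 eZ3] : [/\ 0 = 0 :> R, k * (alpha * z1 - 2 * z2) - (alpha' * z1 - 2 * x1) = 0,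
    k * (2 * z1 + alpha * z2) - (alpha' * z2 - 2 * x2) = 0 & - (alpha' * z3 - 2 * x3) = 0].
  apply: free; transitivity (lie Z' J' - ((-2) *: X' + alpha' *: Z')); last by rewrite ZJ' subrr.
  by rewrite J'E X'E Z'E !lieE XJ ZJ; lmod.
have x30 : x3 = 0.
  apply: (@sq_alpha _ alpha' 2); rewrite ?pnatr_eq0 //.
  by rewrite (_ : (_ + _) * x3 = - alpha' * - (alpha' * x3 + 2 * z3) + 2 * - (alpha' * z3 - 2 * x3));
    [rewrite eX3 eZ3; ring|ring].
have z30 : z3 = 0 by move: eX3; rewrite x30; lra.
pose e := x1 * z2 - x2 * z1.
have Y'E : Y' = e *: Y.
  by rewrite -XZ' X'E Z'E x30 z30 !lieE (lieC Z X) XZ /e; lmod.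
have Y'0 : Y' != 0.
  apply/eqP => Y0; have [] := free' 1 0 0 0; last by move/eqP; rewrite oner_eq0.
  by rewrite Y0; lmod.
have e0 : e != 0 by apply: contra Y'0; rewrite Y'E => /eqP ->; rewrite scale0r.
have [/eqP eY _ _ _] : [/\ 2 * e * (k * alpha - alpha') = 0, 0 = 0 :> R, 0 = 0 :> R & 0 = 0 :> R].
  apply: free; transitivity (lie Y' J' - (2 * alpha') *: Y'); last by rewrite YJ' subrr.
  by rewrite J'E Y'E !lieE YJ; lmod.
have {eY} al'E : alpha' = k * alpha.
  move: eY; rewrite !mulf_eq0 pnatr_eq0 (negPf e0) /= subr_eq0 => /eqP -> //.
have z1E : z1 = - (k * x2) by move: eX1; rewrite al'E; lra.
have z2E : z2 = k * x1 by move: eX2; rewrite al'E; lra.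
have n0 : 0 < x1 ^+ 2 + x2 ^+ 2.
  rewrite lt_neqAle addr_ge0 ?sqr_ge0 // andbT eq_sym; apply: contra e0.
  rewrite paddr_eq0 ?sqr_ge0 // !sqrf_eq0 /e => /andP[/eqP -> /eqP ->].
  by rewrite !mul0r subrr.
have kk x y : k * (k * x) = x -> k * (k * y) = y -> 0 < x ^+ 2 + y ^+ 2 -> k ^+ 2 = 1.
  move=> ex ey xy; have : (x ^+ 2 + y ^+ 2) * (k ^+ 2 - 1) = 0.
    by rewrite -[RHS](subrr (x * x + y * y)) -{3}ex -{3}ey; ring.
  by move/eqP; rewrite mulf_eq0 (gt_eqF xy) subr_eq0 => /eqP.
have k2 : k ^+ 2 = 1.
  apply: (kk x1 x2) => //; first by move: eZ1; rewrite z1E z2E al'E; lra.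
  by move: eZ2; rewrite z1E z2E al'E; lra.
have k0 : k != 0 by apply: contra_eqN k2 => /eqP ->; rewrite expr0n eq_sym oner_eq0.
split.
  have : (k - 1) * (k + 1) == 0 by rewrite -subr_sqr k2 expr1n subrr.
  rewrite mulf_eq0 subr_eq0 addr_eq0 => /orP[/eqP k1|/eqP k1].
    by rewrite al'E k1 mul1r.
  by move: al'0; rewrite al'E k1; lra.
exists (x1 ^+ 2 + x2 ^+ 2) => //.
have [_ f1 f2 _] : [/\ 0 = 0 :> R, - (e * b * x2) - b' * z1 = 0, e * b * x1 - b' * z2 = 0 & 0 = 0 :> R].
  apply: free; transitivity (lie Y' X' - b' *: Z'); last by rewrite YX' subrr.
  by rewrite Y'E X'E Z'E x30 z30 !lieE YX YZ; lmod.
rewrite z1E in f1; rewrite z2E in f2.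
have eE : e = k * (x1 ^+ 2 + x2 ^+ 2) by rewrite /e z1E z2E; ring.
rewrite eE in f1 f2.
apply/eqP; rewrite -subr_eq0; apply/eqP; apply: (mulfI k0); apply: (mulfI (lt0r_neq0 n0)).
rewrite !mulr0 (_ : _ * _ = x2 * (- (k * (x1 ^+ 2 + x2 ^+ 2) * b * x2) - b' * - (k * x2))
   - x1 * (k * (x1 ^+ 2 + x2 ^+ 2) * b * x1 - b' * (k * x1))); last by ring.
by rewrite f1 f2; ring.
Qed.

End Uniqueness.

(** * Adapted bases of the matrix algebras *)

Section MatrixModels.
Variable R : realType.
Local Open Scope classical_set_scope.

(** The degrees -2, -1, -1, 0 of the basis reproduce the three nontrivial steps. *)
Lemma framed_four_step (A : lieAlgType R) (G G' G0 : set A) (Y X Z J : A) t :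
  (forall a b c d, a *: Y + b *: X + c *: Z + d *: J = 0 ->
     [/\ a = 0, b = 0, c = 0 & d = 0]) ->
  (forall v, G v <-> exists a b c d, v = a *: Y + b *: X + c *: Z + d *: J) ->
  (forall v, G' v <-> exists b c d, v = b *: X + c *: Z + d *: J) ->
  (forall v, G0 v <-> exists d, v = d *: J) ->
  (forall i j, (i < j < 4)%N ->
    lie (nth 0 [:: Y; X; Z; J] i) (nth 0 [:: Y; X; Z; J] j) = comb [:: Y; X; Z; J] (t i j)) ->
  framed (@filtration R (four_step G G' G0)) [:: Y; X; Z; J] deg_circular t.
Proof.
move=> free GE G'E G0E tab; split=> //.
- by do 8?[case=> //].
- move=> c; rewrite !big_ord_recl big_ord0 /= => e.
  have [|c0 c1 c2 c3] := free (c 0%N) (c 1%N) (c 2%N) (c 3%N).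
    by rewrite -[RHS]e addr0 !addrA.
  by do 8?[case=> [_|] //].
move=> p; rewrite predeqE => v.
have spanE : span_deg [:: Y; X; Z; J] deg_circular p v <-> exists c : nat -> R,
    v = (if p <= -2 then c 0%N *: Y else 0) + ((if p <= -1 then c 1%N *: X else 0) +
       ((if p <= -1 then c 2%N *: Z else 0) + ((if p <= 0 then c 3%N *: J else 0) + 0))).
  by split=> -[c ->]; exists c; rewrite big_mkcond !big_ord_recl big_ord0.
rewrite spanE /=; case: (lerP p (-2)) => [p2|p2].
  have [-> ->] : p <= -1 /\ p <= 0 by split; lia.
  rewrite GE; split=> [[a [b [c [d ->]]]]|[c ->]].
    by exists (nth 0 [:: a; b; c; d]) => /=; rewrite addr0 !addrA.
  by exists (c 0%N), (c 1%N), (c 2%N), (c 3%N); rewrite addr0 !addrA.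
case: eqP => [->|/eqP p1] /=.
  rewrite G'E; split=> [[b [c [d ->]]]|[c ->]].
    by exists (nth 0 [:: 0; b; c; d]) => /=; rewrite addr0 add0r !addrA.
  by exists (c 1%N), (c 2%N), (c 3%N); rewrite addr0 add0r !addrA.
have -> : (p <= -1) = false by apply/negbTE; rewrite -ltNge; lia.
case: eqP => [->|/eqP p0] /=.
  rewrite G0E; split=> [[d ->]|[c ->]].
    by exists (fun=> d); rewrite addr0 !add0r.
  by exists (c 3%N); rewrite addr0 !add0r.
have -> : (p <= 0) = false by apply/negbTE; rewrite -ltNge; lia.
by split=> [->|[_ ->]]; [exists (fun=> 0)|]; rewrite !addr0.
Qed.

Lemma mx2E (T : pzRingType) (A : 'M[T]_2) : A = mx2 (A 0 0) (A 0 1) (A 1 0) (A 1 1).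
Proof.
apply/matrixP => i j; rewrite mxE.
by case: i j => [[|[|//]] pi] [[|[|//]] pj] //=; congr (A _ _); apply/val_inj.
Qed.
Lemma mx2_inj (T : pzRingType) (a b c d a' b' c' d' : T) :
  mx2 a b c d = mx2 a' b' c' d' -> [/\ a = a', b = b', c = c' & d = d'].
Proof.
move=> /matrixP e; have := e 0 0; have := e 0 1; have := e 1 0; have := e 1 1.
by rewrite !mxE.
Qed.
Lemma mx2D (T : pzRingType) (a b c d a' b' c' d' : T) :
  mx2 a b c d + mx2 a' b' c' d' = mx2 (a + a') (b + b') (c + c') (d + d').
Proof. by apply/matrixP => i j; rewrite !mxE; do 2?case: ifP. Qed.
Lemma mx2N (T : pzRingType) (a b c d : T) : - mx2 a b c d = mx2 (- a) (- b) (- c) (- d).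
Proof. by apply/matrixP => i j; rewrite !mxE; do 2?case: ifP. Qed.
Lemma mx2Z (T : pzRingType) (k a b c d : T) :
  k *: mx2 a b c d = mx2 (k * a) (k * b) (k * c) (k * d).
Proof. by apply/matrixP => i j; rewrite !mxE; do 2?case: ifP. Qed.
Lemma mx2M (T : pzRingType) (a b c d a' b' c' d' : T) :
  mx2 a b c d *m mx2 a' b' c' d' =
  mx2 (a * a' + b * c') (a * b' + b * d') (c * a' + d * c') (c * b' + d * d').
Proof.
apply/matrixP => i j; rewrite !mxE !big_ord_recl big_ord0 !mxE addr0 /=.
by do 2?case: ifP.
Qed.
Lemma mx20 (T : pzRingType) : (0 : 'M[T]_2) = mx2 0 0 0 0.
Proof. by apply/matrixP => i j; rewrite !mxE; do 2?case: ifP. Qed.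

Lemma framed_gl2 : exists2 s : seq (gl2 R), size s = 4 &
  framed (@filtration R (gl2_model R)) s deg_circular (tab_circular (0 : R) (- 4)).
Proof.
exists [:: mx2 0 2 (-2) 0; mx2 1 0 0 (-1); mx2 0 1 1 0; mx2 1 1 (-1) 1] => //.
have combE (a b c d : R) : a *: mx2 0 2 (-2) 0 + b *: mx2 1 0 0 (-1) + c *: mx2 0 1 1 0 +
    d *: mx2 1 1 (-1) 1 = mx2 (b + d) (2 * a + c + d) (- 2 * a + c - d) (- b + d) :> 'M[R]_2.
  by rewrite !mx2Z !mx2D; congr mx2; ring.
apply: framed_four_step.
- move=> a b c d; rewrite [LHS]combE [RHS](mx20 R) => /mx2_inj[e1 e2 e3 e4].
  by split; lra.
- move=> v; split=> // _; rewrite [v]mx2E.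
  move: (v 0 0) (v 0 1) (v 1 0) (v 1 1) => a b c d.
  exists ((b - c - (a + d)) / 4), ((a - d) / 2), ((b + c) / 2), ((a + d) / 2).
  by rewrite [RHS]combE; congr mx2; field.
- move=> v; split=> [[x [y [z ->]]]|[b [c [d ->]]]].
    exists y, z, x; have := combE 0 y z x; rewrite scale0r add0r => ->.
    by congr mx2; ring.
  exists d, b, c; have := combE 0 b c d; rewrite scale0r add0r => ->.
  by congr mx2; ring.
- move=> v; split=> [[x ->]|[d ->]].
    by exists x; rewrite [RHS]mx2Z; congr mx2; ring.
  by exists d; rewrite [LHS]mx2Z; congr mx2; ring.
move=> i j /andP[]; do 5?[case: i => [|i]] => //; do 5?[case: j => [|j]] => //= _ _;
  rewrite /comb /= /lie /= /mx_lie ?mx2Z !mx2M ?mx2N ?mx20 ?mx2D; congr mx2; ring.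
Qed.

Local Open Scope complex_scope.

Lemma framed_u2 : exists2 s : seq (gl2C R), size s = 4 &
  framed (@filtration R (u2_model R)) s deg_circular (tab_circular (0 : R) 4).
Proof.
pose Y : gl2C R := mx2 0 (- 2)%:C 2%:C 0.
pose X : gl2C R := mx2 'i 0 0 (- 'i).
pose Z : gl2C R := mx2 0 'i 'i 0.
pose J : gl2C R := mx2 'i 1 (- 1) 'i.
exists [:: Y; X; Z; J] => //.
have combE (a b c d : R) : a *: Y + b *: X + c *: Z + d *: J =
    mx2 (0 +i* (b + d)) ((- 2 * a + d) +i* c) ((2 * a - d) +i* c) (0 +i* (- b + d)).
  change (a%:C *: (mx2 0 (- 2)%:C 2%:C 0 : 'M[R[i]]_2) + b%:C *: mx2 'i 0 0 (- 'i)
    + c%:C *: mx2 0 'i 'i 0 + d%:C *: mx2 'i 1 (- 1) 'i =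
    mx2 (0 +i* (b + d)) ((- 2 * a + d) +i* c) ((2 * a - d) +i* c) (0 +i* (- b + d))).
  rewrite !mx2Z !mx2D; congr mx2; simpc; congr (_ +i* _); ring.
apply: framed_four_step.
- move=> a b c d; rewrite combE => e; have := etrans e (mx20 R[i]).
  move=> /mx2_inj[/eqP + /eqP + _ /eqP]; rewrite !eq_complex /=.
  move=> /andP[_ /eqP e1] /andP[/eqP e2 /eqP e3] /andP[_ /eqP e4].
  by split; lra.
- move=> v; split=> [/= /matrixP uv|[a [b [c [d ->]]]]]; last first.
    rewrite combE; apply/matrixP => i j; rewrite !mxE.
    by case: i j => [[|[|//]] pi] [[|[|//]] pj] /=; simpc; congr (_ +i* _); ring.
  have := uv 0 0; have := uv 0 1; have := uv 1 1; rewrite !mxE {uv}.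
  case e00: (v 0 0) => [a1 a2]; case e01: (v 0 1) => [b1 b2].
  case e10: (v 1 0) => [c1 c2]; case e11: (v 1 1) => [d1 d2].
  move=> /eqP + /eqP + /eqP; rewrite !eq_complex /=.
  move=> /andP[/eqP d10 _] /andP[/eqP bc1 /eqP bc2] /andP[/eqP a10 _].
  exists (((a2 + d2) / 2 - b1) / 2), ((a2 - d2) / 2), b2, ((a2 + d2) / 2).
  rewrite combE [v in LHS]mx2E e00 e01 e10 e11.
  congr mx2; congr (_ +i* _); lra.
- move=> v; split=> [[x [y [z ->]]]|[b [c [d ->]]]].
    exists y, z, x; have := combE 0 y z x; rewrite scale0r add0r => ->.
    by congr mx2; simpc; congr (_ +i* _); ring.
  exists d, b, c; have := combE 0 b c d; rewrite scale0r add0r => ->.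
  by congr mx2; simpc; congr (_ +i* _); ring.
- move=> v; split=> [[x ->]|[d ->]].
    exists x; have := combE 0 0 0 x; rewrite !scale0r !add0r => ->.
    by congr mx2; simpc; congr (_ +i* _); ring.
  exists d; have := combE 0 0 0 d; rewrite !scale0r !add0r => ->.
  by congr mx2; simpc; congr (_ +i* _); ring.
have scE (k : R) (p q r s : R[i]) : k *: (mx2 p q r s : gl2C R) =
    (mx2 (k%:C * p) (k%:C * q) (k%:C * r) (k%:C * s) : gl2C R) by exact: mx2Z.
have adE (p q r s p' q' r' s' : R[i]) : (mx2 p q r s : gl2C R) + (mx2 p' q' r' s' : gl2C R) =
    (mx2 (p + p') (q + q') (r + r') (s + s') : gl2C R) by exact: mx2D.
have zeE : (0 : gl2C R) = mx2 0 0 0 0 by exact: mx20.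
have liE (p q r s p' q' r' s' : R[i]) : lie (mx2 p q r s : gl2C R) (mx2 p' q' r' s' : gl2C R) =
    (mx2 (q * r' - q' * r) (p * q' + q * s' - (p' * q + q' * s))
         (r * p' + s * r' - (r' * p + s' * r)) (r * q' - r' * q) : gl2C R).
  rewrite [LHS](_ : _ = mx2 p q r s *m mx2 p' q' r' s' - mx2 p' q' r' s' *m mx2 p q r s) //.
  by rewrite !mx2M mx2N mx2D; congr mx2; ring.
move=> i j /andP[]; do 5?[case: i => [|i]] => //; do 5?[case: j => [|j]] => //= _ _;
  rewrite /comb /= /Y /X /Z /J liE ?scE zeE ?adE; congr mx2; simpc; congr (_ +i* _); ring.
Qed.
End MatrixModels.

(** * The classification *)

Section Assembly.
Variable R : realType.

Definition model_deg (m : model R) : seq int :=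
  match m with
  | ModelI1 => deg_projective | ModelI2 => deg_gl2 | ModelI3 => deg_sl2 | ModelI4 => deg_hermitian
  | ModelI5 => deg_similitude | ModelI6 _ _ | ModelII1 | ModelII2 => deg_circular
  end.

Definition model_tab (m : model R) : nat -> nat -> seq (R * nat) :=
  match m with
  | ModelI1 => tab_projective R | ModelI2 => tab_gl2 R | ModelI3 => tab_sl2 R
  | ModelI4 => tab_hermitian R | ModelI5 => tab_similitude R
  | ModelI6 alpha _ => tab_circular alpha 0
  | ModelII1 => tab_circular 0 (- 4) | ModelII2 => tab_circular 0 4
  end.

Lemma model_framed (m : model R) : exists s : seq (ambient (model_algebra m)),
  [/\ size s = size (model_deg m),
    framed (@filtration R (model_algebra m)) s (model_deg m) (model_tab m) &
    @carrier R (model_algebra m) = @filtration R (model_algebra m) (-2)].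
Proof.
case: m => [|||||alpha a0||] /=.
- by have [frm ca] := framed_projective_poly R; eexists; split; [|exact: frm|exact: ca].
- by have [frm ca] := framed_gl2_poly R; eexists; split; [|exact: frm|exact: ca].
- by have [frm ca] := framed_sl2_poly R; eexists; split; [|exact: frm|exact: ca].
- by have [frm ca] := framed_hermitian_poly R; eexists; split; [|exact: frm|exact: ca].
- by have [frm ca] := framed_similitude_poly R; eexists; split; [|exact: frm|exact: ca].
- by have [frm ca] := framed_circular_poly alpha; eexists; split; [|exact: frm|exact: ca].
- by have [s ss frm] := framed_gl2 R; exists s.
- by have [s ss frm] := framed_u2 R; exists s.
Qed.

Variables (g : finLieAlgType R) (F : int -> {vspace g}).
Hypothesis F2 : F (-2) = fullv.

Lemma iso_has_frame (m : model R) :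
  filtered_iso F (model_algebra m) <-> has_frame F (model_deg m) (model_tab m).
Proof.
have [s [ss frm ca]] := model_framed m.
rewrite (iso_framed F2 ca frm) ss; split=> [[b sb fb]|[b sb fb]]; by exists b.
Qed.

Lemma has_frame_size d d' t t' : has_frame F d t -> has_frame F d' t' -> size d = size d'.
Proof.
move=> [b sb fb] [b' sb' fb'].
by rewrite -sb -sb' (framed_size F2 fb) (framed_size F2 fb').
Qed.

Lemma has_frame_inj (m m' : model R) :
  has_frame F (model_deg m) (model_tab m) -> has_frame F (model_deg m') (model_tab m') ->
  m = m'.
Proof.
move=> frm frm'; have := has_frame_size frm frm'.
case: m m' frm frm' => [|||||alpha a0||] [|||||alpha' a0'||] //= frm frm' _;
  (have [//|//|al [n n0 b]] := circular_unique _ _ frm frm'); try by []; try by (exfalso; lra).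
by subst alpha'; congr ModelI6; exact: bool_irrelevance.
Qed.
End Assembly.

Theorem theorem3 (R : realType) (g : finLieAlgType R)
    (F : int -> {vspace g}) :
  contact F -> irreducible F ->
  exists! m : model R, filtered_iso F (model_algebra m).
Proof.
move=> cF irrF; have F2 : F (-2) = fullv by exact: (contact_full cF).
suff [m frm] : exists m, has_frame F (model_deg m) (model_tab m).
  exists m; split; first exact/iso_has_frame.
  by move=> m' /(iso_has_frame F2); exact: (has_frame_inj F2).
have [[f|f]|f|[f|f]|[alpha [b [f a0 ab b_cases]]]] := classification cF irrF.
- by exists (ModelI1 R).
- by exists (ModelI2 R).
- by exists (ModelI3 R).
- by exists (ModelI4 R).
- by exists (ModelI5 R).
case: b_cases => bE; rewrite {}bE in f ab.
- by exists (ModelI6 a0).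
- have alpha0 : alpha = 0 by lra.
  by exists (ModelII2 R); rewrite alpha0 in f.
- have alpha0 : alpha = 0 by lra.
  by exists (ModelII1 R); rewrite alpha0 in f.
Qed.
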